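(* Let $R$ be an F-finite, locally equidimensional Noetherian ring of prime characteristic $p$. For $e\ge 0$ define $a_e:\operatorname{Spec}(R)\to\mathbb{Q}$ by $a_e(P)=a_e(R_P)$ (the $e$-th Frobenius splitting number of $R_P$) and $s_e:\operatorname{Spec}(R)\to\mathbb{Q}$ by $s_e(P)=s_e(R_P)$ (the $e$-th normalized Frobenius splitting number of $R_P$). Then for every $e\ge 0$ both $s_e$ and $a_e$ are lower semicontinuous functions on $\operatorname{Spec}(R)$. Moreover, on each connected component of $\operatorname{Spec}(R)$ the functions $a_e$ and $s_e$ are proportional (with a possibly different factor of proportionality on each component).
   Context: All rings are commutative Noetherian of prime characteristic $p$, and $q = p^e$. For a ring $R$ of prime characteristic $p$ and $e \ge 0$, let $R^{(e)}$ be the $R$-algebra that equals $R$ as a ring, with $R$-algebra structure $r\cdot s = r^{q}s$ for $r\in R$, $s\in R^{(e)}$. $R$ is F-finite if $R^{(e)}$ is a finitely generated $R$-module for all $e$; this property passes to localizations. For a local ring $(R,\mathfrak m,k)$ of prime characteristic $p$, let $E=E_R(k)$ be the injective hull of $k$ and $\psi: k\to E$ the natural injection. Put $K_e := \operatorname{Im}(1\otimes\psi : R^{(e)}\otimes_R k \to R^{(e)}\otimes_R E)$, which has finite length as an $R^{(e)}$-module. The $e$-th normalized Frobenius splitting number of $R$ is $$s_e(R) := \frac{\lambda_{R^{(e)}}(K_e)}{q^{\dim R}},$$ where $\lambda$ denotes length. If moreover $R$ is F-finite, let $\alpha(R)=\log_p[k:k^p]$; the $e$-th Frobenius splitting number of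 $R$ is $a_e(R) := s_e(R)\cdot q^{\dim(R)+\alpha(R)}$. A local ring $R$ is equidimensional if $\dim(R/P)=\dim(R)$ for all minimal primes $P$ of $R$; a ring $R$ is locally equidimensional if $R_P$ is equidimensional for all $P\in\operatorname{Spec}(R)$. A function $f:X\to\mathbb R$ on a topological space is lower semicontinuous if $\{x\in X: f(x)>r\}$ is open for every $r\in\mathbb R$; $\operatorname{Spec}(R)$ carries the Zariski topology. *)

(* Defs.v *)
From HB Require Import structures.
From mathcomp Require Import all_boot all_order all_algebra.
From mathcomp Require Import generic_quotient ring_quotient.
From mathcomp Require Import all_classical all_reals all_analysis.
From mathcomp Require Import ring.

Set Implicit Arguments.
Unset Strict Implicit.
Unset Printing Implicit Defensive.

Import Order.TTheory GRing.Theory Num.Theory.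

Local Open Scope classical_set_scope.
Local Open Scope quotient_scope.
Local Open Scope ring_scope.

Definition has_chain T (F : set (set T)) (n : nat) : Prop :=
  exists c : nat -> set T,
    (forall i, (i <= n)%N -> F (c i)) /\
    (forall i, (i < n)%N -> c i `<` c i.+1).

(* The largest length of a strict chain c 0 `<` ... `<` c n in F. It is only
   meaningful when such a largest length exists; otherwise the value is 0. *)
Definition max_chain T (F : set (set T)) : nat :=
  xget 0%N [set n | has_chain F n /\ forall m, has_chain F m -> (m <= n)%N].

(* This repackages [prime_idealr R], which lives in too large a universe to be
   the carrier of a topology. *)
Record Spec (R : comNzRingType) : Type := PrimeIdeal {
  prime_pred :> R -> bool;
  prime_pred_ideal : idealr_closed prime_pred;
  prime_pred_prime : prime_idealr_closed prime_pred }.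

Canonical Spec_predType (R : comNzRingType) := PredType (@prime_pred R).

HB.instance Definition _ (R : comNzRingType) (P : Spec R) :=
  isIdealr.Build R (prime_pred P) (prime_pred_ideal P).
HB.instance Definition _ (R : comNzRingType) (P : Spec R) :=
  isPrimeIdealrClosed.Build R (prime_pred P) (@prime_pred_prime R P).

Definition prime_ideal (R : comNzRingType) (P : Spec R) : prime_idealr R :=
  prime_pred P.

Definition krull_dim (R : comNzRingType) : nat :=
  max_chain [set I : set R | exists P : Spec R, I = [set x | x \in P]].

Definition submodule (R : pzRingType) (M : lmodType R) (N : set M) : Prop :=
  N 0 /\ forall (a : R) (u v : M), N u -> N v -> N (a *: u + v).

Definition fin_gen (R : pzRingType) (M : lmodType R) (N : set M) : Prop :=
  exists s : seq M,
    N = [set x | exists c : 'I_(size s) -> R, x = \sum_i c i *: s`_i].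

Definition noetherian (R : pzRingType) : Prop :=
  forall I : set R^o, submodule I -> fin_gen I.

(* N is meant to be a submodule of M: its own submodules are then those of M
   that it contains. *)
Definition length (R : pzRingType) (M : lmodType R) (N : set M) : nat :=
  max_chain [set L : set M | submodule L /\ L `<=` N].

Definition injective_module (R : pzRingType) (E : lmodType R) : Prop :=
  forall (A B : lmodType R) (i : {linear A -> B}) (f : {linear A -> E}),
    injective i -> exists g : {linear B -> E}, forall a, g (i a) = f a.

Definition injective_hull (R : pzRingType) (M E : lmodType R)
    (psi : {linear M -> E}) : Prop :=
  [/\ injective_module E, injective psi &
      forall N : set E, submodule N -> N `&` range psi = [set 0] -> N = [set 0]].

Section Tensor.
Variables (R : pzRingType) (A : comAlgType R) (M : lmodType R).

(* Formal sums of pure tensors are finite sequences of pairs, added by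
   concatenation; the tensor product is their quotient by the congruence
   generated by the bilinearity relations. *)
Inductive tens_eq : seq (A * M) -> seq (A * M) -> Prop :=
| TensRefl l : tens_eq l l
| TensSym l1 l2 : tens_eq l1 l2 -> tens_eq l2 l1
| TensTrans l1 l2 l3 : tens_eq l1 l2 -> tens_eq l2 l3 -> tens_eq l1 l3
| TensCat l1 l2 l1' l2' :
    tens_eq l1 l1' -> tens_eq l2 l2' -> tens_eq (l1 ++ l2) (l1' ++ l2')
| TensC l1 l2 : tens_eq (l1 ++ l2) (l2 ++ l1)
| TensDl a b m : tens_eq [:: (a + b, m)] [:: (a, m); (b, m)]
| TensDr a m n : tens_eq [:: (a, m + n)] [:: (a, m); (a, n)]
| TensZ r a m : tens_eq [:: (r *: a, m)] [:: (a, r *: m)]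
| Tens0 m : tens_eq [:: (0, m)] [::].

Definition tens_rel (l1 l2 : seq (A * M)) : bool := `[< tens_eq l1 l2 >].

Lemma tens_rel_equiv : equiv_class_of tens_rel.
Proof.
split.
- by move=> l; apply/asboolP; exact: TensRefl.
- by move=> l1 l2; apply/asboolP/asboolP; exact: TensSym.
- move=> l2 l1 l3 /asboolP h1 /asboolP h2; apply/asboolP.
  exact: TensTrans h1 h2.
Qed.
Canonical tens_rel_canonical := EquivRelPack tens_rel_equiv.
Canonical tens_rel_enc := defaultEncModRel tens_rel.

Definition tensor : Type := {eq_quot tens_rel}.
HB.instance Definition _ := EqQuotient.on tensor.
HB.instance Definition _ := Choice.on tensor.

Implicit Types (x y z : tensor) (l : seq (A * M)).

Lemma tensorP l1 l2 : tens_eq l1 l2 <-> \pi_tensor l1 = \pi_tensor l2.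
Proof. by split=> [h|/eqmodP/asboolP//]; apply/eqmodP/asboolP. Qed.

Lemma tens_repr l : tens_eq (repr (\pi_tensor l)) l.
Proof. by apply/tensorP; rewrite reprK. Qed.

Lemma tensW (K : tensor -> Prop) : (forall l, K (\pi_tensor l)) -> forall x, K x.
Proof. by move=> h x; rewrite -[x]reprK. Qed.

Definition tens_scl a l := [seq (a * u.1, u.2) | u <- l].

Lemma tens_scl_eq a l1 l2 : tens_eq l1 l2 -> tens_eq (tens_scl a l1) (tens_scl a l2).
Proof.
elim=> [l|{}l1 {}l2 _|{}l1 {}l2 l3 _ h1 _|{}l1 {}l2 l1' l2' _ h1 _ h2
       |{}l1 {}l2|b c m|b m n|r b m|m] /=.
- exact: TensRefl.
- exact: TensSym.
- exact: TensTrans.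
- by rewrite /tens_scl !map_cat; exact: TensCat.
- by rewrite /tens_scl !map_cat; exact: TensC.
- by rewrite mulrDr; exact: TensDl.
- exact: TensDr.
- by rewrite -scalerAr; exact: TensZ.
- by rewrite mulr0; exact: Tens0.
Qed.

Definition tens_zero : tensor := \pi_tensor [::].
Definition tens_add x y : tensor := \pi_tensor (repr x ++ repr y).
Definition tens_scale a x : tensor := \pi_tensor (tens_scl a (repr x)).
Definition tens_opp x : tensor := tens_scale (-1) x.

Lemma tens_addE l1 l2 :
  tens_add (\pi_tensor l1) (\pi_tensor l2) = \pi_tensor (l1 ++ l2).
Proof. by apply/tensorP; apply: TensCat; exact: tens_repr. Qed.

Lemma tens_scaleE a l : tens_scale a (\pi_tensor l) = \pi_tensor (tens_scl a l).
Proof. by apply/tensorP; apply: tens_scl_eq; exact: tens_repr. Qed.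

Lemma tens_addA : associative tens_add.
Proof.
by elim/tensW=> x; elim/tensW=> y; elim/tensW=> z; rewrite !tens_addE catA.
Qed.

Lemma tens_addC : commutative tens_add.
Proof.
by elim/tensW=> x; elim/tensW=> y; rewrite !tens_addE; apply/tensorP/TensC.
Qed.

Lemma tens_add0 : left_id tens_zero tens_add.
Proof. by elim/tensW=> x; rewrite tens_addE. Qed.

Lemma tens_scaleDl x a b :
  tens_scale (a + b) x = tens_add (tens_scale a x) (tens_scale b x).
Proof.
elim/tensW: x => l; rewrite !tens_scaleE tens_addE; apply/tensorP.
elim: l => [|[c m] l IH] /=; first exact: TensRefl.
apply: (@TensTrans _ ([:: (a * c, m)] ++ [:: (b * c, m)] ++
                      (tens_scl a l ++ tens_scl b l))).
  by rewrite catA -[_ :: _]cat1s mulrDl; apply: TensCat => //; exact: TensDl.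
rewrite -(cat1s _ (_ ++ _)); apply: TensCat; first exact: TensRefl.
rewrite -(cat1s _ (tens_scl b l)) !catA.
by apply: TensCat; [exact: TensC|exact: TensRefl].
Qed.

Lemma tens_scale0 x : tens_scale 0 x = tens_zero.
Proof.
elim/tensW: x => l; rewrite tens_scaleE; apply/tensorP.
elim: l => [|[c m] l IH] /=; first exact: TensRefl.
rewrite mul0r -cat1s -[[::]]cats0; apply: TensCat => //; exact: Tens0.
Qed.

Lemma tens_scale1 : left_id 1 tens_scale.
Proof.
elim/tensW=> l; rewrite tens_scaleE; congr (\pi_tensor _).
by rewrite -[RHS]map_id; apply: eq_map => -[c m]; rewrite mul1r.
Qed.

Lemma tens_addN : left_inverse tens_zero tens_opp tens_add.
Proof.
by move=> x; rewrite -{2}[x]tens_scale1 -tens_scaleDl addNr tens_scale0.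
Qed.

HB.instance Definition _ :=
  GRing.isZmodule.Build tensor tens_addA tens_addC tens_add0 tens_addN.

Lemma tens_scaleA a b x : tens_scale a (tens_scale b x) = tens_scale (a * b) x.
Proof.
elim/tensW: x => l; rewrite !tens_scaleE; congr (\pi_tensor _).
by rewrite /tens_scl -map_comp; apply: eq_map => -[c m]; rewrite /= mulrA.
Qed.

Lemma tens_scaleDr : right_distributive tens_scale +%R.
Proof.
move=> a; elim/tensW=> l1; elim/tensW=> l2.
rewrite -[_ + _]/(tens_add _ _) -[RHS]/(tens_add _ _).
by rewrite !(tens_addE, tens_scaleE) /tens_scl map_cat.
Qed.

HB.instance Definition _ := GRing.Zmodule_isLmodule.Build A tensor
  tens_scaleA tens_scale1 tens_scaleDr (fun x a b => tens_scaleDl x a b).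

End Tensor.

Section TensorMap.
Variables (R : pzRingType) (A : comAlgType R) (M N : lmodType R).
Variable f : {linear M -> N}.

Definition tens_map (x : tensor A M) : tensor A N :=
  \pi_(tensor A N) [seq (u.1, f u.2) | u <- repr x].

Lemma tens_mapE l :
  tens_map (\pi_(tensor A M) l) = \pi_(tensor A N) [seq (u.1, f u.2) | u <- l].
Proof.
apply/tensorP; have := tens_repr l; move: (repr _) => l'.
elim=> {l l'} [l|l1 l2 _|l1 l2 l3 _ h1 _|l1 l2 l1' l2' _ h1 _ h2
       |l1 l2|b c m|b m n|r b m|m] /=.
- exact: TensRefl.
- exact: TensSym.
- exact: TensTrans.
- by rewrite !map_cat; exact: TensCat.
- by rewrite !map_cat; exact: TensC.
- exact: TensDl.
- by rewrite linearD; exact: TensDr.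
- by rewrite linearZ; exact: TensZ.
- exact: Tens0.
Qed.
End TensorMap.
Arguments tens_map {R} A {M N} f x.

Section FrobeniusAlgebra.
Variables (p : nat) (R : comNzRingType) (chRp : p \in [pchar R]) (e : nat).

Definition frob_alg & p \in [pchar R] & nat : Type := R.
Local Notation Re := (frob_alg chRp e).

HB.instance Definition _ := GRing.ComNzRing.on Re.

Definition frob_scale (r : R) (s : Re) : Re := (r ^+ (p ^ e) : R) * (s : R).

Lemma frob_scaleA a b v : frob_scale a (frob_scale b v) = frob_scale (a * b) v.
Proof. by rewrite /frob_scale exprMn mulrA. Qed.

Lemma frob_scale1 : left_id 1 frob_scale.
Proof. by move=> s; rewrite /frob_scale expr1n mul1r. Qed.

Lemma frob_scaleDr : right_distributive frob_scale +%R.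
Proof. by move=> r s t; rewrite /frob_scale mulrDr. Qed.

Lemma frob_scaleDl v : {morph frob_scale^~ v : a b / a + b}.
Proof.
move=> a b; rewrite /frob_scale exprDn_pchar ?mulrDl //.
by rewrite (eq_pnat _ (pcharf_eq chRp)) pnatX pnat_id ?(pcharf_prime chRp).
Qed.

HB.instance Definition _ := GRing.Zmodule_isLmodule.Build R Re
  frob_scaleA frob_scale1 frob_scaleDr frob_scaleDl.

Lemma frob_scaleAl (a : R) (u v : Re) : a *: (u * v) = a *: u * v.
Proof. exact: mulrA. Qed.

Lemma frob_scaleAr (a : R) (u v : Re) : a *: (u * v) = u * (a *: v).
Proof. exact: mulrCA. Qed.

HB.instance Definition _ := GRing.Lmodule_isLalgebra.Build R Re frob_scaleAl.
HB.instance Definition _ := GRing.Lalgebra_isAlgebra.Build R Re frob_scaleAr.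

End FrobeniusAlgebra.

Definition F_finite (p : nat) (R : comNzRingType) (chRp : p \in [pchar R]) : Prop :=
  forall e, fin_gen [set: frob_alg chRp e].

Section QuotientModule.
Variables (R : comNzRingType) (I : idealr R).
Local Notation Q := {ideal_quot I}.

Definition quot_scale (r : R) (x : Q) : Q := \pi_Q r * x.

Lemma quot_scaleA a b v : quot_scale a (quot_scale b v) = quot_scale (a * b) v.
Proof. by rewrite /quot_scale mulrA rmorphM. Qed.

Lemma quot_scale1 : left_id 1 quot_scale.
Proof. by move=> x; rewrite /quot_scale rmorph1 mul1r. Qed.

Lemma quot_scaleDr : right_distributive quot_scale +%R.
Proof. by move=> r x y; rewrite /quot_scale mulrDr. Qed.

Lemma quot_scaleDl v : {morph quot_scale^~ v : a b / a + b}.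
Proof. by move=> a b; rewrite /quot_scale rmorphD mulrDl. Qed.

HB.instance Definition _ := GRing.Zmodule_isLmodule.Build R Q
  quot_scaleA quot_scale1 quot_scaleDr quot_scaleDl.
End QuotientModule.

(* [idealr] only has proper ideals as elements, so that [max_ideal] is the
   unique maximal ideal. *)
Record localRing := LocalRing {
  local_ring :> comNzRingType;
  max_ideal : idealr local_ring;
  max_idealP : forall I : idealr local_ring, {subset I <= max_ideal} }.

Definition residue_field (R : localRing) : Type := {ideal_quot max_ideal R}.
HB.instance Definition _ (R : localRing) := GRing.ComNzRing.on (residue_field R).
HB.instance Definition _ (R : localRing) := GRing.Lmodule.on (residue_field R).

Definition equidimensional (R : localRing) : Prop :=
  forall P : Spec R,
    (forall Q : Spec R, {subset Q <= P} -> {subset P <= Q}) ->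
    krull_dim {ideal_quot (prime_ideal P)} = krull_dim R.

(* The degree [k : k^p]: the size of a basis of k over the subfield k^p. *)
Definition frob_degree (p : nat) (k : comNzRingType) : nat :=
  xget 0%N [set n | exists b : 'I_n -> k, forall y : k,
    exists! c : 'I_n -> k,
      (forall i, exists z, c i = z ^+ p) /\ y = \sum_i c i * b i].

(* The truncated logarithm is exact here, [k : k^p] being a power of p when it
   is finite. *)
Definition alpha (p : nat) (R : localRing) : nat :=
  trunc_log p (frob_degree p (residue_field R)).

Section SplittingNumbers.
Variables (p : nat) (R : localRing) (chRp : p \in [pchar R]) (e : nat).

Definition K_ (E : lmodType R) (psi : {linear residue_field R -> E})
    : set (tensor (frob_alg chRp e) E) :=
  range (tens_map (frob_alg chRp e) psi).

(* An injective hull exists and is unique up to isomorphism, so that the set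
   below is a singleton and the default value 0 is never used. *)
Definition s_ : rat :=
  xget 0 [set v | exists (E : lmodType R) (psi : {linear residue_field R -> E}),
    injective_hull psi /\
    v = (length (K_ psi))%:R / ((p ^ e) ^ krull_dim R)%:R].

Definition a_ : rat := s_ * ((p ^ e) ^ (krull_dim R + alpha p R))%:R.
End SplittingNumbers.

Section Localization.
Variables (R : comNzRingType) (P : Spec R).

Inductive fraction_at := FractionAt { frac_at :> R * R; _ : frac_at.2 \notin P }.
HB.instance Definition _ := [isSub for frac_at].
HB.instance Definition _ := [Choice of fraction_at by <:].

Implicit Types f g : fraction_at.

Lemma notin_mul a b : a \notin P -> b \notin P -> a * b \notin P.
Proof. by move=> ha hb; rewrite prime_idealrM negb_or ha. Qed.

Lemma notin_1 : (1 : R) \notin P.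
Proof. by rewrite idealr1. Qed.

Lemma den_atP f : f.2 \notin P. Proof. by case: f. Qed.

Definition mk_frac a s (hs : s \notin P) : fraction_at :=
  @FractionAt (a, s) hs.

Definition loc_eq f g : Prop :=
  exists2 t, t \notin P & t * (f.1 * g.2) = t * (g.1 * f.2).
Definition loc_rel f g : bool := `[< loc_eq f g >].

Lemma loc_rel_equiv : equiv_class_of loc_rel.
Proof.
split.
- by move=> f; apply/asboolP; exists 1 => //; exact: notin_1.
- by move=> f g; apply/asboolP/asboolP => -[t ht h]; exists t.
- move=> g f h /asboolP[t ht e1] /asboolP[u hu e2]; apply/asboolP.
  exists (t * u * g.2); first by rewrite !notin_mul ?den_atP.
  have -> : t * u * g.2 * (f.1 * h.2) = t * (f.1 * g.2) * (u * h.2) by ring.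
  have -> : t * u * g.2 * (h.1 * f.2) = u * (h.1 * g.2) * (t * f.2) by ring.
  by rewrite e1 -e2; ring.
Qed.
Canonical loc_rel_canonical := EquivRelPack loc_rel_equiv.
Canonical loc_rel_enc := defaultEncModRel loc_rel.

Definition loc : Type := {eq_quot loc_rel}.
HB.instance Definition _ := EqQuotient.on loc.
HB.instance Definition _ := Choice.on loc.

Lemma locP f g : loc_eq f g <-> \pi_loc f = \pi_loc g.
Proof. by split=> [h|/eqmodP/asboolP//]; apply/eqmodP/asboolP. Qed.

Lemma locW (K : loc -> Prop) : (forall f, K (\pi_loc f)) -> forall x, K x.
Proof. by move=> h x; rewrite -[x]reprK. Qed.

Lemma loc_repr f : loc_eq (repr (\pi_loc f)) f.
Proof. by apply/locP; rewrite reprK. Qed.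

Definition add_frac f g :=
  mk_frac (f.1 * g.2 + g.1 * f.2) (notin_mul (den_atP f) (den_atP g)).
Definition mul_frac f g :=
  mk_frac (f.1 * g.1) (notin_mul (den_atP f) (den_atP g)).
Definition opp_frac f := mk_frac (- f.1) (den_atP f).

Definition loc0 : loc := \pi_loc (mk_frac 0 notin_1).
Definition loc1 : loc := \pi_loc (mk_frac 1 notin_1).
Definition loc_add (x y : loc) : loc := \pi_loc (add_frac (repr x) (repr y)).
Definition loc_mul (x y : loc) : loc := \pi_loc (mul_frac (repr x) (repr y)).
Definition loc_opp (x : loc) : loc := \pi_loc (opp_frac (repr x)).

Lemma loc_addE f g : loc_add (\pi_loc f) (\pi_loc g) = \pi_loc (add_frac f g).
Proof.
apply/locP; have [t ht e1] := loc_repr f; have [u hu e2] := loc_repr g.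
exists (t * u); first exact: notin_mul.
move: e1 e2; move: (repr _) => f'; move: (repr _) => g' /= e1 e2.
have -> : t * u * ((f'.1 * g'.2 + g'.1 * f'.2) * (f.2 * g.2)) =
  t * (f'.1 * f.2) * (u * g'.2 * g.2) + u * (g'.1 * g.2) * (t * f'.2 * f.2).
  by ring.
by rewrite e1 e2; ring.
Qed.

Lemma loc_mulE f g : loc_mul (\pi_loc f) (\pi_loc g) = \pi_loc (mul_frac f g).
Proof.
apply/locP; have [t ht e1] := loc_repr f; have [u hu e2] := loc_repr g.
exists (t * u); first exact: notin_mul.
move: e1 e2; move: (repr _) => f'; move: (repr _) => g' /= e1 e2.
have -> : t * u * (f'.1 * g'.1 * (f.2 * g.2)) =
  t * (f'.1 * f.2) * (u * (g'.1 * g.2)) by ring.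
by rewrite e1 e2; ring.
Qed.

Lemma loc_oppE f : loc_opp (\pi_loc f) = \pi_loc (opp_frac f).
Proof.
apply/locP; have [t ht e1] := loc_repr f; exists t => //=.
by rewrite !mulNr !mulrN e1.
Qed.

Lemma loc_eqW f g : f.1 * g.2 = g.1 * f.2 -> \pi_loc f = \pi_loc g.
Proof. by move=> h; apply/locP; exists 1; [exact: notin_1|rewrite h]. Qed.

Lemma loc_addA : associative loc_add.
Proof.
elim/locW=> x; elim/locW=> y; elim/locW=> z; rewrite !loc_addE.
by apply: loc_eqW => /=; ring.
Qed.

Lemma loc_addC : commutative loc_add.
Proof.
elim/locW=> x; elim/locW=> y; rewrite !loc_addE.
by apply: loc_eqW => /=; ring.
Qed.

Lemma loc_add0 : left_id loc0 loc_add.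
Proof.
by elim/locW=> x; rewrite !loc_addE; apply: loc_eqW => /=; ring.
Qed.

Lemma loc_addN : left_inverse loc0 loc_opp loc_add.
Proof.
by elim/locW=> x; rewrite loc_oppE !loc_addE; apply: loc_eqW => /=; ring.
Qed.

HB.instance Definition _ :=
  GRing.isZmodule.Build loc loc_addA loc_addC loc_add0 loc_addN.

Lemma loc_mulA : associative loc_mul.
Proof.
elim/locW=> x; elim/locW=> y; elim/locW=> z; rewrite !loc_mulE.
by apply: loc_eqW => /=; ring.
Qed.

Lemma loc_mulC : commutative loc_mul.
Proof.
elim/locW=> x; elim/locW=> y; rewrite !loc_mulE.
by apply: loc_eqW => /=; ring.
Qed.

Lemma loc_mul1 : left_id loc1 loc_mul.
Proof.
by elim/locW=> x; rewrite !loc_mulE; apply: loc_eqW => /=; ring.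
Qed.

Lemma loc_mulDl : left_distributive loc_mul +%R.
Proof.
elim/locW=> x; elim/locW=> y; elim/locW=> z.
rewrite -[_ + _]/(loc_add _ _) -[RHS]/(loc_add _ _) !(loc_mulE, loc_addE).
by apply: loc_eqW => /=; ring.
Qed.

Lemma loc_neq0 : loc1 != 0.
Proof.
apply/eqP => /locP[t ht] /=; rewrite mul0r mulr0 !mulr1 => t0.
by move: ht; rewrite t0 idealr0.
Qed.

HB.instance Definition _ := GRing.Zmodule_isComNzRing.Build loc
  loc_mulA loc_mulC loc_mul1 loc_mulDl loc_neq0.

Definition to_loc (r : R) : loc := \pi_loc (mk_frac r notin_1).

Lemma to_loc_zmod : zmod_morphism to_loc.
Proof.
move=> x y; rewrite /to_loc -[RHS]/(loc_add _ (loc_opp _)) loc_oppE loc_addE.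
by apply: loc_eqW => /=; ring.
Qed.

Lemma to_loc_monoid : monoid_morphism to_loc.
Proof.
split=> // x y; rewrite /to_loc -[RHS]/(loc_mul _ _) loc_mulE.
by apply: loc_eqW => /=; ring.
Qed.

HB.instance Definition _ := GRing.isZmodMorphism.Build R loc to_loc to_loc_zmod.
HB.instance Definition _ :=
  GRing.isMonoidMorphism.Build R loc to_loc to_loc_monoid.

Lemma loc_pchar p : p \in [pchar R] -> p \in [pchar loc].
Proof.
case/andP => p_pr /eqP p0; apply/andP; split=> //.
by rewrite -(rmorph_nat to_loc) p0 rmorph0.
Qed.

(* The extension P R_P of P. *)
Definition loc_max (x : loc) : bool :=
  `[< exists2 f : fraction_at, f.1 \in P & x = \pi_loc f >].

Lemma loc_max_ideal : idealr_closed loc_max.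
Proof.
split.
- by apply/asboolP; exists (mk_frac 0 notin_1) => //=; exact: idealr0.
- apply/asboolP => -[f fP /locP[t ht]] /=; rewrite mul1r mulr1 => h.
  have := notin_mul ht (den_atP f); rewrite h.
  by rewrite idealMr.
- move=> a _ _ /asboolP[f fP ->] /asboolP[g gP ->]; apply/asboolP.
  move: a; apply: locW => a; exists (add_frac (mul_frac a f) g) => /=.
    by rewrite rpredD // mulrC idealMr // idealMr.
  by rewrite -[LHS]/(loc_add (loc_mul _ _) _) loc_mulE loc_addE.
Qed.

HB.instance Definition _ := isIdealr.Build loc loc_max loc_max_ideal.

Lemma loc_maxP (I : idealr loc) : {subset I <= (loc_max : idealr loc)}.
Proof.
elim/locW=> f fI; apply/asboolP; exists f => //; apply/negPn/negP => fP.
suff : 1 \in I by rewrite idealr1.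
have -> : (1 : loc) = \pi_loc (mk_frac f.2 fP) * \pi_loc f.
  rewrite -[RHS]/(loc_mul _ _) loc_mulE.
  by apply: loc_eqW => /=; ring.
exact: idealMr.
Qed.

Definition localization : localRing := LocalRing loc_maxP.

End Localization.

Definition locally_equidimensional (R : comNzRingType) : Prop :=
  forall P : Spec R, equidimensional (localization P).

Section Zariski.
Variable R : comNzRingType.

HB.instance Definition _ := gen_eqMixin (Spec R).
HB.instance Definition _ := gen_choiceMixin (Spec R).

Definition zariski_closed (I : set R) : set (Spec R) :=
  [set P : Spec R | forall x, I x -> x \in P].

Definition zariski_open (U : set (Spec R)) : Prop :=
  exists I : set R, U = ~` zariski_closed I.

Lemma zariski_openT : zariski_open setT.
Proof.
exists [set 1]; rewrite eqEsubset; split=> // P _ /(_ 1 erefl).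
by rewrite idealr1.
Qed.

Lemma zariski_openI : setI_closed zariski_open.
Proof.
move=> _ _ [I ->] [J ->].
exists [set x | exists i j, [/\ I i, J j & x = i * j]].
rewrite -setCU; congr (~` _); rewrite eqEsubset; split=> P.
  move=> [h|h] _ [i [j [Ii Jj ->]]]; first by rewrite mulrC idealMr // h.
  by rewrite idealMr // h.
move=> h; have [hI|hI] := pselect (zariski_closed I P); first by left.
right=> j Jj; move/existsNP: hI => [i /not_implyP[Ii niP]].
have := h (i * j); rewrite prime_idealrM => /(_ _)/orP[|//|//].
by exists i, j.
Qed.

Lemma zariski_openU (T : Type) (F : T -> set (Spec R)) :
  (forall i, zariski_open (F i)) -> zariski_open (\bigcup_i F i).
Proof.
move=> /choice[I FI]; exists (\bigcup_i I i).
rewrite eqEsubset; split=> P.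
  by move=> [i _]; rewrite FI => + h; apply=> x Ix; apply: h; exists i.
move=> h; apply: contrapT => nF; apply: h => x [i _ Ix].
suff : zariski_closed (I i) P by apply.
by apply: contrapT => hi; apply: nF; exists i => //; rewrite FI.
Qed.

HB.instance Definition _ := isOpenTopological.Build (Spec R)
  zariski_openT zariski_openI zariski_openU.

End Zariski.

Section SplittingFunctions.
Variables (p : nat) (R : comNzRingType) (chRp : p \in [pchar R]) (e : nat).

Definition s_at (P : Spec R) : rat :=
  @s_ p (localization P) (loc_pchar P chRp) e.
Definition a_at (P : Spec R) : rat :=
  @a_ p (localization P) (loc_pchar P chRp) e.
End SplittingFunctions.

(* Main.v *)
(** Write [F] for [R^(e)] and [q = p^e].  At a prime [P], let [I_e] be the set of
    the [r] in [R_P^(e)] that every map in [Hom(R_P^(e), R_P)] sends into the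
    maximal ideal.  If [u] spans the socle of the injective hull, then
    [r (x) u = 0] iff [r] is in [I_e], so [K_e] is [R_P^(e) / I_e].  Its length over
    [R_P] through Frobenius is [[k : k^p]^e] times its length over [R_P^(e)] and
    equals the largest rank of a free summand of [R_P^(e)]; hence [a_e] is this
    rank.  A free summand of rank [n] is witnessed by [n] maps [F -> R] and [n]
    elements of [F] whose matrix is triangular with diagonal outside [P], which is
    an open condition on [P].

    The quotient [a_e / s_e] is [q] to the power [dim R_P + alpha(P)], and this
    exponent is locally constant.  Indeed, for primes [P] below [Q] with nothing
    in between, computing the length of [F_* A / x F_* A] in two ways for the
    one-dimensional domain [A = R_Q / P] gives
    [[k(P) : k(P)^p] = p [k(Q) : k(Q)^p]].  Hence the length of a maximal chain of
    primes from [P] to [Q] is [alpha(P) - alpha(Q)], and equidimensionality makes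
    [dim R_Q + alpha(Q)] equal to [alpha(P_0)] for every minimal prime [P_0] in
    [Q]. *)
Require Import Defs.
From HB Require Import structures.
From mathcomp Require Import all_boot all_order all_algebra.
From mathcomp Require Import generic_quotient ring_quotient.
From mathcomp Require Import all_classical all_reals all_analysis.
From mathcomp Require Import ring zify.

Set Implicit Arguments.
Unset Strict Implicit.
Unset Printing Implicit Defensive.

Import Order.TTheory GRing.Theory Num.Theory.

Local Open Scope classical_set_scope.
Local Open Scope ring_scope.
Local Open Scope quotient_scope.

(** * Lengths of Frobenius submodules *)

(** Every module whose length matters is a subquotient of [A] seen through a power of Frobenius.
    Lengths are therefore attached to two subsets of [A] and a level [e], without forming quotients:
    going from level [e] to [e + 1] keeps the sets and multiplies the length by [[k : k^p]], and
    [c |-> c^p r] carries a series from level 0 to level 1.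

    Two definitions cost real work. [alpha] is a truncated logarithm, so [[k : k^p]] must be shown
    to be a power of [p]. [s_] selects its value by [xget], so an injective hull must be
    constructed; it is found inside [Hom(A, F_p)], where injectivity reduces to extending additive
    maps into [F_p].

    Matrices of free summands are triangular rather than the identity because a diagonal entry
    outside [P] need not be invertible in [R]; one witness over [R] then serves every prime that
    avoids its diagonal.

    The number of generators of [R^(1)] bounds alpha on the whole spectrum. As alpha drops strictly
    along inclusions of primes, this bound takes the place of finite dimension in the chain
    arguments. *)

Section FrobeniusPower.
Variables (R : comNzRingType) (p : nat) (chRp : p \in [pchar R]) (e : nat).

Lemma frob_expD (x y : R) : (x + y) ^+ (p ^ e) = x ^+ (p ^ e) + y ^+ (p ^ e).
Proof.
rewrite exprDn_pchar //.
by rewrite (eq_pnat _ (pcharf_eq chRp)) pnatX pnat_id ?(pcharf_prime chRp).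
Qed.

Lemma frob_exp0 : (0 : R) ^+ (p ^ e) = 0.
Proof. by rewrite expr0n expn_eq0; have := pcharf_prime chRp; case: (p). Qed.

Lemma frob_expN (x : R) : (- x) ^+ (p ^ e) = - x ^+ (p ^ e).
Proof. by apply/eqP; rewrite -addr_eq0 -frob_expD addNr frob_exp0. Qed.

Lemma frob_expB (x y : R) : (x - y) ^+ (p ^ e) = x ^+ (p ^ e) - y ^+ (p ^ e).
Proof. by rewrite frob_expD frob_expN. Qed.

Lemma frob_exp_sum I (r : seq I) (P : pred I) (F : I -> R) :
  (\sum_(i <- r | P i) F i) ^+ (p ^ e) = \sum_(i <- r | P i) F i ^+ (p ^ e).
Proof. by apply: (big_morph (fun x => x ^+ (p ^ e)) frob_expD frob_exp0). Qed.

Lemma frob_exp_gt0 : (0 < p ^ e)%N.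
Proof. by rewrite expn_gt0 prime_gt0 ?(pcharf_prime chRp). Qed.

Lemma expr_idealr (I : idealr R) a n : (0 < n)%N -> a \in I -> a ^+ n \in I.
Proof. by case: n => // n _ aI; rewrite exprSr idealMr. Qed.

End FrobeniusPower.

Lemma local_unit (A : localRing) (a : A) :
  a \notin max_ideal A -> exists b, b * a = 1.
Proof.
move=> am; apply: contrapT => nu.
pose I : A -> bool := fun x => `[< exists b, x = b * a >].
have cI : idealr_closed I.
  split.
  - by apply/asboolP; exists 0; rewrite mul0r.
  - by apply/asboolP => -[b h]; apply: nu; exists b.
  - move=> c _ _ /asboolP[x ->] /asboolP[y ->]; apply/asboolP.
    by exists (c * x + y); rewrite mulrDl mulrA.
pose J : idealr A := HB.pack I (isIdealr.Build A I cI).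
apply/negP: am; rewrite negbK; apply: (@max_idealP A J a).
by apply/asboolP; exists 1; rewrite mul1r.
Qed.

Section FrobeniusSubmodules.
Variables (A : localRing) (p : nat) (chAp : p \in [pchar A]).
Implicit Types (e n : nat) (N M L B : set A) (a x y : A).

Local Notation m := (max_ideal A).

(* The [A]-submodules of [A^(e)], as subsets of [A]. *)
Definition fsub e N := [/\ N 0, forall x y, N x -> N y -> N (x + y) &
  forall a x, N x -> N (a ^+ (p ^ e) * x)].

Definition fadd e N x : set A := [set y | exists a z, N z /\ y = z + a ^+ (p ^ e) * x].

(** Witnesses that [M / N] has length [n] at level [e]. By the two side conditions,
    [a |-> a^(p^e) x] induces an isomorphism from the residue field onto the new quotient, so each
    step is simple. *)
Inductive comp_series e N : set A -> nat -> Prop :=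
| CompSeries0 : comp_series e N N 0
| CompSeriesS M x n : comp_series e N M n -> ~ M x ->
    (forall a, a \in m -> M (a ^+ (p ^ e) * x)) ->
    comp_series e N (fadd e M x) n.+1.

Lemma fsubN e N x : fsub e N -> N x -> N (- x).
Proof.
by case=> _ _ h Nx; have := h (-1) x Nx; rewrite (frob_expN chAp) expr1n mulN1r.
Qed.

Lemma fsubB e N x y : fsub e N -> N x -> N y -> N (x - y).
Proof. by move=> sN Nx Ny; case: (sN) => _ h _; apply: h => //; exact: fsubN sN _. Qed.

Lemma fsub_sum e N I (r : seq I) (P : pred I) (F : I -> A) :
  fsub e N -> (forall i, P i -> N (F i)) -> N (\sum_(i <- r | P i) F i).
Proof. by case=> h0 hD _ hF; apply: (big_ind N). Qed.

Lemma fsub_fadd e N x : fsub e N -> fsub e (fadd e N x).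
Proof.
move=> [N0 ND NM]; split.
- by exists 0, 0; rewrite (frob_exp0 chAp) mul0r addr0.
- move=> _ _ [a [y [Ny ->]]] [b [z [Nz ->]]]; exists (a + b), (y + z).
  by split; [exact: ND|rewrite (frob_expD chAp); ring].
- move=> b _ [a [y [Ny ->]]]; exists (b * a), (b ^+ (p ^ e) * y).
  by split; [exact: NM|rewrite exprMn; ring].
Qed.

Lemma sub_fadd e N x : N `<=` fadd e N x.
Proof. by move=> y Ny; exists 0, y; rewrite (frob_exp0 chAp) mul0r addr0. Qed.

Lemma fadd_id e N x : fsub e N -> fadd e N x x.
Proof. by case=> N0 _ _; exists 1, 0; rewrite expr1n mul1r add0r. Qed.

Lemma fadd_sub e N M x : fsub e M -> N `<=` M -> M x -> fadd e N x `<=` M.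
Proof.
move=> [_ MD MM] NM Mx _ [a [z [Nz ->]]]; apply: MD; [exact: NM|exact: MM].
Qed.

Lemma comp_series_fsub e N M n : fsub e N -> comp_series e N M n -> fsub e M.
Proof. by move=> sN; elim=> [|M' x k _ IH _ _]; [exact: sN|exact: fsub_fadd]. Qed.

Lemma comp_series_sub e N M n : comp_series e N M n -> N `<=` M.
Proof. by elim=> [|M' x k _ IH _ _]; [by []|exact: (subset_trans IH (@sub_fadd e M' x))]. Qed.

Lemma comp_series_cat e N M L n k :
  comp_series e N M n -> comp_series e M L k -> comp_series e N L (n + k)%N.
Proof.
move=> h; elim=> [|M' x j _ IH h1 h2]; first by rewrite addn0.
by rewrite addnS; exact: CompSeriesS.
Qed.

Lemma comp_series_chain e N M n : fsub e N -> comp_series e N M n ->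
  exists c : nat -> set A,
    [/\ forall i, (i <= n)%N -> [/\ fsub e (c i), N `<=` c i & c i `<=` M] &
        forall i, (i < n)%N -> c i `<` c i.+1].
Proof.
move=> sN; elim=> [|M' x k cs [c [h1 h2]] nx mx].
  by exists (fun=> N); split=> // i _; split.
exists (fun i => if (i <= k)%N then c i else fadd e M' x); split=> i.
  case: ifP => ik _.
    by have [? ? s] := h1 _ ik; split=> //; apply: subset_trans s _; exact: sub_fadd.
  split=> //; first by apply: fsub_fadd; exact: comp_series_fsub cs.
  by apply: subset_trans (comp_series_sub cs) _; exact: sub_fadd.
rewrite ltnS => ik; rewrite ik; case: ltnP => ki; first exact: h2.
have [? ? s] := h1 _ ik; split; first exact: subset_trans s (@sub_fadd _ _ _).
move=> h; apply: nx; apply: s; apply: h; apply: fadd_id.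
exact: comp_series_fsub cs.
Qed.

Lemma strict_chain_le T (c : nat -> set T) n :
  (forall i, (i < n)%N -> c i `<` c i.+1) ->
  forall i j, (i <= j <= n)%N -> c i `<=` c j.
Proof.
move=> h i j /andP[]; elim: j => [|j IH]; first by rewrite leqn0 => /eqP-> _ x.
rewrite leq_eqVlt => /orP[/eqP-> _ x //|]; rewrite ltnS => ij jn.
apply: subset_trans (IH ij (ltnW jn)) _; exact: (h _ jn).1.
Qed.

(** Half of Jordan-Holder, by intersecting the chain with the last but one term [M'] of the series:
    since [M / M'] is simple, at most one link is lost. *)
Lemma comp_series_max e N M n k (c : nat -> set A) :
  fsub e N -> comp_series e N M n ->
  (forall i, (i <= k)%N -> [/\ fsub e (c i), N `<=` c i & c i `<=` M]) ->
  (forall i, (i < k)%N -> c i `<` c i.+1) -> (k <= n)%N.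
Proof.
move=> sN cs; elim: cs k c => [|M' x {}n cs IH nx mx] k c hc sc.
  case: k hc sc => // k hc sc.
  have /(_ isT)[_ h] := sc 0%N.
  have [_ N0 _] := hc 0%N isT; have [_ _ N1] := hc 1%N isT.
  by case: h; exact: subset_trans N1 N0.
have sM := comp_series_fsub sN cs.
have [_ MD MM] := sM.
have lec := strict_chain_le sc.
(* [j] will be the first index at which the chain leaves [M']; if it never does, induction applies
   directly. *)
pose b i := `[< ~ (c i `<=` M') >].
have [bk|nbk] := boolP (b k); last first.
  apply: (@leq_trans n) => //; apply: (IH k c) => // i ik.
  have [? ? _] := hc i ik; split=> //; apply: subset_trans (lec i k _) _.
    by rewrite ik leqnn.
  by move/asboolPn/contrapT: nbk.
have /ex_minnP[j /asboolP bj minj] : exists j, b j by exists k.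
have jk := minj k bk.
have {}minj i : (i < j)%N -> c i `<=` M'.
  move=> ij; apply: contrapT => nb.
  by have := minj i (asboolT nb); rewrite leqNgt ij.
case: k {bk} hc sc lec jk => [//|k] hc sc lec jk; rewrite ltnS.
(* From [j] on, [c i] contains some [w] outside [M'], and modulo [M'] every element of [M] is a
   multiple of [w]; so a link that collapses inside [M'] collapses outright. *)
have strict i : (j <= i < k.+1)%N -> ~ (c i.+1 `&` M' `<=` c i).
  case/andP=> ji ik sub; have [_ ns] := sc i ik; apply: ns => y cy.
  have /existsNP[w /not_implyP[cw nMw]] : ~ (c i `<=` M').
    by move=> h; apply: bj; apply: subset_trans (lec j i _) h; rewrite ji ltnW.
  have [si _ sci] := hc i (ltnW ik); have [ss _ scs] := hc i.+1 ik.
  have [a [z [Mz defw]]] := sci _ cw.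
  have [b' [z' [Mz' defy]]] := scs _ cy.
  have am : a \notin m by apply/negP => am; apply: nMw; rewrite defw; apply: MD => //; exact: mx.
  have [u ua] := local_unit am.
  have [_ cD cM] := si.
  rewrite -[y](subrK ((b' * u) ^+ (p ^ e) * w)); apply: cD; last exact: cM.
  apply: sub; split.
    apply: (fsubB ss) => //; have [_ _ hM] := ss; apply: hM.
    exact: (sc i ik).1.
  have -> : y - (b' * u) ^+ (p ^ e) * w = z' - (b' * u) ^+ (p ^ e) * z.
    rewrite defy defw mulrDr mulrA -exprMn -mulrA ua mulr1; ring.
  by apply: (fsubB sM) => //; exact: MM.
(* [bump j] skips the index [j], the only place where a link can be lost. *)
apply: (IH k (fun i => c (bump j i) `&` M')).
  move=> i ik; have hb : (bump j i <= k.+1)%N by rewrite /bump; case: (leqP j i) => _ /=; lia.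
  have [[c0 cD cM] Nc _] := hc _ hb; split.
  - split.
    + by split=> //; case: sM.
    + by move=> y z [? ?] [? ?]; split; [exact: cD|exact: MD].
    + by move=> a y [? ?]; split; [exact: cM|exact: MM].
  - by move=> y Ny; split; [exact: Nc|exact: comp_series_sub cs _ Ny].
  - by move=> y [].
move=> i ik; split.
  move=> y [cy My]; split=> //; apply: lec cy; rewrite /bump.
  case: (leqP j i); case: (leqP j i.+1) => /=; lia.
rewrite /bump; case: (ltnP i.+1 j) => [ij|ji].
  have -> /= : (j <= i)%N = false by lia.
  rewrite !add0n => h; have [|_] := sc i; first lia.
  by apply=> y cy; have [] // : (c i `&` M') y; apply: h; split=> //; exact: (minj i.+1).
case: (ltnP i j) => ij.
  have jE : j = i.+1 by lia.
  rewrite add0n add1n => h; apply: (strict j); first lia.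
  move=> y; rewrite jE => /h[cy _]; apply: (lec i i.+1 _ _ cy); lia.
rewrite !add1n => h; apply: (strict i.+1); first lia.
by move=> y yc; have [] := h _ yc.
Qed.

Lemma comp_series_uniq e N M n k : fsub e N ->
  comp_series e N M n -> comp_series e N M k -> n = k.
Proof.
move=> sN h1 h2; apply/eqP; rewrite eqn_leq; apply/andP; split.
  by have [c [h h']] := comp_series_chain sN h1; exact: (comp_series_max sN h2 h h').
by have [c [h h']] := comp_series_chain sN h2; exact: (comp_series_max sN h1 h h').
Qed.

Definition fsum N M : set A := [set y | exists z w, [/\ N z, M w & y = z + w]].

Lemma fsum_fadd e N M x : fsum N (fadd e M x) = fadd e (fsum N M) x.
Proof.
rewrite eqEsubset; split=> y.
  move=> [z [_ [Nz [a [w [Mw ->]]] ->]]]; exists a, (z + w).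
  by split; [exists z, w|rewrite addrA].
move=> [a [_ [[z [w [Nz Mw ->]]] ->]]]; exists z, (w + a ^+ (p ^ e) * x).
by split=> //; [exists a, w|rewrite addrA].
Qed.

Lemma fadd_absorb e N x : fsub e N -> N x -> fadd e N x = N.
Proof.
move=> sN Nx; rewrite eqEsubset; split; last exact: sub_fadd.
exact: fadd_sub.
Qed.

Lemma fsub_fsum e N M : fsub e N -> fsub e M -> fsub e (fsum N M).
Proof.
move=> [N0 ND NM] [M0 MD MM]; split.
- by exists 0, 0; rewrite addr0.
- move=> _ _ [x [y [Nx My ->]]] [z [w [Nz Mw ->]]].
  by exists (x + z), (y + w); split; [exact: ND|exact: MD|ring].
- move=> a _ [x [y [Nx My ->]]]; exists (a ^+ (p ^ e) * x), (a ^+ (p ^ e) * y).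
  by split; [exact: NM|exact: MM|rewrite mulrDr].
Qed.

Lemma comp_series_above e N M L n : fsub e N -> fsub e M -> N `<=` M -> M `<=` L ->
  comp_series e N L n -> exists k, comp_series e M L k.
Proof.
move=> sN sM NM ML cs.
(* Add [M] to every term, dropping the steps whose generator is already in the sum. *)
have [k] : exists k, comp_series e M (fsum M L) k.
  elim: {ML} cs => [|L' x j cs [k IH] nx mx].
    exists 0%N; suff -> : fsum M N = M by exact: CompSeries0.
    rewrite eqEsubset; split=> [_ [y [z [My Nz ->]]]|y My].
      by have [_ h _] := sM; apply: h => //; exact: NM.
    by exists y, 0; split; rewrite ?addr0 //; case: sN.
  have sL := comp_series_fsub sN cs.
  rewrite fsum_fadd; have [hx|hx] := pselect (fsum M L' x).
    by exists k; rewrite fadd_absorb //; exact: fsub_fsum.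
  exists k.+1; apply: CompSeriesS => // a am.
  exists 0, (a ^+ (p ^ e) * x); split; rewrite ?add0r //; first by case: sM.
  exact: mx.
suff -> : fsum M L = L by exists k.
have sL := comp_series_fsub sN cs; case: (sL) => _ LD _.
rewrite eqEsubset; split=> [_ [y [z [My Lz ->]]]|y Ly].
  by apply: LD => //; exact: ML.
by exists 0, y; split; rewrite ?add0r //; case: sM.
Qed.

(** The condition on [B] makes [M / N -> (B + f M) / (B + f N)] injective, hence an isomorphism. [f]
    may change the Frobenius level, which lets a length at level 0 be read at level 1. *)
Lemma comp_series_map e e' (f : A -> A) N M B n :
  fsub e N -> fsub e' B -> {morph f : x y / x + y} ->
  (forall a x, f (a ^+ (p ^ e) * x) = a ^+ (p ^ e') * f x) ->
  (forall x, M x -> B (f x) -> N x) ->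
  comp_series e N M n ->
  comp_series e' (fsum B (f @` N)) (fsum B (f @` M)) n.
Proof.
move=> sN sB fD fZ + cs; elim: cs => [|M' x k cs IH nx mx] inj.
  exact: CompSeries0.
have sM' := comp_series_fsub sN cs.
have {}IH := IH (fun x Mx => inj x (@sub_fadd e M' _ x Mx)).
have -> : fsum B (f @` fadd e M' x) = fadd e' (fsum B (f @` M')) (f x).
  rewrite eqEsubset; split=> y.
    move=> [b [_ [Bb [_ [a [z [Mz ->]]] <-] ->]]].
    exists a, (b + f z); rewrite fD fZ addrA; split=> //.
    by exists b, (f z); split=> //; exists z.
  move=> [a [_ [[b [_ [Bb [z Mz <-] ->]]] ->]]].
  exists b, (f (z + a ^+ (p ^ e) * x)); rewrite fD fZ addrA; split=> //.
  by exists (z + a ^+ (p ^ e) * x); [exists a, z|rewrite fD fZ].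
apply: CompSeriesS => //.
  move=> [b [_ [Bb [z Mz <-] fx]]]; apply: nx.
  rewrite -[x](subrK z); case: (sM') => _ MD _; apply: MD => //.
  apply: (comp_series_sub cs); apply: inj.
    by apply: (fsubB (fsub_fadd x sM')); [exact: fadd_id|exact: sub_fadd].
  have fB : f (x - z) + f z = f x by rewrite -fD subrK.
  by have -> : f (x - z) = b by apply: (addIr (f z)); rewrite fB fx.
move=> a am; exists 0, (f (a ^+ (p ^ e) * x)); rewrite add0r fZ; split=> //.
  by case: sB.
by exists (a ^+ (p ^ e) * x) => //; exact: mx.
Qed.

End FrobeniusSubmodules.

(** * Ideals of Noetherian rings and finite length *)

Section Noetherian.
Variable R : comNzRingType.

Definition is_ideal (I : set R) := [/\ I 0, forall x y, I x -> I y -> I (x + y) &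
  forall a x, I x -> I (a * x)].

(** Generators and coefficients are functions on [nat], cut off by the summation bound, so that
    families can be truncated and concatenated freely. *)
Lemma noetherian_gen (I : set R) : noetherian R -> is_ideal I ->
  exists n (g : nat -> R), (forall i, I (g i)) /\
    forall y, I y -> exists c : nat -> R, y = \sum_(i < n) c i * g i.
Proof.
move=> nR [I0 ID IM]; have [|s Es] := nR (I : set R^o).
  by split=> // a u v Iu Iv; apply: ID => //; exact: IM.
exists (size s), (fun i => s`_i); split=> [i|y].
  have [si|si] := ltnP i (size s); last by rewrite nth_default.
  rewrite Es; exists (fun j => (val j == i)%:R).
  rewrite (bigD1 (Ordinal si)) //= eqxx scale1r big1 ?addr0 // => j /eqP ji.
  by case: eqP => [e|_]; [case: ji; exact: val_inj|rewrite scale0r].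
rewrite Es => -[c ->]; exists (fun i => oapp c 0 (insub i)).
by apply: eq_bigr => i _; rewrite valK.
Qed.

Lemma noetherian_max (P : set (set R)) : noetherian R ->
  (exists I, P I) -> (forall I, P I -> is_ideal I) ->
  exists I, P I /\ forall J, P J -> I `<=` J -> J = I.
Proof.
move=> nR [I0 P0] idP; apply: contrapT => nmax.
have /choice[f fP] : forall I, exists J, P I -> [/\ P J, I `<=` J & J <> I].
  move=> I; have [PI|] := pselect (P I); last by exists I.
  apply: contrapT => nJ; apply: nmax; exists I; split=> // J PJ IJ.
  by apply: contrapT => JI; apply: nJ; exists J.
pose c i := iter i f I0.
have Pc i : P (c i) by elim: i => //= i /fP[].
have cS i : c i `<=` c i.+1 by have [] := fP _ (Pc i).
have cle i j : (i <= j)%N -> c i `<=` c j.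
  elim: j => [|j IH]; first by rewrite leqn0 => /eqP-> x.
  rewrite leq_eqVlt => /orP[/eqP-> x //|]; rewrite ltnS => /IH ij.
  exact: subset_trans ij (cS j).
(* The union of the ascending chain is finitely generated, so some [c N] contains it, against the
   choice of [f]. *)
have [|n [g [gU gen]]] := @noetherian_gen (\bigcup_i c i) nR.
  split; first by exists 0%N => //; case: (idP _ (Pc 0%N)).
    move=> x y [i _ ix] [j _ jy]; exists (maxn i j) => //.
    have [_ cD _] := idP _ (Pc (maxn i j)).
    by apply: cD; [apply: cle ix|apply: cle jy]; rewrite leq_max leqnn ?orbT.
  by move=> a x [i _ ix]; exists i => //; have [_ _] := idP _ (Pc i); apply.
have [N hN] : exists N, forall i, (i < n)%N -> c N (g i).
  elim: n {gen} => [|n [N IH]]; first by exists 0%N.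
  have [k _ ck] := gU n; exists (maxn N k) => i; rewrite ltnS leq_eqVlt.
  move=> /orP[/eqP->|/IH]; [apply: cle ck|apply: cle];
    by rewrite leq_max leqnn ?orbT.
have [_ _] := fP _ (Pc N); apply; rewrite eqEsubset; split; last exact: cS.
move=> x cx; have [|b ->] := gen x; first by exists N.+1.
have [c0 cD cM] := idP _ (Pc N).
by apply: (big_ind (c N)) => // i _; apply: cM; exact: hN.
Qed.

Lemma is_ideal_sum (I : set R) J (r : seq J) (P : pred J) (F : J -> R) :
  is_ideal I -> (forall i, P i -> I (F i)) -> I (\sum_(i <- r | P i) F i).
Proof. by case=> h0 hD _ hF; apply: (big_ind I). Qed.

Lemma is_ideal_idealr (I : idealr R) : is_ideal [set x | x \in I].
Proof.
split; rewrite /mkset; first exact: idealr0.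
- by move=> x y; exact: rpredD.
- by move=> a x xI; rewrite idealMr.
Qed.

End Noetherian.

Lemma local_prime (A : localRing) : prime_idealr_closed (max_ideal A).
Proof.
move=> u v uv; apply: contraT; rewrite negb_or => /andP[un vn].
have [b bu] := local_unit un.
by rewrite -[v]mul1r -bu -mulrA idealMr // in vn.
Qed.

Lemma local_closed (A : localRing) : idealr_closed (max_ideal A).
Proof.
split; [exact: idealr0|by rewrite idealr1|move=> a u v um vm].
by rewrite rpredD // idealMr.
Qed.

Definition max_spec (A : localRing) : Spec A :=
  PrimeIdeal (@local_closed A) (@local_prime A).

Lemma max_specE (A : localRing) (x : A) : (x \in max_spec A) = (x \in max_ideal A).
Proof. by []. Qed.

Section PBasis.
Variables (p : nat) (R : comNzRingType).
Implicit Types (P : Spec R) (n : nat) (r : nat -> R).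

(* Lifts to [R] of bases of the residue field [k(P)] over [k(P)^p]. *)
Definition pindep P n r := forall c : nat -> R,
  \sum_(i < n) c i ^+ p * r i \in P -> forall i, (i < n)%N -> c i \in P.

Definition pspan P n r := forall y, exists s (c : nat -> R),
  s \notin P /\ s ^+ p * y - \sum_(i < n) c i ^+ p * r i \in P.

Definition pbasis P n := exists2 r, pindep P n r & pspan P n r.

End PBasis.

Lemma pindepW (p : nat) (R : comNzRingType) (chRp : p \in [pchar R])
    (P : Spec R) n k r : (k <= n)%N -> pindep p P n r -> pindep p P k r.
Proof.
move=> kn h c ck i ik.
pose c' i := if (i < k)%N then c i else 0.
suff : c' i \in P by rewrite /c' ik.
apply: (h c') (leq_trans ik kn); rewrite /c'.
 rewrite (big_ord_widen n (fun i => c i ^+ p * r i) kn) in ck.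
rewrite (bigID (fun i : 'I_n => (i < k)%N)) /= [X in _ + X]big1 ?addr0.
  by under eq_bigr => j -> do [].
by move=> j /negPf->; rewrite -(expn1 p) (frob_exp0 chRp) mul0r.
Qed.

Section Length.
Variables (A : localRing) (p : nat) (chAp : p \in [pchar A]).
Implicit Types (e n : nat) (N M L B : set A) (a x y : A).

Local Notation m := (max_ideal A).

Lemma fsub0P N : fsub p 0 N <-> is_ideal N.
Proof.
by split=> -[h0 hD hM]; split=> // a x Nx; have := hM a x Nx; rewrite expn0 expr1.
Qed.

(** Noetherian induction: let [I] be maximal among the counterexamples. An element [y] outside [I]
    with [m y] inside [I] gives a simple step, after which the larger ideal is no longer a
    counterexample. *)
Lemma finite_length N : noetherian A -> is_ideal N ->
  (forall a, a \in m -> exists k, N (a ^+ k)) ->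
  exists n, comp_series p 0 N setT n.
Proof.
move=> nA iN nilN; apply: contrapT => nocs.
pose P := [set I | [/\ is_ideal I, (forall a, a \in m -> exists k, I (a ^+ k)) &
  ~ exists n, comp_series p 0 I setT n]].
have [| |I [[iI nilI nI] maxI]] := noetherian_max (P := P) nA.
- by exists N.
- by move=> I [].
have [I0 ID IM] := iI.
have I1 : ~ I 1.
  move=> I1; apply: nI; exists 0%N; suff -> : I = setT by exact: CompSeries0.
  by rewrite eqEsubset; split=> // x _; rewrite -[x]mulr1; exact: IM.
have [n [g [gm gen]]] := noetherian_gen nA (is_ideal_idealr m).
(* Treat the generators of [m] one at a time, multiplying [y] by the highest power that keeps it
   outside [I]. *)
have [y nIy hy] : exists2 y, ~ I y & forall i, (i < n)%N -> I (g i * y).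
  elim: n {gen} => [|j [y nIy hy]]; first by exists 1.
  have exk : exists k, `[< I (g j ^+ k * y) >].
    have [k Ik] := nilI _ (gm j); exists k; apply/asboolP.
    by rewrite mulrC; exact: IM.
  case: (ex_minnP exk) => -[/asboolP|k /asboolP Ik mink]; first by rewrite mul1r.
  exists (g j ^+ k * y) => [|i].
    by move=> h; have := mink k (asboolT h); rewrite ltnn.
  rewrite ltnS leq_eqVlt => /orP[/eqP->|/hy h]; first by rewrite mulrA -exprS.
  by rewrite mulrCA; exact: IM.
have my a : a \in m -> I (a ^+ (p ^ 0) * y).
  move=> /gen[c ->]; rewrite expn0 expr1 mulr_suml; apply: is_ideal_sum => // i _.
  by rewrite -mulrA; apply: IM; exact: hy.
have sI : fsub p 0 I by apply/fsub0P.
have step := CompSeriesS (CompSeries0 p 0 I) nIy my.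
have subI := @sub_fadd _ _ chAp 0 I y.
have sI' : is_ideal (fadd p 0 I y) by apply/fsub0P; exact: fsub_fadd.
apply: nIy; rewrite -[I](maxI (fadd p 0 I y)) //; first exact: fadd_id.
split=> // [a /nilI[k Ik]|[k cs]]; first by exists k; exact: subI.
by apply: nI; exists (1 + k)%N; exact: comp_series_cat step cs.
Qed.

(* One step at level [e] has residue field [k], which has length [k : k^p]
   at level [e + 1]. *)
Lemma comp_series_frob e N M n d b : fsub p e N ->
  pindep p (max_spec A) d b -> pspan p (max_spec A) d b ->
  comp_series p e N M n -> comp_series p e.+1 N M (n * d).
Proof.
move=> sN0 bind bspan; elim=> [|{}M x k cs IH nx mx]; first exact: CompSeries0.
rewrite mulSn addnC; apply: (comp_series_cat IH).
have := comp_series_fsub chAp sN0 cs; move: nx mx; clear - bind bspan chAp.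
move: M => N nx mx sN; have [N0 ND NM] := sN.
pose C j := [set y | exists z (c : nat -> A),
  N z /\ y = z + \sum_(i < j) (c i ^+ p * b i) ^+ (p ^ e) * x].
have p1 : p = (p ^ 1)%N by rewrite expn1.
have C0 : C 0%N = N.
  rewrite eqEsubset; split=> [_ [z [c [Nz ->]]]|y Ny]; first by rewrite big_ord0 addr0.
  by exists y, (fun=> 0); rewrite big_ord0 addr0.
have NC j : N `<=` C j.
  move=> y Ny; exists y, (fun=> 0); split=> //; rewrite big1 ?addr0 // => i _.
  by rewrite p1 (frob_exp0 chAp) mul0r -p1 (frob_exp0 chAp) mul0r.
have CS j : C j.+1 = fadd p e.+1 (C j) (b j ^+ (p ^ e) * x).
  rewrite eqEsubset; split=> [_ [z [c [Nz ->]]]|_ [a [_ [[z [c [Nz ->]]] ->]]]].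
    exists (c j), (z + \sum_(i < j) (c i ^+ p * b i) ^+ (p ^ e) * x).
    split; first by exists z, c.
    by rewrite big_ord_recr /= addrA exprMn -exprM -expnS mulrA.
  exists z, (fun i => if (i < j)%N then c i else a); split=> //.
  rewrite big_ord_recr /= ltnn exprMn -exprM -expnS mulrA addrA; congr (_ + _ + _).
  by apply: eq_bigr => i _; rewrite ltn_ord.
have nxN w : N (w ^+ (p ^ e) * x) -> w \in m.
  move=> h; apply: contraT => wm; have [u uw] := local_unit wm.
  by case: nx; have := NM u _ h; rewrite mulrA -exprMn uw expr1n mul1r.
suff csC j : (j <= d)%N -> comp_series p e.+1 N (C j) j.
  suff -> : fadd p e N x = C d by exact: csC.
  rewrite eqEsubset; split=> [_ [a [z [Nz ->]]]|_ [z [c [Nz ->]]]]; last first.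
    exists (\sum_(i < d) c i ^+ p * b i), z; split=> //.
    by rewrite (frob_exp_sum chAp) mulr_suml.
  have [s [c [sm hc]]] := bspan a; have [u us] := local_unit sm.
  exists (z + (a - \sum_(i < d) (u * c i) ^+ p * b i) ^+ (p ^ e) * x), (fun i => u * c i).
  split.
    apply: ND => //; apply: mx.
    have -> : a - \sum_(i < d) (u * c i) ^+ p * b i =
        u ^+ p * (s ^+ p * a - \sum_(i < d) c i ^+ p * b i).
      rewrite mulrBr mulrA -exprMn us expr1n mul1r mulr_sumr; congr (_ - _).
      by apply: eq_bigr => i _; rewrite exprMn mulrA.
    by rewrite idealMr.
  rewrite -mulr_suml -(frob_exp_sum chAp) (frob_expB chAp); ring.
elim: j => [|j IH] jd; first by rewrite C0; exact: CompSeries0.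
rewrite CS; apply: CompSeriesS; first exact: IH (ltnW jd).
  move=> [z [c [Nz hz]]].
  (* The coefficient -1 at [j] turns the membership of the new generator in [C j] into a dependence
     relation; [pindep] then puts -1 in the maximal ideal. *)
  pose c' i := if (i < j)%N then c i else -1.
  have h : \sum_(i < j.+1) c' i ^+ p * b i \in max_spec A.
    rewrite /c' max_specE; apply: nxN; rewrite big_ord_recr /= ltnn.
    rewrite p1 (frob_expN chAp) expr1n mulN1r -p1 (frob_expB chAp) mulrBl hz.
    rewrite (eq_bigr (fun i : 'I_j => c i ^+ p * b i)); last first.
      by move=> i _; rewrite ltn_ord.
    rewrite (frob_exp_sum chAp) mulr_suml opprD addrCA subrr addr0.
    exact: (fsubN chAp sN).
  have := @pindepW _ _ chAp _ _ _ _ jd bind c' h j (ltnSn j).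
  by rewrite /c' ltnn max_specE rpredN idealr1.
move=> a am; apply: NC; rewrite mulrA expnS exprM -exprMn; apply: mx.
by rewrite mulrC idealMr // expr_idealr // prime_gt0 // (pcharf_prime chAp).
Qed.

End Length.

(** * Residue field extensions [k(P) / k(P)^p] *)

Section Generators.
Variables (p : nat) (R : comNzRingType) (chRp : p \in [pchar R]).

Definition frob_gen e n (g : nat -> R) :=
  forall y, exists c : nat -> R, y = \sum_(i < n) c i ^+ (p ^ e) * g i.

Lemma F_finite_gen e : F_finite chRp -> exists n g, frob_gen e n g.
Proof.
move=> /(_ e)[s Es]; exists (size s), (fun i => s`_i) => y.
have : [set: frob_alg chRp e] y by [].
rewrite Es => -[c ->]; exists (fun i => oapp c 0 (insub i)).
by apply: eq_bigr => i _; rewrite valK.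
Qed.

(** Greedy selection: a generator is kept when it is not in the span [S] of those already kept,
    denominators being cleared by [p]-th powers. The bound by [n] is what later bounds alpha on the
    spectrum. *)
Lemma pbasis_exists (P : Spec R) n g : frob_gen 1 n g ->
  exists2 k, (k <= n)%N & pbasis p P k.
Proof.
move=> gen.
pose S k (r : nat -> R) y := exists s (c : nat -> R),
  s \notin P /\ s ^+ p * y - \sum_(i < k) c i ^+ p * r i \in P.
have p1 : p = (p ^ 1)%N by rewrite expn1.
have p0 x : (0 : R) ^+ p * x = 0 by rewrite p1 (frob_exp0 chRp) mul0r.
have SD k r x y : S k r x -> S k r y -> S k r (x + y).
  move=> [s [c [sP hx]]] [t [b [tP hy]]]; exists (s * t), (fun i => t * c i + s * b i).
  split; first exact: notin_mul.
  have -> : (s * t) ^+ p * (x + y) - \sum_(i < k) (t * c i + s * b i) ^+ p * r i =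
     t ^+ p * (s ^+ p * x - \sum_(i < k) c i ^+ p * r i) +
     s ^+ p * (t ^+ p * y - \sum_(i < k) b i ^+ p * r i).
    under eq_bigr => i _ do rewrite p1 (frob_expD chRp) -p1 mulrDl !exprMn -!mulrA.
    by rewrite big_split /= -!mulr_sumr exprMn; ring.
  by rewrite rpredD // idealMr.
have SZ k r a x : S k r x -> S k r (a ^+ p * x).
  move=> [s [c [sP hx]]]; exists s, (fun i => a * c i); split=> //.
  under eq_bigr => i _ do rewrite exprMn -mulrA.
  by rewrite -mulr_sumr mulrCA -mulrBr idealMr.
have S0 k r : S k r 0.
  exists 1, (fun=> 0); split; first exact: notin_1.
  by rewrite mulr0 sub0r rpredN rpred_sum // => i _; rewrite p0 idealr0.
suff [k kn [r rind rgen]] : exists2 k, (k <= n)%N & exists2 r, pindep p P k r &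
    forall i, (i < n)%N -> S k r (g i).
  exists k => //; exists r => // y; have [c ->] := gen y.
  by apply: (big_ind (S k r)) => // [|i _]; [exact: SD|rewrite -p1; apply: SZ; exact: rgen].
elim: n {gen} => [|j [k kj [r rind rgen]]].
  by exists 0%N => //; exists (fun=> 0).
have [Sg|nSg] := pselect (S k r (g j)).
  exists k; first exact: leqW; exists r => // i.
  by rewrite ltnS leq_eqVlt => /orP[/eqP->|]; [|exact: rgen].
pose r' i := if (i < k)%N then r i else g j.
have r'E (c : nat -> R) : \sum_(i < k.+1) c i ^+ p * r' i =
    \sum_(i < k) c i ^+ p * r i + c k ^+ p * g j.
  rewrite big_ord_recr /= /r' ltnn; congr (_ + _).
  by apply: eq_bigr => i _; rewrite ltn_ord.
exists k.+1 => //; exists r'.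
  move=> c; rewrite r'E => hc.
  have ck : c k \in P.
    apply: contraT => nck; case: nSg; exists (c k), (fun i => - c i).
    split=> //; under eq_bigr => i _ do rewrite p1 (frob_expN chRp) -p1 mulNr.
    by rewrite sumrN opprK addrC.
  move=> i; rewrite ltnS leq_eqVlt => /orP[/eqP->//|]; apply: rind.
  move: hc; rewrite rpredDr // mulrC idealMr // expr_idealr // prime_gt0 //.
  exact: pcharf_prime chRp.
have Sr' x : S k r x -> S k.+1 r' x.
  move=> [s [c [sP hc]]]; exists s, (fun i => if (i < k)%N then c i else 0).
  split=> //; rewrite (r'E (fun i => if (i < k)%N then c i else 0)) ltnn p0 addr0.
  by under eq_bigr => i _ do rewrite ltn_ord.
move=> i; rewrite ltnS leq_eqVlt => /orP[/eqP->|/rgen]; last exact: Sr'.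
exists 1, (fun i => (i == k)%:R); split; first exact: notin_1.
rewrite (r'E (fun i => (i == k)%:R)) eqxx expr1n big1 ?add0r ?subrr ?idealr0 // => l _.
by rewrite (ltn_eqF (ltn_ord l)) p0.
Qed.

End Generators.

Section Transfer.
Variables (p : nat) (R S : comNzRingType) (chRp : p \in [pchar R]).
Variables (f : {rmorphism R -> S}) (P : Spec R) (Q : Spec S).
Hypothesis fPQ : forall x, (f x \in Q) = (x \in P).
Hypothesis fden : forall a, exists s x, s \notin P /\ f s * a = f x.

Lemma common_den n (c : nat -> S) : exists s (x : nat -> R),
  s \notin P /\ forall i, (i < n)%N -> f s * c i = f (x i).
Proof.
elim: n => [|n [s [x [sP sx]]]]; first by exists 1, (fun=> 0); split=> //; exact: notin_1.
have [t [y [tP ty]]] := fden (c n).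
exists (s * t), (fun i => if (i < n)%N then t * x i else s * y).
split=> [|i]; first exact: notin_mul.
rewrite ltnS leq_eqVlt => /orP[/eqP->|i_n].
  by rewrite ltnn !rmorphM -mulrA ty.
by rewrite i_n !rmorphM -(sx _ i_n) mulrAC mulrC mulrA.
Qed.

(** By the two hypotheses [R] at [P] and [S] at [Q] have the same residue field, so lifts of a basis
    can be pushed along [f]. *)
Lemma pbasis_transfer n : pbasis p P n -> pbasis p Q n.
Proof.
move=> [r rind rspan]; exists (f \o r).
  move=> c hc i i_n; have [s [x [sP sx]]] := common_den n c.
  have : x i \in P.
    apply: (rind x) => //; rewrite -fPQ rmorph_sum.
    rewrite (eq_bigr (fun i : 'I_n => f s ^+ p * (c i ^+ p * f (r i)))).
      by rewrite -mulr_sumr idealMr.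
    by move=> j _; rewrite mulrA -exprMn (sx _ (ltn_ord j)) rmorphM rmorphXn.
  by rewrite -fPQ -sx // prime_idealrM fPQ (negPf sP).
move=> a; have [s [x [sP sx]]] := fden a.
(* From [f s * a = f x] follows [f s ^+ p * a = f (s ^+ p.-1 * x)]: the denominator becomes a [p]-th
   power. *)
have [t [c [tP tc]]] := rspan (s ^+ p.-1 * x).
exists (f (t * s)), (f \o c); rewrite fPQ; split; first exact: notin_mul.
have -> : f (t * s) ^+ p * a = f (t ^+ p * (s ^+ p.-1 * x)).
  have := pcharf_prime chRp; case: p => // k _.
  by rewrite !rmorphM -sx !rmorphXn /= exprMn [f s ^+ k.+1]exprSr -!mulrA.
rewrite (eq_bigr (fun i : 'I_n => f (c i ^+ p * r i))).
  by rewrite -rmorph_sum -rmorphB fPQ.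
by move=> i _; rewrite rmorphM rmorphXn.
Qed.

End Transfer.

Section LocalizationFacts.
Variables (R : comNzRingType) (P : Spec R).

Lemma loc_fracP (a : loc P) : exists s x, s \notin P /\ to_loc P s * a = to_loc P x.
Proof.
elim/locW: a => -[[x s] hs]; exists s, x; split=> //.
rewrite -[LHS]/(loc_mul _ _) loc_mulE.
by apply: loc_eqW => /=; ring.
Qed.

Lemma loc_max_to_loc x : (to_loc P x \in max_ideal (localization P)) = (x \in P).
Proof.
apply/asboolP/idP => [[f fP /locP[t ht]]|xP]; last first.
  by exists (mk_frac x (notin_1 P)).
rewrite /= mulr1 => h; have : t * (x * f.2) \in P by rewrite h !idealMr.
by rewrite prime_idealrM (negPf ht) prime_idealrM (negPf (den_atP f)) orbF.
Qed.

Lemma to_loc_eq0 x : to_loc P x = 0 <-> exists2 t, t \notin P & t * x = 0.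
Proof.
split=> [/locP[t ht]|[t ht h]]; first by rewrite /= mulr1 mul0r mulr0; exists t.
by apply/locP; exists t => //=; rewrite mulr1 mul0r mulr0.
Qed.

End LocalizationFacts.

Lemma pbasis_localization (p : nat) (R : comNzRingType) (chRp : p \in [pchar R])
  (P : Spec R) n : pbasis p P n -> pbasis p (max_spec (localization P)) n.
Proof.
apply: (pbasis_transfer chRp (f := to_loc P)); last exact: loc_fracP.
exact: loc_max_to_loc.
Qed.

Lemma pbasis_length (A : localRing) (p : nat) (chAp : p \in [pchar A]) d :
  pbasis p (max_spec A) d -> comp_series p 1 [set x | x \in max_ideal A] setT d.
Proof.
move=> [b bind bspan].
have sm : fsub p 0 [set x | x \in max_ideal A] by apply/fsub0P; exact: is_ideal_idealr.
suff cs : comp_series p 0 [set x | x \in max_ideal A] setT 1.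
  by have := comp_series_frob chAp sm bind bspan cs; rewrite mul1n.
have -> : setT = fadd p 0 [set x | x \in max_ideal A] 1.
  rewrite eqEsubset; split=> // x _; exists x, 0; rewrite expn0 expr1 mulr1 add0r.
  by split=> //; exact: idealr0.
apply: CompSeriesS; first exact: CompSeries0.
  by rewrite /mkset /= idealr1.
by move=> a am; rewrite expn0 expr1 mulr1.
Qed.

(** Both numbers are the length at level 1 of the residue field of [R_P]. *)
Lemma pbasis_uniq (p : nat) (R : comNzRingType) (chRp : p \in [pchar R])
  (P : Spec R) n k : pbasis p P n -> pbasis p P k -> n = k.
Proof.
have chL : p \in [pchar localization P] := loc_pchar P chRp.
move=> /(pbasis_localization chRp)/(pbasis_length chL) h1.
move=> /(pbasis_localization chRp)/(pbasis_length chL) h2.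
apply: (comp_series_uniq chL _ h1 h2).
have [h0 hD hM] := is_ideal_idealr (max_ideal (localization P)).
by split=> // a x; exact: hM.
Qed.

Lemma Spec_of_set (R : comNzRingType) (I : set R) : is_ideal I -> ~ I 1 ->
  (forall x y, I (x * y) -> I x \/ I y) ->
  exists Q : Spec R, forall x, x \in Q <-> I x.
Proof.
move=> [I0 ID IM] I1 IP; pose S : R -> bool := fun x => `[< I x >].
have cS : idealr_closed S.
  split; [exact/asboolP|exact/asboolP|].
  by move=> a u v /asboolP Iu /asboolP Iv; apply/asboolP/ID => //; exact: IM.
have pS : prime_idealr_closed S.
  by move=> u v /asboolP/IP[h|h]; apply/orP; [left|right]; exact/asboolP.
by exists (PrimeIdeal cS pS) => x; split=> /asboolP.
Qed.

Section Avoid.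
Variables (R : comNzRingType) (noethR : noetherian R).

Definition idealD (I : set R) x : set R := [set y | exists a z, I z /\ y = z + a * x].

Lemma is_ideal_idealD I x : is_ideal I -> is_ideal (idealD I x).
Proof.
move=> [I0 ID IM]; split.
- by exists 0, 0; rewrite mul0r addr0.
- move=> _ _ [a [y [Iy ->]]] [b [z [Iz ->]]]; exists (a + b), (y + z).
  by split; [exact: ID|ring].
- move=> b _ [a [y [Iy ->]]]; exists (b * a), (b * y).
  by split; [exact: IM|ring].
Qed.

Lemma sub_idealD I x : I `<=` idealD I x.
Proof. by move=> y Iy; exists 0, y; rewrite mul0r addr0. Qed.

Lemma idealD_id I x : is_ideal I -> idealD I x x.
Proof. by case=> I0 _ _; exists 1, 0; rewrite mul1r add0r. Qed.

(** An ideal maximal among those containing [I] and missing all powers of [a] is prime: adjoining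
    either factor of a product in it captures a power of [a], and multiplying these powers gives one
    in the ideal. *)
Lemma prime_avoiding (I : set R) (a : R) : is_ideal I -> (forall k, ~ I (a ^+ k)) ->
  exists2 Q : Spec R, (forall x, I x -> x \in Q) & a \notin Q.
Proof.
move=> iI nI.
pose P := [set J | [/\ is_ideal J, I `<=` J & forall k, ~ J (a ^+ k)]].
have [| |J [[iJ IJ nJ] maxJ]] := noetherian_max (P := P) noethR.
- by exists I; split=> // x.
- by move=> J [].
have [_ JD JM] := iJ.
have out x : ~ J x -> exists k, idealD J x (a ^+ k).
  move=> nx; apply: contrapT => nk; apply: nx; rewrite -(maxJ (idealD J x)).
  - exact: idealD_id.
  - split; first exact: is_ideal_idealD.
      by apply: subset_trans IJ _; exact: sub_idealD.
    by move=> k h; apply: nk; exists k.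
  - exact: sub_idealD.
have [|x y Jxy|Q QP] := Spec_of_set iJ; first exact: (nJ 0%N).
  apply: contrapT => /not_orP[/out[k [b [u [Ju ak]]]] /out[l [c [v [Jv al]]]]].
  apply: (nJ (k + l)%N); rewrite exprD ak al.
  have -> : (u + b * x) * (v + c * y) = (v + c * y) * u + (b * x) * v + (b * c) * (x * y).
    by ring.
  by apply: (JD); [apply: (JD)|]; apply: (JM).
exists Q => [x /IJ|]; first by move/QP.
by apply/negP => /QP; exact: (nJ 1%N).
Qed.

End Avoid.

(** * Adjacent primes: the one-dimensional domain [A / P] *)

Section Adjacent.
Variables (A : localRing) (p : nat) (chAp : p \in [pchar A]) (noethA : noetherian A).
Variables (P : Spec A) (x : A).
Hypothesis adjP : forall Q : Spec A, {subset P <= Q} ->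
  {subset Q <= P} \/ {subset max_ideal A <= Q}.
Hypotheses (xP : x \notin P) (xm : x \in max_ideal A).

Local Notation m := (max_ideal A).
Let sP : set A := [set z | z \in P].

Let iP : is_ideal sP. Proof. exact: is_ideal_idealr. Qed.

Let fP e : fsub p e sP.
Proof. by case: iP => h0 hD hM; split=> // a z; exact: hM. Qed.

Let iP_ y : is_ideal (idealD sP y). Proof. exact: is_ideal_idealD. Qed.

Let fJ e y : fsub p e (idealD sP y).
Proof. by case: (iP_ y) => h0 hD hM; split=> // a z; exact: hM. Qed.

(** A prime over [P] that contains [y] is maximal, so every element of [m] has a power in
    [P + y A]. *)
Lemma adjacent_length y : y \notin P -> exists n, comp_series p 0 (idealD sP y) setT n.
Proof.
move=> yP; apply: finite_length => // a am; apply: contrapT => nk.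
have [|Q PQ aQ] := @prime_avoiding _ noethA (idealD sP y) a (iP_ y).
  by move=> k h; apply: nk; exists k.
have [|QP|mQ] := adjP (Q := Q).
- by move=> z zP; apply: PQ; exact: sub_idealD.
- by move: yP; rewrite QP // PQ //; exact: idealD_id.
- by rewrite mQ in aQ.
Qed.

Let idealD_mulE y : fsum sP ([eta *%R y] @` setT) = idealD sP y.
Proof.
rewrite eqEsubset; split=> [_ [z [_ [Pz [a _ <-] ->]]]|_ [a [z [Pz ->]]]].
  by exists a, z; rewrite mulrC.
by exists z, (y * a); split=> //; rewrite mulrC.
Qed.

(** Since [A / P] is a domain, multiplication by [x^k] carries [A / (P + x A)] isomorphically onto
    [(P + x^k A) / (P + x^(k+1) A)]. *)
Lemma adjacent_length_exp b k : comp_series p 0 (idealD sP x) setT b ->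
  comp_series p 0 (idealD sP (x ^+ k)) setT (k * b).
Proof.
move=> cs; elim: k => [|k IH].
  rewrite expr0; suff -> : idealD sP 1 = setT by exact: CompSeries0.
  rewrite eqEsubset; split=> // z _; exists z, 0; rewrite add0r mulr1; split=> //.
  by case: iP.
rewrite mulSn; apply: comp_series_cat IH.
have xkP : x ^+ k \notin P.
  elim: k => [|k IH]; rewrite ?expr0 ?notin_1 // exprS.
  exact: notin_mul.
have := @comp_series_map A p chAp 0 0 ([eta *%R (x ^+ k)]) (idealD sP x) setT sP b.
rewrite idealD_mulE; have -> : fsum sP ([eta *%R (x ^+ k)] @` idealD sP x) =
    idealD sP (x ^+ k.+1).
  rewrite eqEsubset; split=> [_ [z [_ [Pz [_ [a [w [Pw ->]]] <-] ->]]]|_ [a [z [Pz ->]]]].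
    exists a, (z + x ^+ k * w); split; last by rewrite exprSr; ring.
    by case: iP => _ hD hM; apply: hD => //; exact: hM.
  exists z, (x ^+ k * (a * x)); split=> //; last by rewrite exprSr; ring.
  by exists (a * x) => //; exists a, 0; rewrite add0r; split=> //; case: iP.
apply=> //.
- by move=> u v; rewrite mulrDr.
- by move=> a u; rewrite mulrCA.
- move=> z _; rewrite /sP /mkset /= prime_idealrM (negPf xkP) => zP.
  exact: sub_idealD.
Qed.

(* With [N = P + \sum A^p r_i], multiplication by [x^p] maps [A / N] isomorphically
   onto [(P + x^p A) / (P + x^p N)], so [A / (P + x^p A)] and [N / (P + x^p N)] have
   the same length through Frobenius. *)
Lemma adjacent_rank n d k (g : nat -> A) : frob_gen p 1 k g ->
  pbasis p P n -> pbasis p (max_spec A) d -> n = (p * d)%N.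
Proof.
move=> gen [r rind rspan] [b bind bspan].
have p1 : p = (p ^ 1)%N by rewrite expn1.
pose N j : set A := [set y | exists z (c : nat -> A),
  sP z /\ y = z + \sum_(i < j) c i ^+ p * r i].
have sN j : fsub p 1 (N j).
  split.
  - exists 0, (fun=> 0); split; first by case: iP.
    by rewrite big1 ?addr0 // => i _; rewrite p1 (frob_exp0 chAp) mul0r.
  - move=> _ _ [z [c [Pz ->]]] [w [c' [Pw ->]]]; exists (z + w), (fun i => c i + c' i).
    split; first by case: iP => _ hD _; exact: hD.
    under [in RHS]eq_bigr => i _ do rewrite p1 (frob_expD chAp) -p1 mulrDl.
    by rewrite big_split /=; ring.
  - move=> a _ [z [c [Pz ->]]]; exists (a ^+ p * z), (fun i => a * c i).
    split; first by case: iP => _ _ hM; exact: hM.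
    rewrite -p1 mulrDr mulr_sumr; congr (_ + _).
    by apply: eq_bigr => i _; rewrite exprMn mulrA.
have PN j : sP `<=` N j.
  move=> z Pz; exists z, (fun=> 0); split=> //.
  by rewrite big1 ?addr0 // => i _; rewrite p1 (frob_exp0 chAp) mul0r.
(* A common denominator [s] of the generators gives [s^p A] inside [N n], so that [A / N n] has
   finite length. *)
have [s sP' hs] : exists2 s, s \notin P & forall y, N n (s ^+ p * y).
  suff [s sP' hs] : exists2 s, s \notin P & forall i, (i < k)%N -> N n (s ^+ p * g i).
    exists s => // y; have [c ->] := gen y; rewrite mulr_sumr.
    apply: (fsub_sum _ (sN n)) => i _; rewrite mulrCA.
    by case: (sN n) => _ _ hM; apply: hM; exact: hs.
  elim: k {gen} => [|k [s sP' hs]]; first by exists 1 => //; exact: notin_1.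
  have [t [c [tP tc]]] := rspan (g k).
  exists (s * t) => [|i]; first exact: notin_mul.
  rewrite exprMn ltnS leq_eqVlt => /orP[/eqP->|/hs h]; last first.
    by rewrite mulrAC mulrC p1; case: (sN n) => _ _ hM; exact: hM.
  rewrite -mulrA p1; case: (sN n) => _ _ hM; apply: hM; rewrite -p1.
  by exists (t ^+ p * g k - \sum_(i < n) c i ^+ p * r i), c; rewrite subrK.
pose y := x ^+ p.
have yP : y \notin P.
  by rewrite /y; elim: p => [|j IH]; rewrite ?expr0 ?notin_1 // exprS notin_mul.
have spP : s ^+ p \notin P.
  by elim: p => [|j IH]; rewrite ?expr0 ?notin_1 // exprS notin_mul.
have [b0 cs0] := adjacent_length xP.
have b0_gt0 : (0 < b0)%N.
  case: b0 cs0 => // cs; inversion cs as [E|].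
  have [a [z [Pz h1]]] : idealD sP x 1 by rewrite E.
  have : (1 : A) \in m.
    by rewrite h1 rpredD ?idealMr //; exact: (@max_idealP A (prime_ideal P)).
  by rewrite idealr1.
have [a csa] : exists a, comp_series p 1 (N n) setT a.
  have [a0 csa0] := adjacent_length spP.
  apply: (comp_series_above chAp (fJ 1 (s ^+ p)) (sN n) _ _
    (comp_series_frob chAp (fJ 0 _) bind bspan csa0)) => //.
  move=> _ [c [z [Pz ->]]]; have [_ hD _] := sN n; apply: hD; first exact: PN.
  by rewrite mulrC; exact: hs.
pose yN := fsum sP ([eta *%R y] @` N n).
have sNy : fsub p 1 yN.
  apply: fsub_fsum => //; have [h0 hD hM] := sN n; split.
  - by exists 0; rewrite ?mulr0.
  - by move=> _ _ [u hu <-] [v hv <-]; exists (u + v); rewrite ?mulrDr //; exact: hD.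
  - by move=> c _ [u hu <-]; exists (c ^+ (p ^ 1) * u); [exact: hM|rewrite mulrCA].
have csy : comp_series p 1 yN (idealD sP y) a.
  rewrite -idealD_mulE; apply: comp_series_map => //.
  - by move=> u v; rewrite mulrDr.
  - by move=> c u; rewrite mulrCA.
  - move=> z _; rewrite /sP /mkset prime_idealrM (negPf yP) => zP; exact: PN.
(* First count of the length of [A / yN]: [a] up to [P + x^p A], then [p * b0] steps at level 0,
   each worth [d] at level 1. *)
have cs1 : comp_series p 1 yN setT (a + p * b0 * d).
  apply: (comp_series_cat csy).
  exact: (comp_series_frob chAp (fJ 0 _) bind bspan (adjacent_length_exp p cs0)).
(* Second count: go from [yN] to [N n] by adding the lines [A^p r_j] in turn. Each adds a copy of
   [A / (P + x A)], embedded from level 0 to level 1 by [c |-> c^p r_j], hence length [b0]. *)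
pose Ny j : set A := [set w | exists z (c : nat -> A),
  yN z /\ w = z + \sum_(i < j) c i ^+ p * r i].
have csN j : (j <= n)%N -> comp_series p 1 yN (Ny j) (j * b0) /\ fsub p 1 (Ny j).
  have [Y0 YD YM] := sNy.
  elim: j => [|j IH] jn.
    have -> : Ny 0%N = yN; last by split=> //; exact: CompSeries0.
    rewrite eqEsubset; split=> [_ [z [c [yz ->]]]|z yz]; first by rewrite big_ord0 addr0.
    by exists z, (fun=> 0); rewrite big_ord0 addr0.
  have {IH}[IH sNj] := IH (ltnW jn); rewrite mulSn addnC.
  suff csj : comp_series p 1 (Ny j) (Ny j.+1) b0.
    by split; [exact: comp_series_cat IH csj|exact: comp_series_fsub csj].
  have subNy : yN `<=` Ny j.
    move=> z yz; exists z, (fun=> 0); split=> //.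
    by rewrite big1 ?addr0 // => i _; rewrite p1 (frob_exp0 chAp) mul0r.
  pose f (c : A) := c ^+ p * r j.
  have -> : Ny j.+1 = fsum (Ny j) (f @` setT).
    rewrite eqEsubset; split=> [_ [z [c [yz ->]]]|_ [_ [_ [[z [c [yz ->]]] [u _ <-] ->]]]].
      exists (z + \sum_(i < j) c i ^+ p * r i), (f (c j)).
      by split; [exists z, c|exists (c j)|rewrite big_ord_recr addrA].
    exists z, (fun i => if (i < j)%N then c i else u); split=> //.
    rewrite big_ord_recr /= ltnn addrA; congr (_ + _ + _).
    by apply: eq_bigr => i _; rewrite ltn_ord.
  have fJN : f @` idealD sP x `<=` Ny j.
    move=> _ [_ [c [z [Pz ->]]] <-]; apply: subNy.
    exists (z ^+ p * r j), (y * (c ^+ p * r j)); split.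
    - rewrite /sP /mkset mulrC idealMr // expr_idealr //.
      by rewrite prime_gt0 // (pcharf_prime chAp).
    - exists (c ^+ p * r j) => //; exists 0, (fun i => if i == j then c else 0).
      split; first by case: iP.
      rewrite add0r (bigD1 (Ordinal jn)) //= eqxx big1 ?addr0 // => i /eqP ij.
      case: eqP => [e|_]; first by case: ij; exact: val_inj.
      by rewrite p1 (frob_exp0 chAp) mul0r.
    - by rewrite /f p1 (frob_expD chAp) -p1 exprMn /y; ring.
  have {1}-> : Ny j = fsum (Ny j) (f @` idealD sP x).
    rewrite eqEsubset; split=> [w Nw|_ [u [v [Nu /fJN Nv ->]]]].
      exists w, (f 0); split=> //; first by exists 0 => //; case: (iP_ x).
      by rewrite /f p1 (frob_exp0 chAp) mul0r addr0.
    by case: sNj => _ hD _; exact: hD.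
  apply: (comp_series_map chAp (fJ 0 x) sNj) => //.
  - by move=> u v; rewrite /f p1 (frob_expD chAp) mulrDl.
  - by move=> c u; rewrite /f expn0 expr1 exprMn -p1 mulrA.
  move=> c _ [_ [c' [[z [_ [Pz [_ [w [dd [Pw ->]]] <-] ->]]] hc]]].
  (* The coefficients of a relation modulo [P] among the [r i]; independence at [j] puts
     [c - x * dd j] in [P]. *)
  pose cc i := (if (i < j)%N then c' i else if i == j then - c else 0) + x * dd i.
  have : cc j \in P.
    apply: (rind cc) => //; rewrite /cc.
    under eq_bigr => i _ do rewrite p1 (frob_expD chAp) -p1 mulrDl exprMn -mulrA.
    rewrite big_split /= -mulr_sumr.
    have -> : \sum_(i < n) (if (i < j)%N then c' i else if (i : nat) == j then - c else 0) ^+ p * r i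
        = \sum_(i < j) c' i ^+ p * r i - c ^+ p * r j.
      rewrite (bigID (fun i : 'I_n => (i < j)%N)) /=; congr (_ + _).
        rewrite (big_ord_widen n (fun i => c' i ^+ p * r i) (ltnW jn)).
        by apply: eq_bigr => i ->.
      rewrite (bigD1 (Ordinal jn)) /= ?ltnn // eqxx big1 ?addr0.
        by rewrite p1 (frob_expN chAp) mulNr.
      move=> i /andP[ij /eqP nij]; rewrite (negPf ij); case: eqP => [e|_].
        by case: nij; exact: val_inj.
      by rewrite p1 (frob_exp0 chAp) mul0r.
    have -> : \sum_(i < j) c' i ^+ p * r i - c ^+ p * r j +
        x ^+ p * (\sum_(i < n) dd i ^+ p * r i) = - (z + y * w).
      by rewrite -/(f c) hc /y; ring.
    by rewrite rpredN rpredD // idealMr.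
  rewrite /cc ltnn eqxx => h; exists (dd j), (c - dd j * x).
  split; last by rewrite subrK.
  by rewrite /sP /mkset -opprB rpredN addrC mulrC.
have NyE : Ny n = N n.
  rewrite eqEsubset; split=> [_ [z [c [yz ->]]]|_ [z [c [Pz ->]]]].
    have [_ hD hM] := sN n; apply: (hD); last by exists 0, c; rewrite add0r; split=> //; case: iP.
    case: yz => u [_ [Pu [v Nv <-] ->]]; apply: (hD); first exact: PN.
    by rewrite /y p1; exact: hM.
  exists z, c; split=> //; exists z, 0; rewrite addr0; split=> //.
  by exists 0; rewrite ?mulr0 //; case: (sN n).
have [csn _] := csN n (leqnn n); rewrite NyE in csn.
(* Cancelling [a] in [a + p b0 d = n b0 + a] and dividing by [b0 > 0] leaves [n = p d]. *)
have := comp_series_uniq chAp sNy cs1 (comp_series_cat csn csa).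
rewrite addnC => /addIn; rewrite mulnAC => /eqP.
by rewrite eqn_pmul2r // => /eqP.
Qed.

End Adjacent.

(* The minimal polynomial of [x] over [T] divides [X^p - x^p = (X - x)^p], so it
   is [(X - x)^j] with [0 < j < p], and its subleading coefficient is [- j x]. *)
Lemma purely_inseparable_degree (K : fieldType) (p : nat) (chKp : p \in [pchar K])
    (T : set K) (x : K) (f : {poly K}) :
  T 0 -> T 1 -> (forall a b, T a -> T b -> T (a - b)) ->
  (forall a b, T a -> T b -> T (a * b)) -> (forall a, T a -> T a^-1) ->
  T (x ^+ p) -> (forall i, T f`_i) -> f != 0 -> root f x -> (size f <= p)%N -> T x.
Proof.
move=> T0 T1 TB TM TV Txp Tf f0 fx fp.
have TN a : T a -> T (- a) by move=> Ta; rewrite -sub0r; exact: TB.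
have TD a b : T a -> T b -> T (a + b).
  by move=> Ta Tb; rewrite -[b]opprK; apply: TB => //; exact: TN.
pose J (g : {poly K}) := (forall i, T g`_i) /\ root g x.
pose D n := `[< exists g, [/\ J g, g != 0 & size g = n] >].
have /ex_minnP[n /asboolP[h [[Th hx] h0 hn]] minn] : exists n, D n.
  by exists (size f); apply/asboolP; exists f.
pose g := (lead_coef h)^-1 *: h.
have lh : lead_coef h != 0 by rewrite lead_coef_eq0.
have g_monic : lead_coef g = 1 by rewrite lead_coefZ mulVf.
have gn : size g = n by rewrite size_scale ?invr_eq0.
have Tg i : T g`_i by rewrite coefZ; apply: TM => //; apply: TV; exact: Th.
have gx : root g x by rewrite /root hornerZ (rootP hx) mulr0.
(* Division by [g] with coefficients kept in [T]: subtract a multiple of [g] that cancels the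
   leading term; minimality of [n] excludes a nonzero remainder. *)
have dvg k : forall u : {poly K}, (size u <= k)%N -> J u -> g %| u.
  elim: k => [|k IH] u uk [Tu ux].
    by move: uk; rewrite leqn0 size_poly_eq0 => /eqP->; exact: dvdp0.
  have [->|u0] := eqVneq u 0; first exact: dvdp0.
  have nu : (n <= size u)%N by apply: minn; apply/asboolP; exists u.
  pose w := (lead_coef u *: 'X^(size u - n)) * g.
  have Tw i : T w`_i.
    rewrite /w -scalerAl coefZ coefXnM; apply: TM; first exact: Tu.
    by case: ifP.
  rewrite -[u](subrK w); apply: dvdp_add; last exact: dvdp_mull.
  have n_gt0 : (0 < n)%N by rewrite -hn size_poly_gt0.
  apply: IH; last first.
    split=> [i|]; first by rewrite coefB; exact: TB.
    by rewrite /root hornerD hornerN /w hornerM (rootP ux) (rootP gx) mulr0 subr0.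
  have sw : size w = size u.
    rewrite /w -scalerAl size_scale ?lead_coef_eq0 // mulrC size_mulXn.
      by rewrite gn subnK.
    by rewrite -size_poly_gt0 gn.
  have lw : lead_coef w = lead_coef u.
    by rewrite /w lead_coefM lead_coefZ lead_coefXn mulr1 g_monic mulr1.
  rewrite -ltnS; apply: leq_trans uk.
  have u_gt0 : (0 < size u)%N by rewrite size_poly_gt0.
  rewrite -(prednK u_gt0) ltnS; apply/leq_sizeP => i.
  rewrite leq_eqVlt coefB => /orP[/eqP<-|si].
    by rewrite -{2}sw -!lead_coefE lw subrr.
  rewrite prednK // in si.
  by rewrite !nth_default ?subrr // sw.
have : g %| ('X - x%:P) ^+ p.
  have chP : p \in [pchar {poly K}] by rewrite pchar_poly.
  have -> : ('X - x%:P) ^+ p = 'X^p - (x ^+ p)%:P.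
    by rewrite -(expn1 p) (frob_expB chP) -rmorphXn.
  apply: (dvg _ _ (leqnn _)); split=> [i|]; last by rewrite /root !hornerE subrr.
  rewrite coefB coefXn coefC; apply: TB; first by case: eqP.
  by case: eqP.
case/dvdp_exp_XsubCP => j jp gj.
have {gj} gE : g = ('X - x%:P) ^+ j.
  apply/eqP; rewrite -eqp_monic //; first exact/monicP.
  by apply: monic_exp; exact: monicXsubC.
have nj : n = j.+1 by rewrite -gn gE size_exp_XsubC.
have j0 : (0 < j)%N.
  rewrite lt0n; apply/eqP => j0; move: gx; rewrite gE j0 expr0 /root hornerC.
  by rewrite oner_eq0.
have jltp : (j < p)%N.
  by rewrite -nj; apply: leq_trans fp; apply: minn; apply/asboolP; exists f.
have gj : g`_j.-1 = - (x *+ j).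
  have := @coefPn_prod_XsubC K (nseq j x).
  rewrite size_nseq -lt0n => /(_ j0).
  by rewrite !big_nseq !iter_mulr_1 -gE => ->; rewrite iter_addr_0.
have jK : (j%:R : K) != 0.
  rewrite -(dvdn_pcharf chKp); apply/negP => /(dvdn_leq j0).
  by rewrite leqNgt jltp.
have Tj : T j%:R.
  by elim: (j) => [|i Ti]; rewrite ?mulr0n // mulrSr; exact: TD.
have -> : x = - g`_j.-1 * j%:R^-1 by rewrite gj opprK -[x *+ j]mulr_natr mulfK.
by apply: TM; [exact: TN|exact: TV].
Qed.

(** Makes the residue field a [fieldType], as the polynomial argument requires. *)
Lemma residue_fieldP (A : localRing) : exists (K : fieldType) (f : {rmorphism A -> K}),
  (forall x, (f x == 0) = (x \in max_ideal A)) /\ forall y, exists x, f x = y.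
Proof.
pose Q := {ideal_quot (max_ideal A)}.
have pi0 x : (\pi_Q x == 0 :> Q) = (x \in max_ideal A).
  by rewrite -(rmorph0 (\pi_Q)) -Quotient.idealrBE subr0.
have inv_ex (y : Q) : exists z, (y != 0 -> z * y = 1) /\ (y = 0 -> z = 0).
  have [->|y0] := eqVneq y 0; first by exists 0.
  have [u uy] : exists u, u * repr y = 1.
    by apply: local_unit; rewrite -pi0 reprK.
  exists (\pi_Q u); split=> [_|y_eq0]; last by rewrite y_eq0 eqxx in y0.
  by rewrite -[y in _ * y]reprK -rmorphM uy rmorph1.
have [inv invP] := choice inv_ex.
have mulVf y : y != 0 -> inv y * y = 1 by have [] := invP y.
have inv0 : inv 0 = 0 by have [_] := invP 0; apply.
pose K : fieldType := HB.pack Q (GRing.ComNzRing_isField.Build Q mulVf inv0).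
exists K, (\pi_Q : {rmorphism A -> Q}); split; first exact: pi0.
by move=> y; exists (repr (y : Q)); exact: reprK.
Qed.

(** * The degree [[k : k^p]] is a power of [p] *)

Section ResidueDegree.
Variables (A : localRing) (p : nat) (chAp : p \in [pchar A]).
Local Notation m := (max_ideal A).
Let sm : set A := [set z | z \in m].

(* These subrings correspond to the fields between [k^p] and [k]. *)
Definition frob_subring (S : set A) := [/\ sm `<=` S, forall a, S (a ^+ p),
  forall a b, S a -> S b -> S (a + b) & forall a b, S a -> S b -> S (a * b)].

Let p1 : p = (p ^ 1)%N. Proof. by rewrite expn1. Qed.

Let fm e : fsub p e sm.
Proof. by have [h0 hD hM] := is_ideal_idealr m; split=> // a x; exact: hM. Qed.

Lemma frob_subring_fsub S : frob_subring S -> fsub p 1 S.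
Proof.
case=> mS Sp SD SM; split=> //; first by apply: mS; case: (fm 0).
by move=> a x Sx; rewrite -p1; exact: SM.
Qed.

(** In the residue field [S] becomes a subfield containing all [p]-th powers, over which [x] has
    degree less than [p]; pure inseparability puts the image of [x] in it, and [S] contains the
    kernel [m]. *)
Lemma frob_subring_pow S x i (c : nat -> A) : frob_subring S -> (0 < i < p)%N ->
  (forall l, S (c l)) -> x ^+ i = \sum_(l < i) c l * x ^+ l -> S x.
Proof.
move=> [mS Sp SD SM] /andP[i0 ip] Sc hx.
have [K [f [f0 fsurj]]] := residue_fieldP A.
have S1 : S 1 by rewrite -(expr1n _ p).
have SN a : S a -> S (- a).
  move=> Sa; rewrite -mulN1r; apply: (SM) => //.
  by rewrite -(expr1n A p) p1 -(frob_expN chAp) -p1.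
suff [s Ss /eqP] : (f @` S) (f x).
  rewrite -subr_eq0 -rmorphB f0 => h; rewrite -[x](subKr s).
  by apply: (SD) => //; apply: SN; apply: mS.
have fN a b : (f @` S) a -> (f @` S) b -> (f @` S) (a - b).
  move=> [u Su <-] [v Sv <-]; exists (u - v); rewrite ?rmorphB //.
  by apply: (SD) => //; exact: SN.
have chKp : p \in [pchar K] by exact: (rmorph_pchar f).
pose F : {poly K} := 'X^i - \poly_(l < i) f (c l).
have sF : size F = i.+1.
  by rewrite /F size_polyDl ?size_polyXn // size_polyN ltnS size_poly.
apply: (purely_inseparable_degree chKp (f := F)) => //.
- by exists 0; rewrite ?rmorph0 //; apply: mS; case: (fm 0).
- by exists 1; rewrite ?rmorph1.
- by move=> _ _ [u Su <-] [v Sv <-]; exists (u * v); rewrite ?rmorphM //; exact: SM.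
- move=> _ [u Su <-]; have [->|u0] := eqVneq (f u) 0.
    by rewrite invr0; exists 0; rewrite ?rmorph0 //; apply: mS; case: (fm 0).
  have [v vu] : exists v, v * u = 1 by apply: local_unit; rewrite -f0.
  (* The inverse [v] of [u], written as a product of elements of [S]. *)
  exists (v ^+ p * u ^+ p.-1).
    by apply: (SM) => //; elim: p.-1 => [|k IH]; rewrite ?expr0 // exprS; exact: SM.
  have -> : v ^+ p * u ^+ p.-1 = v.
    have := prime_gt0 (pcharf_prime chAp); case: (p) => // k _ /=.
    by rewrite exprSr mulrAC -exprMn vu expr1n mul1r.
  by apply: (mulIf u0); rewrite -rmorphM vu rmorph1 mulVf.
- by exists (x ^+ p); rewrite ?rmorphXn.
- move=> l; rewrite coefB coefXn coef_poly; apply: fN.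
    case: eqP => _; first by exists 1; rewrite ?rmorph1.
    by exists 0; rewrite ?rmorph0 //; apply: mS; case: (fm 0).
  case: ifP => _; first by exists (c l).
  by exists 0; rewrite ?rmorph0 //; apply: mS; case: (fm 0).
- by rewrite -size_poly_gt0 sF.
- rewrite /root hornerD hornerN hornerXn horner_poly -rmorphXn hx rmorph_sum.
  by under eq_bigr => l _ do rewrite rmorphM rmorphXn; rewrite subrr.
- by rewrite sF.
Qed.

(** Take [S' = S[x]]. As [x^p] is in [S], the powers [x^i] with [i < p] span it, and
    [frob_subring_pow] makes them independent modulo [m]: there are [p] layers, each as long as
    [S / m]. *)
Lemma frob_subring_extend S x n : frob_subring S -> ~ S x ->
  comp_series p 1 sm S n ->
  exists S', frob_subring S' /\ comp_series p 1 sm S' (p * n).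
Proof.
move=> subS nSx cs; have [mS Sp SD SM] := subS.
have [S0 _ SM1] := frob_subring_fsub subS.
have S1 : S 1 by rewrite -(expr1n _ p).
pose B i : set A := [set y | exists c : nat -> A,
  (forall l, S (c l)) /\ y = \sum_(l < i) c l * x ^+ l].
have B0 i : B i 0.
  by exists (fun=> 0); split=> //; rewrite big1 // => l _; rewrite mul0r.
have BD i y z : B i y -> B i z -> B i (y + z).
  move=> [c [Sc ->]] [d [Sd ->]]; exists (fun l => c l + d l).
  split=> [l|]; first exact: SD.
  by rewrite -big_split; apply: eq_bigr => l _; rewrite mulrDl.
have BM i s y : S s -> B i y -> B i (s * y).
  move=> Ss [c [Sc ->]]; exists (fun l => s * c l); split=> [l|]; first exact: SM.
  by rewrite mulr_sumr; apply: eq_bigr => l _; rewrite mulrA.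
have BX i s k : S s -> (k < i)%N -> B i (s * x ^+ k).
  move=> Ss ki; exists (fun l => if l == k then s else 0); split=> [l|].
    by case: eqP.
  rewrite (bigD1 (Ordinal ki)) //= eqxx big1 ?addr0 // => l /eqP lk.
  by case: eqP => [e|_]; [case: lk; exact: val_inj|rewrite mul0r].
have fB i : fsub p 1 (B i).
  by split=> // [y z|a y]; [exact: BD|apply: (BM); rewrite -p1].
have B1 : B 1%N = S.
  rewrite eqEsubset; split=> [_ [c [Sc ->]]|s Ss].
    by rewrite big_ord1 expr0 mulr1.
  by rewrite -[s]mulr1 -(expr0 x); exact: BX.
have SB i : (0 < i)%N -> S `<=` B i.
  by move=> i0 s Ss; rewrite -[s]mulr1 -(expr0 x); exact: BX.
have csB i : (0 < i <= p)%N -> comp_series p 1 sm (B i) (i * n).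
  elim: i => // -[|i] IH /andP[_ ip]; first by rewrite B1 mul1n.
  rewrite mulSn addnC; apply: comp_series_cat; first exact: IH (ltnW ip).
  pose f a := a * x ^+ i.+1.
  have {1}-> : B i.+1 = fsum (B i.+1) (f @` sm).
    rewrite eqEsubset; split=> [y By|_ [y [_ [By [a am <-] ->]]]].
      by exists y, 0; rewrite addr0; split=> //; exists 0; rewrite /f ?mul0r //; case: (fm 0).
    apply: (BD) => //; apply: SB => //; apply: mS; rewrite /f /sm /mkset mulrC.
    by rewrite idealMr.
  have -> : B i.+2 = fsum (B i.+1) (f @` S).
    rewrite eqEsubset; split=> [_ [c [Sc ->]]|_ [_ [_ [[c [Sc ->]] [s Ss <-] ->]]]].
      exists (\sum_(l < i.+1) c l * x ^+ l), (f (c i.+1)).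
      by split; [exists c|exists (c i.+1)|rewrite big_ord_recr].
    apply: (BD); last exact: BX.
    exists (fun l => if (l < i.+1)%N then c l else 0); split=> [l|]; first by case: ifP.
    rewrite [RHS]big_ord_recr /= ltnn mul0r addr0.
    by apply: eq_bigr => l _; rewrite ltn_ord.
  apply: (comp_series_map chAp (fm 1) (fB i.+1)) cs.
  - by move=> a b; rewrite /f mulrDl.
  - by move=> a b; rewrite /f mulrA.
  move=> s Ss [c [Sc hs]]; apply: contrapT => /negP sm'.
  have [u us] := local_unit sm'.
  pose w := u ^+ p * s ^+ p.-1.
  have Sw : S w.
    by apply: (SM) => //; elim: p.-1 => [|k IHk]; rewrite ?expr0 // exprS; exact: SM.
  have ws : w * s = 1.
    have := prime_gt0 (pcharf_prime chAp); rewrite /w; case: (p) => // k _ /=.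
    by rewrite -mulrA -exprSr -exprMn us expr1n.
  apply: nSx; apply: (frob_subring_pow (i := i.+1) (c := fun l => w * c l)) => //.
    by move=> l; exact: SM.
  have -> : x ^+ i.+1 = w * f s by rewrite /f mulrA ws mul1r.
  by rewrite hs mulr_sumr; apply: eq_bigr => l _; rewrite mulrA.
have p_gt0 := prime_gt0 (pcharf_prime chAp).
exists (B p); split; last by apply: csB; rewrite p_gt0 leqnn.
have BXX k y : B p y -> B p (x ^+ k * y).
  elim: k y => [|k IH] y By; first by rewrite expr0 mul1r.
  rewrite exprSr -mulrA; apply: IH; case: By => c [Sc ->].
  rewrite mulr_sumr; apply: (big_ind (B p)) => // [y' z'|l _]; first exact: BD.
  rewrite mulrCA -exprS; have := ltn_ord l; rewrite leq_eqVlt => /orP[/eqP lp|].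
    by rewrite lp; apply: SB => //; exact: SM.
  exact: BX.
split.
- by apply: subset_trans mS _; exact: SB.
- by move=> a; exact: SB.
- exact: BD.
- move=> y z [c [Sc ->]] Bz; rewrite mulr_suml.
  apply: (big_ind (B p)) => // [y' z'|l _]; first exact: BD.
  by rewrite -mulrA; apply: (BM) => //; exact: BXX.
Qed.

(** Start from the [p]-th powers modulo [m], of length 1, and adjoin elements, each multiplying the
    length by [p]. As the length stays at most [d], there is a largest exponent, and then nothing is
    left to adjoin. *)
Lemma frob_degree_ppow d : comp_series p 1 sm setT d -> exists k, d = (p ^ k)%N.
Proof.
move=> csd; have p_gt1 := prime_gt1 (pcharf_prime chAp).
pose D k := `[< exists S, frob_subring S /\ comp_series p 1 sm S (p ^ k) >].
have D0 : exists k, D k.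
  have [m0 mD mM] := fm 1.
  exists 0%N; apply/asboolP; exists (fadd p 1 sm 1); split; last first.
    apply: CompSeriesS; first exact: CompSeries0.
      by rewrite /sm /mkset /= idealr1.
    by move=> a am; rewrite mulr1 -p1 /sm /mkset /= expr_idealr // ltnW.
  split.
  - exact: sub_fadd.
  - by move=> a; exists a, 0; rewrite mulr1 add0r -p1.
  - by move=> a b; case: (fsub_fadd chAp 1 (fm 1)) => _ + _; apply.
  - move=> _ _ [a [z [mz ->]]] [b [w [mw ->]]]; exists (a * b), (z * w + z * b ^+ p + a ^+ p * w).
    split; last by rewrite exprMn -p1; ring.
    rewrite /sm /mkset rpredD ?rpredD //.
    + by rewrite mulrC idealMr.
    + by rewrite mulrC idealMr.
    + by rewrite idealMr.
have Dd k : D k -> (k <= d)%N.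
  move=> /asboolP[S [subS cs]]; apply: leq_trans (ltnW (ltn_expl k p_gt1)) _.
  have [c [hc sc]] := comp_series_chain chAp (fm 1) cs.
  apply: (comp_series_max chAp (fm 1) csd (c := c)) => // i ik.
  by have [? ? _] := hc i ik; split.
case: (ex_maxnP D0 Dd) => k /asboolP[S [subS cs]] maxk; exists k.
suff ST : S = setT.
  by rewrite ST in cs; exact: (comp_series_uniq chAp (fm 1) csd cs).
rewrite eqEsubset; split=> // x _; apply: contrapT => nSx.
have [S' [subS' cs']] := frob_subring_extend subS nSx cs.
have : (k.+1 <= k)%N by apply: maxk; apply/asboolP; exists S'; rewrite expnS.
by rewrite ltnn.
Qed.

End ResidueDegree.

Lemma fin_gen_family (R : comNzRingType) (I : set R) n (g : nat -> R) :
  is_ideal I -> (forall i, (i < n)%N -> I (g i)) ->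
  (forall y, I y -> exists c : nat -> R, y = \sum_(i < n) c i * g i) ->
  fin_gen (I : set R^o).
Proof.
move=> iI gI gen; exists (mkseq g n).
rewrite eqEsubset; split=> y.
  move=> /gen[c ->]; exists (fun i => c i).
  by rewrite size_mkseq; apply: eq_bigr => i _; rewrite nth_mkseq.
move=> [c ->]; apply: is_ideal_sum => // i _.
have i_n : (i < n)%N by rewrite -[X in (_ < X)%N](size_mkseq g n).
by have [_ _ h] := iI; apply: h; rewrite nth_mkseq //; exact: gI.
Qed.

Section LocalizationFinite.
Variables (R : comNzRingType) (P : Spec R).

Lemma to_loc_unit s : s \notin P -> exists u, u * to_loc P s = 1.
Proof. by move=> sP; apply: (@local_unit (localization P)); rewrite loc_max_to_loc. Qed.

Lemma noetherian_localization : noetherian R -> noetherian (localization P).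
Proof.
move=> nR I [I0 IL].
have iI : @is_ideal (localization P) I.
  split=> // [x y Ix Iy|a x Ix]; first by have := IL 1 x y Ix Iy; rewrite scale1r.
  by have := IL a x 0 Ix I0; rewrite addr0.
have [_ ID IM] := iI.
have [|n [g [gI gen]]] := @noetherian_gen _ [set x | I (to_loc P x)] nR.
  split; rewrite /mkset ?rmorph0 //.
    by move=> x y Ix Iy; rewrite rmorphD; exact: ID.
  by move=> a x Ix; rewrite rmorphM; exact: IM.
apply: (@fin_gen_family (localization P) I n (fun i => to_loc P (g i))) => // [i _|a Ia]; first exact: gI.
have [s [x [sP sx]]] := loc_fracP a; have [u us] := to_loc_unit sP.
have [|c hc] := gen x; first by rewrite /mkset -sx; exact: IM.
exists (fun i => u * to_loc P (c i)).
rewrite -[a]mul1r -us -mulrA sx hc rmorph_sum mulr_sumr.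
by apply: eq_bigr => i _; rewrite rmorphM mulrA.
Qed.

Lemma frob_gen_localization (p : nat) (chRp : p \in [pchar R]) e n g :
  frob_gen p e n g -> @frob_gen p (localization P) e n (to_loc P \o g).
Proof.
move=> gen a; have [s [x [sP sx]]] := loc_fracP a; have [u us] := to_loc_unit sP.
have [c hc] := gen (s ^+ (p ^ e).-1 * x).
exists (fun i => u * to_loc P (c i)).
have -> : a = u ^+ (p ^ e) * to_loc P (s ^+ (p ^ e).-1 * x).
  rewrite rmorphM rmorphXn /= -sx [X in _ * X]mulrA -exprSr prednK ?(frob_exp_gt0 chRp) //.
  by rewrite mulrA -exprMn us expr1n mul1r.
rewrite hc rmorph_sum mulr_sumr; apply: eq_bigr => i _.
by rewrite rmorphM rmorphXn exprMn mulrA.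
Qed.

End LocalizationFinite.

Section Alpha.
Variables (A : localRing) (p : nat) (chAp : p \in [pchar A]).
Local Notation m := (max_ideal A).
Let Q := residue_field A.

Lemma residue_pi_eq0 x : (\pi_Q x == 0) = (x \in m).
Proof. by rewrite -(rmorph0 (\pi_Q)) -Quotient.idealrBE subr0. Qed.

Let pchQ : p \in [pchar Q].
Proof. exact: (rmorph_pchar (\pi_Q : {rmorphism A -> Q})). Qed.

Let p1 : p = (p ^ 1)%N. Proof. by rewrite expn1. Qed.

Lemma pbasis_frob_degree d : pbasis p (max_spec A) d -> frob_degree p (residue_field A) = d.
Proof.
move=> pb; rewrite /frob_degree; case: xgetP => [n _ [b hb]|/(_ d)[]].
  apply: (pbasis_uniq chAp) pb; exists (fun i => oapp (fun j => repr (b j)) 0 (insub i)).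
    move=> c hc i i_n.
    have [c0 [_ uniq0]] := hb 0.
    have e0 : c0 = fun=> 0.
      apply: uniq0; split=> [j|]; first by exists 0; rewrite p1 (frob_exp0 pchQ).
      by rewrite big1 // => j _; rewrite mul0r.
    have e1 : c0 = fun j => \pi_Q (c j) ^+ p.
      apply: uniq0; split=> [j|]; first by exists (\pi_Q (c j)).
      move: hc; rewrite max_specE -residue_pi_eq0 rmorph_sum => /eqP hc.
      rewrite -[LHS]hc; apply: eq_bigr => j _.
      by rewrite rmorphM rmorphXn valK /= reprK.
    have /eqP : \pi_Q (c i ^+ p) = 0.
      by have := congr1 (fun h => h (Ordinal i_n)) e1; rewrite e0 rmorphXn.
    rewrite residue_pi_eq0 -max_specE; elim: (p) => [|k IH]; first by rewrite idealr1.
    by rewrite exprS prime_idealrM => /orP[].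
  move=> y; have [c [[cp hc] _]] := hb (\pi_Q y).
  have [z hz] := choice cp.
  exists 1, (fun i => oapp (fun j => repr (z j)) 0 (insub i)); rewrite notin_1; split=> //.
  rewrite max_specE -residue_pi_eq0 expr1n mul1r rmorphB /= hc rmorph_sum subr_eq0.
  apply/eqP; apply: eq_bigr => i _.
  by rewrite valK rmorphM rmorphXn /= !reprK hz.
(* Conversely the reduced family is a basis of the residue field, so the default value of [xget]
   does not occur. *)
case: pb => r rind rspan; exists (fun i => \pi_Q (r i)) => y.
have [s [c [sm hc]]] := rspan (repr y); have [u us] := local_unit sm.
have hy : y = \sum_(i < d) \pi_Q (u * c i) ^+ p * \pi_Q (r i).
  have <- : \pi_Q (\sum_(i < d) (u * c i) ^+ p * r i) =
      \sum_(i < d) \pi_Q (u * c i) ^+ p * \pi_Q (r i).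
    by rewrite rmorph_sum; apply: eq_bigr => i _; rewrite rmorphM rmorphXn.
  apply/eqP; rewrite -{1}[y]reprK -subr_eq0 -rmorphB residue_pi_eq0.
  have -> : repr y - \sum_(i < d) (u * c i) ^+ p * r i =
      u ^+ p * (s ^+ p * repr y - \sum_(i < d) c i ^+ p * r i).
    rewrite mulrBr mulrA -exprMn us expr1n mul1r mulr_sumr; congr (_ - _).
    by apply: eq_bigr => i _; rewrite exprMn mulrA.
  by rewrite idealMr.
exists (fun i => \pi_Q (u * c i) ^+ p); split.
  by split=> // i; exists (\pi_Q (u * c i)).
move=> c' [/choice[z hz] hy']; apply/funext => i; rewrite hz; congr (_ ^+ p).
pose w j := u * c j - oapp (fun i => repr (z i)) 0 (insub j).
have : w i \in max_spec A.
  apply: (rind w) => //; rewrite max_specE -residue_pi_eq0 rmorph_sum.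
  have wE (j : 'I_d) : \pi_Q (w j ^+ p * r j) =
      \pi_Q (u * c j) ^+ p * \pi_Q (r j) - c' j * \pi_Q (r j).
    rewrite rmorphM rmorphXn /w valK /= rmorphB /= reprK hz.
    by rewrite p1 (frob_expB pchQ) mulrBl.
  rewrite (eq_bigr _ (fun j _ => wE j)).
  by rewrite sumrB -hy -hy' subrr.
by rewrite max_specE -residue_pi_eq0 /w valK /= rmorphB /= reprK subr_eq0 => /eqP.
Qed.

Lemma pbasis_alpha d : pbasis p (max_spec A) d -> d = (p ^ alpha p A)%N.
Proof.
move=> pb; rewrite /alpha (pbasis_frob_degree pb).
have [k ->] := frob_degree_ppow chAp (pbasis_length chAp pb).
by rewrite trunc_expnK // prime_gt1 // (pcharf_prime chAp).
Qed.

End Alpha.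

(** * Kunz's formula and the dimension of localizations *)

Section Preimage.
Variables (R S : comNzRingType) (f : {rmorphism R -> S}) (P : Spec S).

Lemma spec_pre_closed : idealr_closed (fun x : R => f x \in P).
Proof.
split=> [||a u v uP vP].
- by change (f 0 \in P); rewrite rmorph0 idealr0.
- by change (f 1 \notin P); rewrite rmorph1 idealr1.
change (f (a * u + v) \in P); rewrite rmorphD rmorphM.
by rewrite (rpredD (idealMr _ uP) vP).
Qed.

Lemma spec_pre_prime : prime_idealr_closed (fun x : R => f x \in P).
Proof.
move=> u v uv; change ((f u \in P) || (f v \in P)).
by rewrite -prime_idealrM -rmorphM; exact: uv.
Qed.

Definition spec_pre : Spec R := PrimeIdeal spec_pre_closed spec_pre_prime.

Lemma spec_preE x : (x \in spec_pre) = (f x \in P).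
Proof. by []. Qed.

End Preimage.

Lemma Spec_ext (R : comNzRingType) (P Q : Spec R) : P =i Q -> P = Q.
Proof.
case: P Q => [P cP pP] [Q cQ pQ] PQ.
have E : P = Q by apply/funext => x; exact: PQ.
by subst Q; congr PrimeIdeal; exact: Prop_irrelevance.
Qed.

Section FractionHom.
Variables (R S : comNzRingType) (f : {rmorphism R -> S}) (Q : Spec R).
Hypothesis fden : forall a, exists s x, s \notin Q /\ f s * a = f x.
Hypothesis funit : forall s, s \notin Q -> exists u, u * f s = 1.

Lemma unit_notin (P : Spec S) s : s \notin Q -> f s \notin P.
Proof.
move=> /funit[u us]; apply/negP => sP.
by have := idealr1 (prime_ideal P); rewrite -us idealMr.
Qed.

Lemma spec_pre_sub (P : Spec S) : {subset spec_pre f P <= Q}.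
Proof. by move=> x xP; apply: contraT => /(unit_notin P); rewrite -spec_preE xP. Qed.

Lemma spec_pre_le (P P' : Spec S) :
  {subset spec_pre f P <= spec_pre f P'} -> {subset P <= P'}.
Proof.
move=> h a aP; have [s [x [sQ sx]]] := fden a.
have : x \in spec_pre f P' by apply: h; rewrite spec_preE -sx idealMr.
by rewrite spec_preE -sx prime_idealrM (negPf (unit_notin P' sQ)).
Qed.

(** [P'] is the extension of [P], described by fractions. This is the surjectivity of the
    correspondence between primes of [S] and primes of [R] from the kernel of [f] up to [Q]. *)
Lemma spec_extend (P : Spec R) : {subset P <= Q} -> (forall x, f x = 0 -> x \in P) ->
  exists P' : Spec S, spec_pre f P' = P.
Proof.
move=> PQ f0.
have fP x s y : s \notin Q -> f s * f x = f y -> y \in P -> x \in P.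
  move=> sQ /eqP; rewrite -rmorphM -subr_eq0 -rmorphB => /eqP/f0 h yP.
  have : s * x \in P by rewrite -(subrK y (s * x)) rpredD.
  rewrite prime_idealrM => /orP[/PQ sQ'|//].
  by rewrite sQ' in sQ.
pose I := [set a | exists s x, [/\ s \notin Q, x \in P & f s * a = f x]].
have [||a b [s [x [sQ xP sx]]]|P' P'E] := @Spec_of_set S I.
- split.
  + by exists 1, 0; rewrite notin_1 idealr0 mulr0 rmorph0.
  + move=> a b [s [x [sQ xP sx]]] [t [y [tQ yP ty]]].
    exists (s * t), (t * x + s * y); rewrite notin_mul // rpredD ?idealMr //; split=> //.
    by rewrite rmorphD !rmorphM -sx -ty; ring.
  + move=> c a [s [x [sQ xP sx]]]; have [t [y [tQ ty]]] := fden c.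
    exists (s * t), (y * x); rewrite notin_mul // idealMr //; split=> //.
    by rewrite !rmorphM -sx -ty; ring.
- move=> [s [x [sQ xP]]]; rewrite mulr1 => sx.
  have := fP 1 s x sQ; rewrite rmorph1 mulr1 => /(_ sx xP).
  by rewrite idealr1.
- have [t [y [tQ ty]]] := fden a; have [u [z [uQ uz]]] := fden b.
  have : y * z \in P.
    apply: (fP _ s (t * u * x)) => //; last by rewrite idealMr.
    by rewrite !rmorphM -sx -ty -uz; ring.
  by rewrite prime_idealrM => /orP[h|h]; [left; exists t, y|right; exists u, z].
exists P'; apply: Spec_ext => x; rewrite spec_preE; apply/idP/idP => [/P'E|xP].
  by move=> [s [y [sQ yP sy]]]; exact: fP sQ sy yP.
by apply/P'E; exists 1, x; rewrite notin_1 rmorph1 mul1r.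
Qed.

End FractionHom.

Definition primes_between (R : comNzRingType) (P Q : Spec R) : set (set R) :=
  [set I | exists P1 : Spec R,
    [/\ {subset P <= P1}, {subset P1 <= Q} & I = [set x | x \in P1]]].

Lemma max_chain_eq T T' (F : set (set T)) (G : set (set T')) :
  (forall n, has_chain F n <-> has_chain G n) -> max_chain F = max_chain G.
Proof.
move=> h; rewrite /max_chain; congr (xget _ _); rewrite eqEsubset; split=> n [c m].
  by split; [exact/h|move=> k /h; exact: m].
by split; [exact/h|move=> k /h; exact: m].
Qed.

Lemma has_chain_map T T' (F : set (set T)) (G : set (set T')) (phi : set T -> set T') :
  (forall I, F I -> G (phi I)) ->
  (forall I J, F I -> F J -> I `<` J -> phi I `<` phi J) ->
  forall n, has_chain F n -> has_chain G n.
Proof.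
move=> FG mono n [c [Fc cs]]; exists (phi \o c); split=> i i_n /=; first exact/FG/Fc.
by apply: mono; [exact: Fc (ltnW _)|exact: Fc|exact: cs].
Qed.

(** The hypotheses characterise [S] as the localization of [R / P] at [Q]; chains travel both ways
    by contraction and extension of primes. *)
Lemma krull_dim_fractions (R S : comNzRingType) (f : {rmorphism R -> S}) (P Q : Spec R) :
  (forall a, exists s x, s \notin Q /\ f s * a = f x) ->
  (forall s, s \notin Q -> exists u, u * f s = 1) ->
  (forall x, f x = 0 <-> x \in P) -> krull_dim S = max_chain (primes_between P Q).
Proof.
move=> fden funit fP; apply: max_chain_eq => n; split.
  apply: (has_chain_map (phi := fun I => f @^-1` I)).
    move=> _ [P1 ->]; exists (spec_pre f P1); split=> //; last exact: spec_pre_sub.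
    by move=> x /fP fx; rewrite spec_preE fx idealr0.
  move=> _ _ [P1 ->] [P2 ->] [le12 nle]; split; first by move=> x; exact: le12.
  move=> h; apply: nle; apply: (spec_pre_le fden funit); exact: h.
apply: (has_chain_map (phi := fun J => [set a | exists s x, [/\ s \notin Q, J x & f s * a = f x]])).
  move=> _ [P1 [PP1 P1Q ->]].
  have [|P' P'E] := spec_extend fden P1Q; first by move=> x /fP/PP1.
  exists P'; rewrite eqEsubset; split=> a.
    move=> [s [x [sQ]]]; rewrite /mkset -P'E spec_preE => xP sx.
    by move: xP; rewrite -sx prime_idealrM (negPf (unit_notin funit P' sQ)).
  move=> aP; have [s [x [sQ sx]]] := fden a; exists s, x; split=> //.
  by rewrite /mkset -P'E spec_preE -sx idealMr.
move=> _ _ [P1 [PP1 P1Q ->]] [P2 [PP2 P2Q ->]] [le12 nle]; split.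
  by move=> a [s [x [sQ xP sx]]]; exists s, x; split=> //; exact: le12.
move=> h; apply: nle => x xP2; have [|s [y [sQ yP sy]]] := h (f x).
  by exists 1, x; rewrite notin_1 rmorph1 mul1r.
have : s * x - y \in P1 by apply: PP1; apply/fP; rewrite rmorphB rmorphM sy subrr.
move=> hxy; have : s * x \in P1 by rewrite -(subrK y (s * x)) rpredD.
by rewrite prime_idealrM => /orP[/P1Q|//]; rewrite (negPf sQ).
Qed.

Section Kunz.
Variables (p : nat) (R : comNzRingType) (chRp : p \in [pchar R]).
Variables (noethR : noetherian R) (mu : nat) (g : nat -> R) (gen : frob_gen p 1 mu g).
Implicit Types P Q : Spec R.

Local Notation alph P := (alpha p (localization P)).
Let p_gt1 : (1 < p)%N. Proof. exact: prime_gt1 (pcharf_prime chRp). Qed.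

Lemma pbasis_expn_alpha P : pbasis p P (p ^ alph P).
Proof.
have [k _ pb] := pbasis_exists chRp P gen.
have chL : p \in [pchar localization P] := loc_pchar P chRp.
by rewrite -(pbasis_alpha chL (pbasis_localization chRp pb)).
Qed.

(** A bound independent of [P], which will cap the length of every chain of primes. *)
Lemma alpha_le P : (alph P <= mu)%N.
Proof.
have [k k_mu pb] := pbasis_exists chRp P gen.
apply: leq_trans k_mu; rewrite (pbasis_uniq chRp pb (pbasis_expn_alpha P)).
exact: ltnW (ltn_expl _ p_gt1).
Qed.

Lemma alpha_adjacent P Q : {subset P <= Q} -> ~ {subset Q <= P} ->
  (forall P1, {subset P <= P1} -> {subset P1 <= Q} ->
     {subset P1 <= P} \/ {subset Q <= P1}) ->
  alph P = (alph Q).+1.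
Proof.
move=> PQ nQP adj; pose A := localization Q; pose f : {rmorphism R -> A} := to_loc Q.
have chA : p \in [pchar A] := loc_pchar Q chRp.
have fden : forall a : A, exists s x, s \notin Q /\ f s * a = f x by exact: loc_fracP.
have funit s : s \notin Q -> exists u, u * f s = 1 by exact: to_loc_unit.
have [x xQ xP] : exists2 x, x \in Q & x \notin P.
  apply: contrapT => h; apply: nQP => x xQ; apply: contraT => xP.
  by case: h; exists x.
have [|P' P'E] := spec_extend fden PQ.
  move=> y /to_loc_eq0[t tQ ty]; have : t * y \in P by rewrite ty idealr0.
  by rewrite prime_idealrM => /orP[/PQ tQ'|//]; rewrite tQ' in tQ.
have fP' y : (f y \in P') = (y \in P) by rewrite -P'E.
have pbP' : pbasis p P' (p ^ alph P).
  apply: (pbasis_transfer chRp fP') (pbasis_expn_alpha P) => a.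
  have [s [y [sQ sy]]] := fden a; exists s, y; split=> //.
  by apply: contra sQ; exact: PQ.
have := @adjacent_rank A p chA (@noetherian_localization R Q noethR) P' (f x).
move=> /(_ _ _ _ _ _ _ _ (@frob_gen_localization R Q p chRp 1 mu g gen) pbP'
  (pbasis_localization chRp (pbasis_expn_alpha Q))).
rewrite -expnS => /(_ _ _ _)/(expnI p_gt1); apply.
- move=> Q' PQ'; have [||h|h] := adj (spec_pre f Q').
  + by move=> y yP; rewrite spec_preE; apply: PQ'; rewrite fP'.
  + exact: spec_pre_sub.
  + by left; apply: (spec_pre_le fden funit) => y /h; rewrite P'E.
  + right=> a am; have [s [y [sQ sy]]] := fden a.
    have : y \in Q by rewrite -(loc_max_to_loc Q) -[to_loc Q y]sy idealMr.
    by move=> /h; rewrite spec_preE -sy prime_idealrM (negPf (unit_notin funit Q' sQ)).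
- by rewrite fP'.
- by rewrite /f loc_max_to_loc.
Qed.

(** Choose [P1] maximal among the primes from [P] to [Q] other than [Q]: nothing lies strictly
    between [P1] and [Q], so [alpha_adjacent] applies. *)
Lemma prime_below P Q : {subset P <= Q} -> ~ {subset Q <= P} ->
  exists P1, [/\ {subset P <= P1}, {subset P1 <= Q}, ~ {subset Q <= P1} &
    alph P1 = (alph Q).+1].
Proof.
move=> PQ nQP.
pose F := [set I | exists P1 : Spec R, [/\ {subset P <= P1}, {subset P1 <= Q},
  ~ {subset Q <= P1} & I = [set x | x \in P1]]].
have [||I [[P1 [PP1 P1Q nQP1 IE]] maxI]] := noetherian_max (P := F) noethR.
- by exists [set x | x \in P], P; split.
- by move=> _ [P1 [_ _ _ ->]]; exact: is_ideal_idealr (prime_ideal P1).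
exists P1; split=> //; apply: alpha_adjacent => // P2 P12 P2Q.
have [h|h] := pselect ({subset Q <= P2}); [by right|left].
have := maxI [set x | x \in P2]; rewrite IE => /(_ _ _)E x xP2.
suff : [set y | y \in P1] x by [].
rewrite -E //; exists P2; split=> //.
by move=> y /PP1/P12.
Qed.

(** A saturated chain is built downward from [Q], alpha growing by exactly one per step. [k] is the
    fuel: alpha is at most [mu], so once it is spent no further step down exists. *)
Lemma alpha_chain k P Q : (mu <= k + alph Q)%N -> {subset P <= Q} ->
  exists n (c : nat -> Spec R), [/\ alph P = (alph Q + n)%N,
    (forall i, (i <= n)%N -> {subset P <= c i} /\ {subset c i <= Q}) &
    (forall i, (i < n)%N -> {subset c i <= c i.+1} /\ ~ {subset c i.+1 <= c i})].
Proof.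
elim: k Q => [|k IH] Q hk PQ.
all: have [QP|nQP] := pselect ({subset Q <= P});
  first by (have -> : P = Q by apply: Spec_ext => x; apply/idP/idP; [exact: PQ|exact: QP]);
    exists 0%N, (fun=> Q); split; rewrite ?addn0 // => i _; split.
all: have [P1 [PP1 P1Q nQP1 E]] := prime_below PQ nQP.
  by have := alpha_le P1; rewrite E ltnNge hk.
have [|n [c [an hc sc]]] := IH P1 _ PP1; first by rewrite E addnS -addSn.
exists n.+1, (fun i => if (i <= n)%N then c i else Q); split.
- by rewrite an E addSnnS.
- move=> i _; case: ifP => [i_n|_]; last by split.
  by have [? h] := hc i i_n; split=> // x /h/P1Q.
move=> i; rewrite ltnS => i_n; rewrite i_n; case: ltnP => [|n_i]; first exact: sc.
have [_ h] := hc i i_n; split=> [x /h/P1Q //|QP1].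
by apply: nQP1 => x /QP1/h.
Qed.

Lemma alpha_mono P Q : {subset P <= Q} -> (alph Q <= alph P)%N.
Proof.
move=> PQ; have [|n [c [-> _ _]]] := @alpha_chain mu P Q _ PQ; first exact: leq_addr.
exact: leq_addr.
Qed.

Lemma alpha_strict P Q : {subset P <= Q} -> ~ {subset Q <= P} -> (alph Q < alph P)%N.
Proof.
move=> PQ nQP; have [P1 [PP1 _ _ <-]] := prime_below PQ nQP.
exact: alpha_mono.
Qed.

Lemma max_chain_primes_between P Q : {subset P <= Q} ->
  max_chain (primes_between P Q) = (alph P - alph Q)%N.
Proof.
move=> PQ; rewrite /max_chain.
have [|n [c [an hc sc]]] := @alpha_chain mu P Q _ PQ; first exact: leq_addr.
have ub k : has_chain (primes_between P Q) k -> (k <= n)%N.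
  move=> [c' [hc' sc']].
  (* Count links from the top: the prime [j] links below the end has alpha at least [alph Q + j]. *)
  suff h j : (j <= k)%N -> forall P1 : Spec R, c' (k - j)%N = [set x | x \in P1] ->
      {subset P1 <= Q} -> (alph Q + j <= alph P1)%N.
    have [P1 [PP1 P1Q cP1]] := hc' 0%N isT.
    rewrite -(leq_add2l (alph Q)) -an; apply: leq_trans (alpha_mono PP1).
    by apply: h => //; rewrite subnn.
  elim: j => [|j IHj] jk P1 cP1 P1Q; first by rewrite addn0; exact: alpha_mono.
  have [P2 [_ P2Q cP2]] := hc' (k - j)%N (leq_subr _ _).
  rewrite addnS; apply: leq_ltn_trans (IHj (ltnW jk) P2 cP2 P2Q) _.
  have [le12 nle] : c' (k - j.+1)%N `<` c' (k - j)%N.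
    by rewrite -(subnSK jk); apply: sc'; rewrite -{2}(subnKC jk) addSn ltnS leq_addl.
  by rewrite cP1 cP2 in le12 nle; apply: alpha_strict.
have chn : has_chain (primes_between P Q) n.
  exists (fun i => [set x | x \in c i]); split=> i i_n.
    by have [? ?] := hc i i_n; exists (c i).
  by have [? ?] := sc i i_n; split.
rewrite an addKn; case: xgetP => [k _ [ck hk]|/(_ n)[]]; last by split.
by apply/eqP; rewrite eqn_leq ub //= hk.
Qed.

Hypothesis eqdimR : locally_equidimensional R.

(** A prime below [Q] with the largest alpha is minimal, since alpha would be larger strictly below
    it. *)
Lemma minimal_prime Q : exists P0 : Spec R, {subset P0 <= Q} /\
  forall P, {subset P <= P0} -> {subset P0 <= P}.
Proof.
pose D k := `[< exists P, {subset P <= Q} /\ alph P = k >].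
have D0 : exists k, D k by exists (alph Q); apply/asboolP; exists Q; split.
have Dmu k : D k -> (k <= mu)%N by move=> /asboolP[P [_ <-]]; exact: alpha_le.
have [k /asboolP[P0 [P0Q <-]] maxk] := ex_maxnP D0 Dmu.
exists P0; split=> // P PP0; apply: contrapT => nP0P.
have := alpha_strict PP0 nP0P; rewrite ltnNge maxk //.
by apply/asboolP; exists P; split=> // x /PP0/P0Q.
Qed.

Lemma dim_alpha P0 Q : {subset P0 <= Q} -> (forall P, {subset P <= P0} -> {subset P0 <= P}) ->
  (krull_dim (localization Q) + alph Q)%N = alph P0.
Proof.
move=> P0Q minP0; pose A := localization Q; pose f : {rmorphism R -> A} := to_loc Q.
have fden : forall a : A, exists s x, s \notin Q /\ f s * a = f x by exact: loc_fracP.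
have funit s : s \notin Q -> exists u, u * f s = 1 by exact: to_loc_unit.
have [|P' P'E] := spec_extend fden P0Q.
  move=> y /to_loc_eq0[t tQ ty]; have : t * y \in P0 by rewrite ty idealr0.
  by rewrite prime_idealrM => /orP[/P0Q tQ'|//]; rewrite tQ' in tQ.
pose S := {ideal_quot (prime_ideal P')}.
have <- : krull_dim S = krull_dim A.
  apply: eqdimR => Q' Q'P'; apply: (spec_pre_le fden funit) => x.
  rewrite P'E => /minP0; apply=> y; rewrite -P'E !spec_preE; exact: Q'P'.
pose h : {rmorphism R -> S} := (\pi_S : {rmorphism A -> S}) \o f.
rewrite (@krull_dim_fractions R S h P0 Q) ?max_chain_primes_between ?subnK //.
- exact: alpha_mono.
- move=> a; have [s [x [sQ sx]]] := fden (repr a); exists s, x; split=> //.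
  by rewrite /h /= -[a]reprK -rmorphM sx.
- move=> s /funit[u us]; exists (\pi_S u); rewrite /h /= -rmorphM us; exact: rmorph1.
- move=> x; rewrite -P'E spec_preE /h /=; split=> [/eqP|xP].
    by rewrite -(rmorph0 (\pi_S)) -Quotient.idealrBE subr0.
  by apply/eqP; rewrite -(rmorph0 (\pi_S)) -Quotient.idealrBE subr0.
Qed.

Lemma dim_alpha_specialize P Q : {subset P <= Q} ->
  (krull_dim (localization P) + alph P)%N = (krull_dim (localization Q) + alph Q)%N.
Proof.
move=> PQ; have [P0 [P0P minP0]] := minimal_prime P.
rewrite !(dim_alpha _ minP0) // => x /P0P; exact: PQ.
Qed.

(** The list stands in for the minimal primes. A maximal ideal [I] without such a list is not prime;
    if it contains [x y] but neither factor, the lists for [I + (x)] and [I + (y)] together serve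
    for [I]. *)
Lemma finite_primes : exists s : seq (Spec R), forall Q, exists2 P, P \in s & {subset P <= Q}.
Proof.
pose cov (I : set R) (s : seq (Spec R)) := forall Q : Spec R, (forall x, I x -> x \in Q) ->
  exists2 P, P \in s & {subset P <= Q}.
suff [s hs] : exists s, cov [set 0] s.
  by exists s => Q; apply: hs => _ ->; exact: idealr0.
apply: contrapT => ncov0.
pose F := [set I | is_ideal I /\ ~ exists s, cov I s].
have [||I [[iI nI] maxI]] := noetherian_max (P := F) noethR.
- exists [set 0]; split=> //; split=> //; first by move=> x y -> ->; rewrite /= addr0.
  by move=> a x ->; rewrite /= mulr0.
- by move=> I [].
have big x : ~ I x -> exists s, cov (idealD I x) s.
  move=> nx; apply: contrapT => nc; apply: nx.
  rewrite -(maxI (idealD I x)); first exact: idealD_id.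
    by split=> //; exact: is_ideal_idealD.
  exact: sub_idealD.
apply: nI; have [I1|nI1] := pselect (I 1).
  by exists [::] => Q /(_ _ I1); rewrite idealr1.
have [[x [y [Ixy nx ny]]]|h] := pselect (exists x y, [/\ I (x * y), ~ I x & ~ I y]).
  have [s1 c1] := big x nx; have [s2 c2] := big y ny; exists (s1 ++ s2) => Q IQ.
  have IQ' z : z \in Q -> forall w, idealD I z w -> w \in Q.
    by move=> zQ _ [a [w [Iw ->]]]; rewrite (rpredD (IQ _ Iw) (idealMr _ zQ)).
  have := IQ _ Ixy; rewrite prime_idealrM => /orP[xQ|yQ].
    by have [P Ps PQ] := c1 Q (IQ' x xQ); exists P; rewrite ?mem_cat ?Ps.
  by have [P Ps PQ] := c2 Q (IQ' y yQ); exists P; rewrite ?mem_cat ?Ps ?orbT.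
have [x y Ixy|Q QI] := Spec_of_set iI nI1.
  apply: contrapT => /not_orP[nx ny]; apply: h; by exists x, y.
exists [:: Q] => Q' IQ'; exists Q; rewrite ?inE //.
by move=> x /QI/IQ'.
Qed.

(** The sum is constant along specialization, so its level set is the complement of finitely many
    closed sets: the closures of the primes of the finite list with another value. *)
Lemma dim_alpha_open n :
  open [set Q : Spec R | (krull_dim (localization Q) + alph Q)%N = n].
Proof.
pose d Q := (krull_dim (localization Q) + alph Q)%N.
have [s hs] := finite_primes.
pose s' := [seq P <- s | d P != n].
have -> : [set Q | d Q = n] = [set Q : Spec R | forall P, P \in s' -> ~ {subset P <= Q}].
  rewrite eqEsubset; split=> Q /=.
    move=> dQ P; rewrite mem_filter => /andP[/eqP nP _] PQ; apply: nP.
    by rewrite -dQ; exact: dim_alpha_specialize.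
  move=> h; apply: contrapT => nQ; have [P Ps PQ] := hs Q.
  apply: (h P) => //; rewrite mem_filter Ps andbT; apply/eqP => dP; apply: nQ.
  by rewrite -dP; exact/esym/dim_alpha_specialize.
elim: s' => [|P t IH].
  rewrite (_ : [set _ | _] = setT); first exact: openT.
  by rewrite eqEsubset; split.
rewrite (_ : [set _ | _] = ~` zariski_closed [set x | x \in P] `&`
    [set Q : Spec R | forall P, P \in t -> ~ {subset P <= Q}]).
  by apply: openI => //; exists [set x | x \in P].
rewrite eqEsubset; split=> Q /=.
  move=> h; split; first by apply: h; rewrite inE eqxx.
  by move=> P1 P1t; apply: h; rewrite inE P1t orbT.
by move=> [h1 h2] P1; rewrite inE => /orP[/eqP->|/h2].
Qed.

Lemma dim_alpha_component P Q : connected_component [set: Spec R] P Q ->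
  (krull_dim (localization P) + alph P)%N = (krull_dim (localization Q) + alph Q)%N.
Proof.
pose d Q := (krull_dim (localization Q) + alph Q)%N.
move=> [C [CP _ cC] CQ].
have oP : open [set Q | d Q = d P] := dim_alpha_open (d P).
have cP : closed [set Q | d Q = d P].
  rewrite -[X in closed X]setCK; apply: open_closedC.
  rewrite (_ : ~` _ = \bigcup_(n in [set n | n <> d P]) [set Q | d Q = n]).
    by apply: bigcup_open => n _; exact: dim_alpha_open.
  rewrite eqEsubset; split=> Q' /=; first by move=> h; exists (d Q').
  by move=> [n /= nP ->].
have /cC E : C `&` [set Q | d Q = d P] !=set0 by exists P.
have : (C `&` [set Q | d Q = d P]) Q.
  by rewrite E //; [exists [set Q | d Q = d P]|exists [set Q | d Q = d P]].
by move=> [_ /esym].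
Qed.

End Kunz.

(** * Injective hulls *)

(** Zorn is applied to the sets [X] with [P (A0 U X)]: the empty chain is then harmless, and the
    maximal set contains [A0]. *)
Lemma Zorn_above T (P : set (set T)) (A0 : set T) : P A0 ->
  (forall F : set (set T), F !=set0 -> F `<=` P -> total_on F subset ->
    P (\bigcup_(X in F) X)) ->
  exists A, [/\ P A, A0 `<=` A & forall B, P B -> A `<=` B -> B = A].
Proof.
move=> P0 chP; pose P' := [set X | P (A0 `|` X)].
have [F FP totF|A [PA maxA]] := @Zorn_bigcup T P'.
  have [->|/set0P F0] := eqVneq F set0; first by rewrite /P' /mkset bigcup_set0 setU0.
  rewrite /P' /mkset.
  have -> : A0 `|` \bigcup_(X in F) X = \bigcup_(Y in [set A0 `|` X | X in F]) Y.
    rewrite bigcup_image eqEsubset; split=> x.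
      by case: F0 => X FX; case=> [xA|[Y FY Yx]]; [exists X => //; left|exists Y => //; right].
    by move=> [X FX [xA|Xx]]; [left|right; exists X].
  apply: chP.
  - by case: F0 => X FX; exists (A0 `|` X), X.
  - by move=> _ [X FX <-]; exact: FP.
  - by move=> _ _ [X FX <-] [Y FY <-]; have [h|h] := totF X Y FX FY;
      [left|right]; exact: setUS.
exists (A0 `|` A); split; [exact: PA|by move=> x; left|].
move=> B PB AB; apply: contrapT => nBA; apply: (maxA B).
  split; first by move=> x xA; apply: AB; right.
  move=> BA; apply: nBA; rewrite eqEsubset; split=> //.
  by move=> x /BA xA; right.
rewrite /P' /mkset (setUidr _) //.
by move=> x xA; apply: AB; left.
Qed.

Lemma submodule_type (R : pzRingType) (V : lmodType R) (N : set V) : submodule N ->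
  exists (W : lmodType R) (i : {linear W -> V}), injective i /\ forall x, N x <-> exists w, i w = x.
Proof.
move=> [N0 NL]; pose S : pred V := fun x => `[< N x >].
have cS : subsemimod_closed S.
  apply: GRing.submod_closed_semi; split; first exact/asboolP.
  by move=> a u v /asboolP Nu /asboolP Nv; apply/asboolP; exact: NL.
pose W0 : subChoiceType S := {x : V | S x}%type.
pose W : subLmodType S := HB.pack W0 (GRing.SubChoice_isSubLmodule.Build R V S W0 cS).
exists W, (val : {linear W -> V}); split; first exact: val_inj.
move=> x; split=> [Nx|[w <-]]; last exact/asboolP/(valP w).
have Sx : S x by exact/asboolP.
by exists (Sub x Sx : W); apply: SubK.
Qed.

Definition linear_of (R : pzRingType) (V W : lmodType R) (f : V -> W) (lf : linear f)
  : {linear V -> W} := HB.pack f (GRing.isLinear.Build R V W *:%R f lf).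

(** [h] is a total function, linear only on [N], so that partial maps can be stated without
    subtypes. *)
Lemma injective_extend (R : pzRingType) (E V : lmodType R) (N : set V) (h : V -> E) :
  injective_module E -> submodule N ->
  (forall a u v, N u -> N v -> h (a *: u + v) = a *: h u + h v) ->
  exists g : {linear V -> E}, forall x, N x -> g x = h x.
Proof.
move=> injE sN hL; have [W [i [inj_i iN]]] := submodule_type sN.
have lf : linear (h \o i).
  have iw w : N (i w) by apply/iN; exists w.
  by move=> a u v; rewrite /= linearP hL.
have [g gE] := injE W V i (linear_of lf) inj_i.
by exists g => x /iN[w <-]; rewrite gE.
Qed.

(** * Injectivity of [Hom(A, F_p)] *)

Section AdditiveExtension.
Variables (N : zmodType) (p : nat) (p_pr : prime p).
Hypothesis pN : forall x : N, x *+ p = 0.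

(** Partial additive maps are graphs: subgroups with trivial fibre over 0, for which Zorn only needs
    unions. A maximal one is total, because a missing [x] could be sent to 0. *)
Lemma additive_extend (G0 : set (N * 'F_p)) : G0 (0, 0) ->
  (forall u v, G0 u -> G0 v -> G0 (u - v)) -> (forall t, G0 (0, t) -> t = 0) ->
  exists h : N -> 'F_p, (forall x y, h (x - y) = h x - h y) /\
    forall x t, G0 (x, t) -> h x = t.
Proof.
move=> G00 G0B G0f.
pose P := [set G : set (N * 'F_p) | [/\ G (0, 0), (forall u v, G u -> G v -> G (u - v)) &
  forall t, G (0, t) -> t = 0]].
have [||G [[G_0 GB Gf] G0G maxG]] := @Zorn_above _ P G0.
- by split.
- move=> F [X FX] FP totF; split.
  + by exists X => //; have [] := FP _ FX.
  + move=> u v [Y FY Yu] [Z FZ Zv]; have [h|h] := totF Y Z FY FZ.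
      by exists Z => //; have [_ ZB _] := FP _ FZ; apply: ZB => //; exact: h.
    by exists Y => //; have [_ YB _] := FP _ FY; apply: YB => //; exact: h.
  + by move=> t [Y FY]; have [_ _] := FP _ FY; apply.
have GN u : G u -> G (- u) by move=> Gu; rewrite -sub0r; exact: GB.
have GD u v : G u -> G v -> G (u + v).
  by move=> Gu Gv; rewrite -[v]opprK; apply: GB => //; exact: GN.
have GM u k : G u -> G (u *+ k).
  by move=> Gu; elim: k => [|k IH]; rewrite ?mulr0n // mulrS; exact: GD.
have pairMn (x : N) (t : 'F_p) k : (x, t) *+ k = (x *+ k, t *+ k).
  by elim: k => // k IH; rewrite !mulrS IH.
have dom x : exists t, G (x, t).
  apply: contrapT => nx.
  pose G' := [set u | exists k v, G v /\ u = v + (x, 0) *+ k].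
  have G'E : G' = G.
    apply: maxG; last by move=> u Gu; exists 0%N, u; rewrite mulr0n addr0.
    split.
    - by exists 0%N, (0, 0); rewrite mulr0n addr0.
    - move=> _ _ [k [u [Gu ->]]] [l [v [Gv ->]]].
      (* [p] kills [x], so adding it [l * p.-1] times amounts to subtracting it [l] times. *)
      exists (k + l * p.-1)%N, (u - v); split; first exact: GB.
      have xp : (x, 0 : 'F_p) *+ p = 0 by rewrite pairMn pN mul0rn.
      have E : (x, 0 : 'F_p) *+ (l * p.-1) = - (x, 0 : 'F_p) *+ l.
        rewrite [(l * _)%N]mulnC mulrnA; congr (_ *+ _); apply/eqP.
        by rewrite -addr_eq0 -mulrSr prednK ?prime_gt0 ?xp.
      by rewrite mulrnDr E mulNrn opprD addrACA.
    - move=> t [k [[y s] [Gv]]]; rewrite pairMn mul0rn => -[y0].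
      rewrite addr0 => ->.
      have [pk|pk] := boolP (p %| k)%N.
        apply: Gf; move: y0; case/dvdnP: pk => j ->.
        by rewrite mulnC mulrnA pN mul0rn addr0 => ->.
      (* If [p] does not divide [k], a Bezout relation recovers [x] from [k x = - y], so [x] was
         already in the domain. *)
      have cpk : coprime k p by rewrite coprime_sym prime_coprime.
      have k_gt0 : (0 < k)%N by case: (k) pk => //; rewrite dvdn0.
      case: (egcdnP p k_gt0) => km kn e _; case: nx.
      rewrite (eqP cpk) in e.
      exists (- s *+ km); have := GM _ km (GN _ Gv); rewrite pairMn /=.
      suff -> : - y *+ km = x by [].
      have -> : - y = x *+ k by apply/eqP; rewrite eq_sym -subr_eq0 opprK addrC -y0.
      by rewrite -mulrnA mulnC e mulrnDr mulnC mulrnA pN mul0rn add0r mulr1n.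
  apply: nx; exists 0; rewrite -G'E; exists 1%N, (0, 0).
  by rewrite mulr1n add0r.
have [h hG] := choice dom.
have huniq x t : G (x, t) -> h x = t.
  move=> Gt; apply/eqP; rewrite -subr_eq0; apply/eqP; apply: Gf.
  by rewrite -[X in G (X, _)](subrr x); exact: GB (hG x) Gt.
exists h; split=> [x y|x t /G0G]; last exact: huniq.
by apply: huniq; exact: GB (hG x) (hG y).
Qed.

End AdditiveExtension.

Section Coinduced.
Variables (p : nat) (A : comNzRingType).

Definition additive_fun : pred (A -> 'F_p) :=
  fun f => `[< forall x y, f (x - y) = f x - f y >].

(** For [A] of characteristic [p] these are the [F_p]-linear maps from [A] to [F_p]; with [A] acting
    on the argument they form the module coinduced from the prime field. *)
Record coind := Coind { coind_fun :> A -> 'F_p; _ : additive_fun coind_fun }.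

HB.instance Definition _ := [isSub for coind_fun].
HB.instance Definition _ := [Choice of coind by <:].

Lemma additive_fun_closed : zmod_closed additive_fun.
Proof.
split; first by apply/asboolP => x y; rewrite /= subr0.
move=> f g /asboolP fB /asboolP gB; apply/asboolP => x y.
rewrite -[LHS]/(f (x - y) - g (x - y)) fB gB.
by rewrite -[RHS]/(f x - g x - (f y - g y)) !opprD !opprK addrACA.
Qed.

HB.instance Definition _ :=
  GRing.SubChoice_isSubZmodule.Build (A -> 'F_p) additive_fun coind additive_fun_closed.

Lemma coindB (f : coind) x y : f (x - y) = f x - f y.
Proof. by case: f => f /= /asboolP. Qed.

Lemma coindD (f : coind) x y : f (x + y) = f x + f y.
Proof.
have f0 : f 0 = 0 by rewrite -[X in f X](subrr 0) coindB subrr.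
by rewrite -{1}[y]opprK coindB -[- y]sub0r coindB f0 sub0r opprK.
Qed.

Lemma coind_scale_subproof a (f : coind) : additive_fun (fun x => f (a * x)).
Proof. by apply/asboolP => x y; rewrite mulrBr coindB. Qed.

Definition coind_scale a f := Coind (coind_scale_subproof a f).

Lemma coindP (f g : coind) : (forall x, f x = g x) -> f = g.
Proof. by move=> fg; apply: val_inj; apply/funext. Qed.

Lemma coind_addE (f g : coind) x : (f + g) x = f x + g x.
Proof. by rewrite -[coind_fun (f + g)]/(val (f + g)) raddfD. Qed.

Lemma coind_subE (f g : coind) x : (f - g) x = f x - g x.
Proof. by rewrite -[coind_fun (f - g)]/(val (f - g)) raddfB. Qed.

Lemma coind_scaleA a b f : coind_scale a (coind_scale b f) = coind_scale (a * b) f.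
Proof. by apply: coindP => x; rewrite /= mulrCA mulrA. Qed.

Lemma coind_scale1 : left_id 1 coind_scale.
Proof. by move=> f; apply: coindP => x; rewrite /= mul1r. Qed.

Lemma coind_scaleDr : right_distributive coind_scale +%R.
Proof. by move=> a f g; apply: coindP => x; rewrite [RHS]coind_addE; exact: coind_addE. Qed.

Lemma coind_scaleDl f : {morph coind_scale^~ f : a b / a + b}.
Proof. by move=> a b; apply: coindP => x; rewrite coind_addE /= mulrDl coindD. Qed.

HB.instance Definition _ := GRing.Zmodule_isLmodule.Build A coind
  coind_scaleA coind_scale1 coind_scaleDr coind_scaleDl.

Lemma coind_scaleE a (f : coind) x : (a *: f) x = f (a * x).
Proof. by []. Qed.

(** A linear map [f] into [coind] amounts to the additive map [m |-> f m 1], from which [f m a] is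
    recovered at [a m]. So it suffices to extend additive maps into [F_p]. *)
Lemma coind_injective : p \in [pchar A] -> injective_module coind.
Proof.
move=> chAp M N i f inj_i.
have p_pr := pcharf_prime chAp.
have pN (V : lmodType A) (x : V) : x *+ p = 0.
  by rewrite -scaler_nat (pcharf0 chAp) scale0r.
pose G0 := [set u : N * 'F_p | exists m, u = (i m, f m 1)].
have fE m k x : f (m - k) x = f m x - f k x.
  by rewrite linearB coind_subE.
have [||t [m [/esym im ->]]|h [hB hG]] := @additive_extend N p p_pr (pN N) G0.
- by exists 0; rewrite !linear0.
- move=> _ _ [m ->] [k ->]; exists (m - k); rewrite linearB fE; reflexivity.
- have -> : m = 0 by apply: inj_i; rewrite im linear0.
  by rewrite linear0.
have h0 : h 0 = 0 by rewrite -[X in h X](subrr 0) hB subrr.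
have hD x y : h (x + y) = h x + h y.
  by rewrite -{1}[y]opprK hB -[- y]sub0r hB h0 sub0r opprK.
have gP n : additive_fun (fun a => h (a *: n)).
  by apply/asboolP => x y; rewrite scalerBl hB.
pose g n := Coind (gP n).
have lg : linear g.
  move=> a u v; apply: coindP => x; rewrite coind_addE coind_scaleE /=.
  by rewrite scalerDr hD scalerA mulrC.
exists (linear_of lg) => m; apply: coindP => a /=.
rewrite -linearZ; have -> : h (i (a *: m)) = f (a *: m) 1 by apply: hG; exists (a *: m).
by rewrite linearZ coind_scaleE mulr1.
Qed.

End Coinduced.

Lemma linear_lift (R : pzRingType) (M V W : lmodType R) (i : {linear W -> V}) (F : {linear M -> V}) :
  injective i -> (forall x, exists w, i w = F x) ->
  exists G : {linear M -> W}, forall x, i (G x) = F x.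
Proof.
move=> inj_i /choice[G GE].
have lG : linear G by move=> a u v; apply: inj_i; rewrite !linearP !GE linearP.
by exists (linear_of lG).
Qed.

Section InjectiveHull.
Variables (A : localRing) (p : nat) (chAp : p \in [pchar A]).
Local Notation Q := (residue_field A).
Local Notation D := (coind p A).

(** Extend [1 |-> 1] to an additive [l] from the residue field to [F_p] and send [x] to
    [a |-> l (a x)]. For [x] nonzero some [a] has [a x = 1], where the value is 1. *)
Lemma residue_embedding : exists psi : {linear Q -> D}, injective psi.
Proof.
have p_pr := pcharf_prime chAp.
have pchQ : p \in [pchar Q] by exact: (rmorph_pchar (\pi_Q : {rmorphism A -> Q})).
have pN (x : Q) : x *+ p = 0 by rewrite -mulr_natr (pcharf0 pchQ) mulr0.
pose G0 := [set u : Q * 'F_p | exists n : nat, u = (n%:R, n%:R)].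
have [||t [n [/esym n0 ->]]|l [lB lG]] := @additive_extend Q p p_pr pN G0.
- by exists 0%N.
- move=> _ _ [n ->] [k ->]; exists (n + k * p.-1)%N.
  have H (S : pzRingType) : p%:R = 0 :> S -> (n + k * p.-1)%:R = n%:R - k%:R :> S.
    move=> pS; rewrite natrD natrM; congr (_ + _); apply/eqP.
    rewrite -addr_eq0 -[X in _ + X]mulr1 -mulrDr -[1]/(1%:R) -natrD addn1.
    by rewrite prednK ?prime_gt0 // pS mulr0.
  by rewrite (H Q (pcharf0 pchQ)) (H 'F_p (pcharf0 (pchar_Fp p_pr))).
- move: n0 => /eqP; rewrite -(dvdn_pcharf pchQ) => pn.
  by apply/eqP; rewrite -(dvdn_pcharf (pchar_Fp p_pr)).
have l0 : l 0 = 0 by rewrite -[X in l X](subrr 0) lB subrr.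
have lD x y : l (x + y) = l x + l y.
  by rewrite -{1}[y]opprK lB -[- y]sub0r lB l0 sub0r opprK.
have gP (x : Q) : additive_fun (fun a : A => l (a *: x)).
  by apply/asboolP => a b; rewrite scalerBl lB.
pose psi x : D := Coind (gP x).
have lpsi : linear psi.
  move=> a u v; apply: coindP => x; rewrite coind_addE coind_scaleE /=.
  by rewrite scalerDr lD scalerA mulrC.
exists (linear_of lpsi) => x y xy; apply/eqP; rewrite -subr_eq0; apply/negPn/negP => z0.
have [u uz] : exists u, u * repr (x - y) = 1.
  by apply: local_unit; rewrite -residue_pi_eq0 reprK.
have : psi (x - y) u = 0.
  have -> : psi (x - y) = psi x - psi y by exact: (linearB (linear_of lpsi)).
  by rewrite coind_subE [psi x]xy subrr.
have -> : psi (x - y) u = l 1.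
  rewrite /=; congr l; rewrite -[x - y]reprK -[LHS]/(\pi_Q u * \pi_Q _) -rmorphM uz.
  exact: rmorph1.
rewrite (lG 1 1); last by exists 1%N.
by move/eqP; rewrite oner_eq0.
Qed.

(* [E] is a maximal essential extension of [k] in [D] and [C] is maximal among
   the submodules meeting [E] in [0].  The projection [E + C -> E] extends to
   [h : D -> D], whose image is again essential over [k]; hence the image is [E],
   and [E] is a retract of the injective module [D]. *)
Lemma injective_hull_exists :
  exists (E : lmodType A) (psi : {linear Q -> E}), injective_hull psi.
Proof.
have [psi0 inj0] := residue_embedding.
pose W : set D := range psi0.
have sW : submodule W.
  split; first by exists 0 => //; rewrite linear0.
  by move=> a _ _ [x _ <-] [y _ <-]; exists (a *: x + y) => //; rewrite linearP.
(* Essential extensions of [W] in elementwise form: each nonzero element has a nonzero multiple in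
   [W]. *)
pose P1 := [set N : set D | submodule N /\ forall x, N x -> x <> 0 ->
  exists2 a : A, W (a *: x) & a *: x <> 0].
have chain_submod (F : set (set D)) : F !=set0 -> (forall N, F N -> submodule N) ->
    total_on F subset -> submodule (\bigcup_(N in F) N).
  move=> [X FX] sF totF; split; first by exists X => //; case: (sF _ FX).
  move=> a u v [Y FY Yu] [Z FZ Zv]; have [h|h] := totF Y Z FY FZ.
    by exists Z => //; have [_ ZL] := sF _ FZ; apply: ZL => //; exact: h.
  by exists Y => //; have [_ YL] := sF _ FY; apply: YL => //; exact: h.
have [||E [[sE essE] WE maxE]] := @Zorn_above _ P1 W.
- split=> // x Wx x0; exists 1; rewrite scale1r //.
- move=> F F0 FP totF; split.
    by apply: chain_submod => // N /FP[].
  by move=> x [N FN Nx]; have [_] := FP _ FN; apply.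
pose P2 := [set C : set D | submodule C /\ forall x, C x -> E x -> x = 0].
have [||C [[sC CE] _ maxC]] := @Zorn_above _ P2 [set 0].
- by split=> //; split=> // a u v -> ->; rewrite scaler0 addr0.
- move=> F F0 FP totF; split.
    by apply: chain_submod => // N /FP[].
  by move=> x [N FN Nx]; have [_] := FP _ FN; apply.
have [E0 EL] := sE; have [C0 CL] := sC.
pose N := [set x : D | exists e, E e /\ C (x - e)].
have sN : submodule N.
  split; first by exists 0; rewrite subr0.
  move=> a u v [e [Ee Ce]] [e' [Ee' Ce']]; exists (a *: e + e'); split; first exact: EL.
  by rewrite opprD addrACA -scalerBr; exact: CL.
have : forall x, exists e, N x -> E e /\ C (x - e).
  by move=> x; have [[e h]|] := pselect (N x); [exists e|exists 0].
move=> /choice[h0 h0P].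
have h0U x e : E e -> C (x - e) -> h0 x = e.
  move=> Ee Ce; have [|Eh Ch] := h0P x; first by exists e.
  apply/eqP; rewrite -subr_eq0; apply/eqP; apply: CE.
    have -> : h0 x - e = (-1) *: (x - h0 x) + (x - e).
      by rewrite scaleN1r opprB addrA subrK.
    exact: CL.
  by rewrite addrC -scaleN1r; exact: EL.
have [|h hE] := @injective_extend A D D N h0 (coind_injective chAp) sN.
  move=> a u v Nu Nv; have [Eu Cu] := h0P _ Nu; have [Ev Cv] := h0P _ Nv.
  apply: h0U; first exact: EL.
  by rewrite opprD addrACA -scalerBr; exact: CL.
have hid e : E e -> h e = e.
  move=> Ee; rewrite hE; last by exists e; rewrite subrr.
  by apply: h0U => //; rewrite subrr.
have h_0 c : C c -> h c = 0.
  move=> Cc; rewrite hE; last by exists 0; rewrite subr0.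
  by apply: h0U => //; rewrite subr0.
have hrE x : E (h x).
  suff <- : range h = E by exists x.
  apply: maxE; last by move=> e Ee; exists e => //; exact: hid.
  split.
    split; first by exists 0 => //; rewrite linear0.
    by move=> a _ _ [u _ <-] [v _ <-]; exists (a *: u + v) => //; rewrite linearP.
  move=> _ [{}x _ <-] hx0.
  (* As [h x] is nonzero, [x] is not in [C]; by maximality of [C], [C + A x] meets [E] in some
     nonzero [z], which [h] fixes, so [z] is a multiple of [h x]. *)
  pose C' := [set z : D | exists a c, C c /\ z = c + a *: x].
  have [z [[a [c [Cc zE]]] Ez z0]] : exists z, [/\ C' z, E z & z <> 0].
    apply: contrapT => nz; apply: hx0; apply: h_0.
    rewrite -(maxC C'); first by exists 1, 0; rewrite scale1r add0r.
      split; last first.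
        by move=> y Cy Ey; apply: contrapT => y0; apply: nz; exists y.
      split; first by exists 0, 0; rewrite scale0r addr0.
      move=> a _ _ [b [c [Cc ->]]] [b' [c' [Cc' ->]]].
      exists (a * b + b'), (a *: c + c'); split; first exact: CL.
      by rewrite scalerDr scalerA scalerDl addrACA.
    by move=> c Cc; exists 0, c; rewrite scale0r addr0.
  have zhx : z = a *: h x.
    by rewrite -(hid _ Ez) zE linearD linearZ (h_0 _ Cc) add0r.
  have [b Wb b0] := essE z Ez z0.
  by exists (b * a); rewrite -scalerA -zhx.
have [Et [i [inj_i iE]]] := submodule_type sE.
have [|psi psiE] := @linear_lift _ _ _ _ i psi0 inj_i.
  by move=> x; apply/iE; apply: WE; exists x.
exists Et, psi; split.
- move=> M M' j f inj_j.
  have [g gE] := @coind_injective p A chAp M M' j (i \o f : {linear M -> D}) inj_j.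
  have [|r rE] := @linear_lift _ _ _ _ i (h \o g : {linear M' -> D}) inj_i.
    by move=> x; exact/iE/hrE.
  exists r => m; apply: inj_i; rewrite rE /= gE /=; apply: hid; apply/iE.
  by exists (f m).
- by move=> x y xy; apply: inj0; rewrite -!psiE xy.
move=> L [L0 LL] LW; rewrite eqEsubset; split=> [x Lx|_ -> //].
apply: contrapT => x0.
have ix0 : i x <> 0 by move=> ix; apply: x0; apply: inj_i; rewrite ix linear0.
have [|a [q _ qa] a0] := essE (i x) _ ix0; first by apply/iE; exists x.
have ax : a *: x = psi q by apply: inj_i; rewrite linearZ psiE.
have : (L `&` range psi) (a *: x).
  split; last by exists q.
  by rewrite -[a *: x]addr0; exact: LL.
by rewrite LW => ax0; apply: a0; rewrite -linearZ ax0 linear0.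
Qed.

End InjectiveHull.

(** * The modules [K_e] *)

(** Induction on [n]: lift generators of the ideal of last coordinates, and add generators of the
    part where that coordinate vanishes. Vectors of [R^n] are functions of which only the first [n]
    values count. *)
Lemma noetherian_fun (R : comNzRingType) n (N : set (nat -> R)) : noetherian R ->
  N (fun=> 0) -> (forall x y, N x -> N y -> N (fun i => x i + y i)) ->
  (forall a x, N x -> N (fun i => a * x i)) ->
  exists m (v : nat -> nat -> R), (forall j, N (v j)) /\
    forall x, N x -> exists c : nat -> R, forall i, (i < n)%N ->
      x i = \sum_(j < m) c j * v j i.
Proof.
move=> nR; elim: n N => [|n IH] N N0 ND NM; first by exists 0%N, (fun _ _ => 0); split=> // x _; exists (fun=> 0).
have [|k [y [yI gen]]] := @noetherian_gen R [set y | exists2 x, N x & x n = y] nR.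
  split; first by exists (fun=> 0).
    by move=> _ _ [x Nx <-] [x' Nx' <-]; exists (fun i => x i + x' i) => //; exact: (ND _ _ Nx Nx').
  by move=> a _ [x Nx <-]; exists (fun i => a * x i) => //; exact: (NM _ _ Nx).
have /choice[w hw] : forall j, exists x, N x /\ x n = y j.
  by move=> j; have [x Nx <-] := yI j; exists x.
have [|||m [v [vN vgen]]] := IH [set x | N x /\ x n = 0].
- by split.
- by move=> x x' [Nx xn] [Nx' xn']; split; [exact: ND|rewrite xn xn' addr0].
- by move=> a x [Nx xn]; split; [exact: NM|rewrite xn mulr0].
exists (k + m)%N, (fun j => if (j < k)%N then w j else v (j - k)%N); split.
  by move=> j; case: ifP => _; [have [] := hw j|have [] := vN (j - k)%N].
move=> x Nx; have [|c xn] := gen (x n); first by exists x.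
pose x' i := x i + -1 * \sum_(j < k) c j * w j i.
have Nx' : N x'.
  apply: (ND) => //; apply: (NM); elim: (k) => [|l IHl].
    by under [fun i => _]funext => i do rewrite big_ord0.
  under [fun i => _]funext => i do rewrite big_ord_recr /=.
  by apply: (ND) => //; apply: (NM); have [] := hw l.
have x'n : x' n = 0.
  rewrite /x' xn mulN1r; apply/eqP; rewrite subr_eq0; apply/eqP.
  by apply: eq_bigr => j _; have [_ ->] := hw j.
have [|d hd] := vgen x'; first by split.
exists (fun j => if (j < k)%N then c j else d (j - k)%N) => i i_n.
rewrite big_split_ord /=.
under eq_bigr => j _ do rewrite ltn_ord.
under [X in _ + X]eq_bigr => j _ do rewrite ltnNge leq_addr addKn.
have -> : \sum_(j < m) d j * v j i = x' i.
  move: i_n; rewrite ltnS leq_eqVlt => /orP[/eqP->|]; last by move=> /hd.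
  by rewrite x'n big1 // => j _; have [_ ->] := vN j; rewrite mulr0.
by rewrite /x' mulN1r addrC subrK.
Qed.

Section FrobeniusLinear.
Variables (R : comNzRingType) (p : nat) (chRp : p \in [pchar R]) (e : nat).

(* The elements of [Hom_R(R^(e), R)]. *)
Definition flin (phi : R -> R) := (forall x y, phi (x + y) = phi x + phi y) /\
  forall a x, phi (a ^+ (p ^ e) * x) = a * phi x.

Lemma flin0 phi : flin phi -> phi 0 = 0.
Proof. by move=> [_ /(_ 0 0)]; rewrite mulr0 mul0r. Qed.

Lemma flinN phi x : flin phi -> phi (- x) = - phi x.
Proof.
move=> lphi; apply/eqP; rewrite -addr_eq0; case: (lphi) => <- _.
by rewrite addNr flin0.
Qed.

Lemma flin_sum phi n (c g : nat -> R) : flin phi ->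
  phi (\sum_(i < n) c i ^+ (p ^ e) * g i) = \sum_(i < n) c i * phi (g i).
Proof.
move=> lphi; rewrite (big_morph phi lphi.1 (flin0 lphi)).
by apply: eq_bigr => i _; rewrite lphi.2.
Qed.

Lemma flin_mulr phi b : flin phi -> flin (fun x => phi (b * x)).
Proof.
move=> [pD pM]; split=> [x y|a x]; first by rewrite mulrDr pD.
by rewrite mulrCA pM.
Qed.

Lemma flin_scale phi b : flin phi -> flin (fun x => b * phi x).
Proof.
move=> [pD pM]; split=> [x y|a x]; first by rewrite pD mulrDr.
by rewrite pM mulrCA.
Qed.

Lemma flin_of_images n (g d : nat -> R) : frob_gen p e n g ->
  (forall a : nat -> R, \sum_(i < n) a i ^+ (p ^ e) * g i = 0 -> \sum_(i < n) a i * d i = 0) ->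
  exists2 phi, flin phi &
    forall c : nat -> R, phi (\sum_(i < n) c i ^+ (p ^ e) * g i) = \sum_(i < n) c i * d i.
Proof.
move=> /choice[c hc] rel.
have uniq y (b : nat -> R) : y = \sum_(i < n) b i ^+ (p ^ e) * g i ->
    \sum_(i < n) c y i * d i = \sum_(i < n) b i * d i.
  move=> yE; apply/eqP; rewrite -subr_eq0 -sumrB; apply/eqP.
  under eq_bigr => i _ do rewrite -mulrBl.
  apply: (rel (fun i => c y i - b i)).
  under eq_bigr => i _ do rewrite (frob_expB chRp) mulrBl.
  by rewrite sumrB -hc -yE subrr.
exists (fun y => \sum_(i < n) c y i * d i); last by move=> b; exact: uniq.
split=> [x y|a x].
  rewrite (uniq _ (fun i => c x i + c y i)).
    by under eq_bigr => i _ do rewrite mulrDl; rewrite big_split.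
  under eq_bigr => i _ do rewrite (frob_expD chRp) mulrDl.
  by rewrite big_split /= -!hc.
rewrite (uniq _ (fun i => a * c x i)).
  by rewrite mulr_sumr; apply: eq_bigr => i _; rewrite mulrA.
rewrite {1}[x]hc mulr_sumr; apply: eq_bigr => i _.
by rewrite exprMn mulrA.
Qed.

End FrobeniusLinear.

Section SplittingIdeal.
Variables (A : localRing) (p : nat) (chAp : p \in [pchar A]) (e : nat).
Local Notation m := (max_ideal A).
Local Notation F := (frob_alg chAp e).
Local Notation Q := (residue_field A).

Definition split_ideal : set A := [set r | forall phi, flin p e phi -> phi r \in m].

Lemma split_ideal_ideal : is_ideal split_ideal.
Proof.
split=> [phi lphi|x y Ix Iy phi lphi|a x Ix phi lphi].
- by rewrite (flin0 lphi) idealr0.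
- by rewrite lphi.1 (rpredD (Ix _ lphi) (Iy _ lphi)).
- by have := Ix _ (flin_mulr a lphi).
Qed.

Lemma split_ideal_fsub : fsub p e split_ideal.
Proof. by have [h0 hD hM] := split_ideal_ideal; split=> // a x; exact: hM. Qed.

Variables (E : lmodType A).

Definition pure_tensor (r : A) (x : E) : tensor F E := \pi_(tensor F E) [:: (r : F, x)].
Local Notation pt := pure_tensor.

Lemma tensor_addE l1 l2 : \pi_(tensor F E) l1 + \pi_(tensor F E) l2 = \pi_(tensor F E) (l1 ++ l2).
Proof. exact: tens_addE. Qed.

Lemma pure_tensorDl r s x : pt (r + s) x = pt r x + pt s x.
Proof. by rewrite tensor_addE; apply/tensorP; exact: TensDl. Qed.

Lemma pure_tensorDr r x y : pt r (x + y) = pt r x + pt r y.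
Proof. by rewrite tensor_addE; apply/tensorP; exact: TensDr. Qed.

Lemma pure_tensorZ a r x : pt (a ^+ (p ^ e) * r) x = pt r (a *: x).
Proof. by apply/tensorP; exact: TensZ. Qed.

Lemma pure_tensor0 x : pt 0 x = 0.
Proof. by apply/tensorP; exact: Tens0. Qed.

Lemma pure_tensorr0 r : pt r 0 = 0.
Proof. by rewrite -(scale0r (0 : E)) -pure_tensorZ (frob_exp0 chAp) mul0r pure_tensor0. Qed.

Lemma pure_tensor_scale (s : A) r x : (s : F) *: pt r x = pt (s * r) x.
Proof. exact: tens_scaleE. Qed.

Variables (psi : {linear Q -> E}).
Local Notation u := (psi 1).

Lemma socle_annihilated a : a \in m -> a *: u = 0.
Proof.
move=> am; rewrite -linearZ; have -> : a *: (1 : Q) = 0; last exact: linear0.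
by apply/eqP; rewrite -[_ *: _]/(\pi_Q a * 1) mulr1 residue_pi_eq0.
Qed.

Lemma socle_annihilator a : injective psi -> a *: u = 0 -> a \in m.
Proof.
move=> inj_psi; rewrite -linearZ -(linear0 psi) => /inj_psi /eqP.
by rewrite -[_ *: _]/(\pi_Q a * 1) mulr1 residue_pi_eq0.
Qed.

(** [phi] induces the map [b (x) z |-> phi(b) z] on the tensor product; hence [phi(r) u = 0], and
    [u] is annihilated only by [m]. *)
Lemma pure_tensor_split r : injective psi -> pt r u = 0 -> split_ideal r.
Proof.
move=> inj_psi r0 phi lphi; apply: socle_annihilator => //.
have : tens_eq [:: (r : F, u)] [::] by apply/tensorP.
pose s (l : seq (F * E)) : E := \sum_(z <- l) phi z.1 *: z.2.
suff h l1 l2 : tens_eq l1 l2 -> s l1 = s l2.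
  by move=> /h; rewrite /s big_seq1 big_nil.
rewrite /s; elim=> // {l1 l2} [l1 l2 l3 _ -> _ -> //|l1 l2 l1' l2' _ h1 _ h2|l1 l2
  |b c x|b x y|a b x|x].
- by rewrite !big_cat /= h1 h2.
- by rewrite !big_cat /= addrC.
- by rewrite !big_cons !big_nil !addr0 /= lphi.1 scalerDl.
- by rewrite !big_cons !big_nil !addr0 /= scalerDr.
- by rewrite !big_cons !big_nil !addr0 /= lphi.2 scalerA mulrC.
- by rewrite big_cons !big_nil /= (flin0 lphi) scale0r addr0.
Qed.

(* If every map in [Hom(A^(e), A)] sends [r] into the maximal ideal, then [A]
   does not split off along [r]; the resulting obstruction, read through the
   injectivity of [E], is a family of relations killing [r (x) u]. *)
Lemma split_pure_tensor n (g : nat -> A) r : noetherian A -> frob_gen p e n g -> injective_module E ->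
  split_ideal r -> pt r u = 0.
Proof.
move=> nA gen injE Ir; have [b rE] := gen r.
have [|||m' [v [vrel vgen]]] := @noetherian_fun A n
  [set a : nat -> A | \sum_(i < n) a i ^+ (p ^ e) * g i = 0] nA.
- by rewrite /mkset big1 // => i _; rewrite (frob_exp0 chAp) mul0r.
- move=> x y hx hy; rewrite /mkset.
  under eq_bigr => i _ do rewrite (frob_expD chAp) mulrDl.
  by rewrite big_split /= hx hy addr0.
- move=> a x hx; rewrite /mkset.
  under eq_bigr => i _ do rewrite exprMn -mulrA.
  by rewrite -mulr_sumr hx mulr0.
(* A vector [d] orthogonal to the relations defines a map with [g i |-> d i], and this sum is the
   image of [r]. *)
have kill (d : nat -> A) : (forall j, (j < m')%N -> \sum_(i < n) d i * v j i = 0) ->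
    \sum_(i < n) d i * b i \in m.
  move=> hd; have [|phi lphi phiE] := @flin_of_images _ _ chAp e n g d gen.
    move=> a /vgen[c hc].
    rewrite (eq_bigr (fun i : 'I_n => \sum_(j < m') c j * (d i * v j i))); last first.
      move=> i _; rewrite hc // mulr_suml; apply: eq_bigr => j _.
      by rewrite -mulrA [v j i * _]mulrC.
    rewrite exchange_big /= big1 // => j _.
    by rewrite -mulr_sumr hd // mulr0.
  have := Ir _ lphi; rewrite rE phiE.
  by rewrite (eq_bigr (fun i : 'I_n => d i * b i)) // => i _; rewrite mulrC.
pose V : lmodType A := ('rV[A]_m' * A^o)%type.
pose row (d : nat -> A) : 'rV[A]_m' := \row_j \sum_(i < n) d i * v j i.
(* On [N], [h] sends [(row d, t)] to [(t - sum d_i b_i) u]; by [kill] this does not depend on [d],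
   as [m] annihilates [u]. *)
pose N := [set z : V | exists d, z.1 = row d].
have rowL a d d' : a *: row d + row d' = row (fun i => a * d i + d' i).
  apply/rowP => j; rewrite !mxE mulr_sumr -big_split; apply: eq_bigr => i _.
  by rewrite /= mulrDl mulrA.
have /choice[D DP] : forall w, exists d, (exists d', w = row d') -> w = row d.
  by move=> w; have [[d wd]|h] := pselect (exists d', w = row d'); [exists d|exists (fun=> 0)].
pose h (z : V) : E := (z.2 - \sum_(i < n) D z.1 i * b i) *: u.
have hE (z : V) d : z.1 = row d -> h z = (z.2 - \sum_(i < n) d i * b i) *: u.
  move=> zd; apply/eqP; rewrite -subr_eq0 -scalerBl; apply/eqP.
  apply: socle_annihilated; rewrite opprB addrC addrA subrK -sumrB.
  under eq_bigr => i _ do rewrite -mulrBl.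
  apply: (kill (fun i => d i - D z.1 i)) => j jm.
  have : row (D z.1) = row d by rewrite -(DP z.1) //; exists d.
  move=> /rowP/(_ (Ordinal jm)); rewrite !mxE => Ej.
  by under eq_bigr => i _ do rewrite mulrBl; rewrite sumrB Ej subrr.
have sN : submodule N.
  split.
    exists (fun=> 0); apply/rowP => j; rewrite !mxE big1 // => i _.
    by rewrite mul0r.
  by move=> a z z' [d zd] [d' zd']; exists (fun i => a * d i + d' i); rewrite -rowL -zd -zd'.
have [|H HE] := injective_extend injE sN (h := h).
  move=> a z z' [d zd] [d' zd'].
  rewrite (hE _ _ zd) (hE _ _ zd') (hE _ (fun i => a * d i + d' i)); last first.
    by rewrite -rowL -zd -zd'.
  rewrite scalerA -scalerDl; congr (_ *: _).
  rewrite -[(_ + _).2]/(a * z.2 + z'.2) mulrBr.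
  under eq_bigr => i _ do rewrite mulrDl -mulrA.
  by rewrite big_split /= -mulr_sumr opprD addrACA.
(* Evaluated on basis vectors, the extension [H] yields elements of [E] that express each [b i *: u]
   through the relations. *)
pose x j : E := H (delta_mx 0 j, 0).
have bu i : (i < n)%N -> b i *: u = - \sum_(j < m') v j i *: x j.
  move=> i_n.
  have : H (row (fun k => (k == i)%:R), 0) = - (b i *: u).
    rewrite HE; last by exists (fun k => (k == i)%:R).
    rewrite (hE _ (fun k => (k == i)%:R)) //= sub0r scaleNr; congr (- (_ *: _)).
    rewrite (bigD1 (Ordinal i_n)) //= eqxx mul1r big1 ?addr0 // => k /eqP ki.
    by case: eqP => [k_i|_]; [case: ki; exact: val_inj|rewrite mul0r].
  move=> Hi; rewrite -[LHS]opprK -Hi; congr (- _).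
  have -> : (row (fun k => (k == i)%:R), 0) = \sum_(j < m') v j i *: (delta_mx 0 j, 0) :> V.
    have sumE (G : 'I_m' -> V) : \sum_j G j = (\sum_j (G j).1, \sum_j (G j).2).
      elim/big_ind3: _ => // [a1 a2 a3 b1 b2 b3 -> ->|j _]; first by [].
      by case: (G j).
    rewrite sumE /=; congr (_, _); last by rewrite big1 // => j _; rewrite scaler0.
    rewrite [LHS]row_sum_delta; apply: eq_bigr => j _; rewrite mxE.
    rewrite (bigD1 (Ordinal i_n)) //= eqxx mul1r big1 ?addr0 // => k /eqP ki.
    by case: eqP => [k_i|_]; [case: ki; exact: val_inj|rewrite mul0r].
  by rewrite linear_sum; apply: eq_bigr => j _; rewrite linearZ.
have ptl k (G : 'I_k -> A) y : pt (\sum_i G i) y = \sum_i pt (G i) y.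
  exact: (big_morph (pt^~ y) (fun a c => pure_tensorDl a c y) (pure_tensor0 y)).
have ptr k a (G : 'I_k -> E) : pt a (\sum_i G i) = \sum_i pt a (G i).
  exact: (big_morph (pt a) (pure_tensorDr a) (pure_tensorr0 a)).
(* Moving the coefficients [v j i] across the tensor sign collects, for each [j], the relation
   [v j], which is 0 in [A^(e)]. *)
rewrite rE ptl (eq_bigr (fun i : 'I_n => \sum_(j < m') pt (v j i ^+ (p ^ e) * g i) (- x j))); last first.
  move=> i _; rewrite pure_tensorZ bu // -sumrN ptr; apply: eq_bigr => j _.
  by rewrite pure_tensorZ scalerN.
rewrite exchange_big /= big1 // => j _; rewrite -ptl.
by have := vrel j; rewrite /mkset => ->; exact: pure_tensor0.
Qed.

Lemma K_E : @K_ p A chAp e E psi = [set pt r u | r in setT].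
Proof.
rewrite eqEsubset; split=> [_ [x _ <-]|_ [r _ <-]]; last first.
  exists (\pi_(tensor F Q) [:: (r : F, 1)]) => //.
  by rewrite tens_mapE.
elim/tensW: x => l; rewrite tens_mapE.
elim: l => [|[a k] l [r _ IH]] /=; first by exists 0 => //; exact: pure_tensor0.
have kE : psi k = repr k *: u.
  rewrite -linearZ; congr (psi _).
  by rewrite -[RHS]/(\pi_Q (repr k) * 1) mulr1 reprK.
exists (repr k ^+ (p ^ e) * a + r) => //.
by rewrite pure_tensorDl IH pure_tensorZ -kE tensor_addE.
Qed.

(** The map [r |-> r (x) u] identifies [A / split_ideal] with [K_e], so chains of submodules
    correspond to chains of ideals above [split_ideal]. *)
Lemma length_K_ n : (forall r, pt r u = 0 <-> split_ideal r) ->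
  comp_series p 0 split_ideal setT n -> length (@K_ p A chAp e E psi) = n.
Proof.
move=> ptP cs; rewrite /length K_E.
set FF := [set L | _].
have sI : fsub p 0 split_ideal by apply/fsub0P; exact: split_ideal_ideal.
have ptB r s : pt r u = pt s u -> split_ideal (r - s).
  move=> rs; apply/ptP; apply: (addIr (pt s u)).
  by rewrite -pure_tensorDl subrK rs add0r.
have ub k : has_chain FF k -> (k <= n)%N.
  move=> [c [Fc sc]].
  apply: (comp_series_max chAp sI cs (c := fun i => [set r | c i (pt r u)])) => i ik.
    have [[c0 cL] _] := Fc i ik; split=> //; last first.
      by move=> r /ptP; rewrite /mkset => ->.
    apply/fsub0P; split; first by rewrite /mkset pure_tensor0.
      move=> r s cr cs'; rewrite /mkset pure_tensorDl -[pt r u]scale1r.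
      exact: cL.
    move=> a r cr; rewrite /mkset -pure_tensor_scale -[_ *: _]addr0.
    exact: cL.
  have [le nle] := sc i ik; split=> [r|h]; first exact: le.
  apply: nle => y cy; have [_ /(_ _ cy)[r _ yE]] := Fc i.+1 ik.
  by rewrite -yE; apply: h; rewrite /mkset yE.
have chn : has_chain FF n.
  have [c [hc sc]] := comp_series_chain chAp sI cs.
  exists (fun i => [set pt r u | r in c i]); split=> i i_n.
    have [/fsub0P[c0 cD cM] _ _] := hc i i_n; split; last first.
      by move=> _ [r _ <-]; exists r.
    split; first by exists 0 => //; exact: pure_tensor0.
    move=> a _ _ [r cr <-] [s cs' <-]; exists ((a : A) * r + s).
      by apply: cD => //; exact: cM.
    by rewrite pure_tensorDl -pure_tensor_scale.
  have [le nle] := sc i i_n; split=> [_ [r cr <-]|h]; first by exists r => //; exact: le.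
  apply: nle => r cr; have [|s cs' /esym/ptB rs] := h (pt r u); first by exists r.
  have [/fsub0P[c0 cD cM] Ic _] := hc i (ltnW i_n).
  by rewrite -(subrK s r); apply: cD => //; exact: Ic.
rewrite /max_chain; case: xgetP => [k _ [ck hk]|/(_ n)[]]; last by split.
by apply/eqP; rewrite eqn_leq ub //= hk.
Qed.

End SplittingIdeal.

(** * Free summands of [R^(e)] *)

(* A family of [k] maps [R^(e) -> R] that is triangular with respect to [k]
   elements and has diagonal entries outside [P]: it exhibits a free summand of
   rank [k] of [R^(e)] at [P]. *)
Definition split_family (R : comNzRingType) (p e : nat) (P : Spec R) (k : nat)
    (phi : nat -> R -> R) (r : nat -> R) : Prop :=
  [/\ forall i, flin p e (phi i),
      forall i j, (i < j < k)%N -> phi i (r j) = 0 &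
      forall i, (i < k)%N -> phi i (r i) \notin P].

Definition splits (R : comNzRingType) (p e : nat) (P : Spec R) (k : nat) : Prop :=
  exists phi r, split_family p e P k phi r.

Section LocalRank.
Variables (A : localRing) (p : nat) (chAp : p \in [pchar A]) (e : nat).
Local Notation m := (max_ideal A).
Local Notation I := (@split_ideal A p e).

Let partial_span (r : nat -> A) j : set A :=
  [set y | exists z (c : nat -> A), I z /\ y = z + \sum_(i < j) c i ^+ (p ^ e) * r i].

(** [r j] is not in the span of its predecessors: applying [phi 0], [phi 1] and so on to a relation
    forces its coefficients into [m] one by one, and finally [phi j (r j)] as well. *)
Lemma split_family_series k phi r : split_family p e (max_spec A) k phi r ->
  forall j, (j <= k)%N -> comp_series p e I (partial_span r j) j.
Proof.
move=> [lphi tri diag]; have sI := split_ideal_fsub A p e; have [I0 ID IM] := sI.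
have IN j : I `<=` partial_span r j.
  move=> y Iy; exists y, (fun=> 0); split=> //.
  by rewrite big1 ?addr0 // => i _; rewrite (frob_exp0 chAp) mul0r.
elim=> [|j IH] jk.
  suff -> : partial_span r 0 = I by exact: CompSeries0.
  rewrite eqEsubset; split=> [_ [z [c [Iz ->]]]|]; first by rewrite big_ord0 addr0.
  exact: IN.
have -> : partial_span r j.+1 = fadd p e (partial_span r j) (r j).
  rewrite eqEsubset; split=> [_ [z [c [Iz ->]]]|_ [a [_ [[z [c [Iz ->]]] ->]]]].
    exists (c j), (z + \sum_(i < j) c i ^+ (p ^ e) * r i); split; first by exists z, c.
    by rewrite big_ord_recr addrA.
  exists z, (fun i => if (i < j)%N then c i else a); split=> //.
  rewrite big_ord_recr /= ltnn addrA; congr (_ + _ + _).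
  by apply: eq_bigr => i _; rewrite ltn_ord.
apply: CompSeriesS; first exact: IH (ltnW jk).
  move=> [z [c [Iz rj]]].
  have img i : phi i (r j) = phi i z + \sum_(l < j) c l * phi i (r l).
    by rewrite {1}rj (lphi i).1 flin_sum.
  have cm i : (i < j)%N -> c i \in m.
    elim/ltn_ind: i => i IHi ij.
    have := img i; rewrite tri ?ij // => /esym/eqP; rewrite addrC addr_eq0 => /eqP h.
    have : \sum_(l < j) c l * phi i (r l) \in m by rewrite h rpredN Iz.
    rewrite (bigD1 (Ordinal ij)) //= rpredDr.
      rewrite -max_specE prime_idealrM => /orP[//|].
      by rewrite (negPf (diag _ (ltn_trans ij jk))).
    apply: rpred_sum => l /eqP li; have [lt_li|le_il] := ltnP l i.
      by rewrite mulrC idealMr // IHi.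
    rewrite tri ?mulr0 ?idealr0 // (ltn_trans (ltn_ord l) jk) andbT.
    rewrite ltn_neqAle le_il andbT; apply/eqP => il; apply: li.
    exact: val_inj.
  have := diag j jk; rewrite max_specE (img j) rpredD //; first exact: Iz.
  by apply: rpred_sum => l _; rewrite mulrC idealMr // cm.
move=> a am; apply: IN => psi lpsi; rewrite lpsi.2 mulrC.
by rewrite idealMr.
Qed.

Lemma splits_le k N : comp_series p e I setT N -> splits p e (max_spec A) k -> (k <= N)%N.
Proof.
move=> cs [phi [r sf]]; have sI := split_ideal_fsub A p e.
have [c [hc sc]] := comp_series_chain chAp sI (split_family_series sf (leqnn k)).
apply: (comp_series_max chAp sI cs (c := c)) => // i ik.
by have [? ? _] := hc i ik; split.
Qed.

(** Take a longest family. Elimination turns any [x] into some [y] killed by all [phi i]; if [y]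
    were not in [I], a map detecting it would prolong the family. So the span is everything. *)
Lemma splits_rank N : comp_series p e I setT N -> splits p e (max_spec A) N.
Proof.
move=> cs; have sI := split_ideal_fsub A p e.
have D0 : exists k, `[< splits p e (max_spec A) k >].
  exists 0%N; apply/asboolP; exists (fun _ _ => 0), (fun=> 0); split=> //.
    by move=> i; split=> *; rewrite ?addr0 ?mulr0.
have DN k : `[< splits p e (max_spec A) k >] -> (k <= N)%N.
  by move=> /asboolP; exact: splits_le.
have [k /asboolP[phi [r sf]] maxk] := ex_maxnP D0 DN.
suff kN : k = N by rewrite -kN; exists phi, r.
have [lphi tri diag] := sf.
apply: (comp_series_uniq chAp sI _ cs); have := split_family_series sf (leqnn k).
suff -> : partial_span r k = setT by [].
rewrite eqEsubset; split=> // x _.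
have [c hc] : exists c : nat -> A, forall i, (i < k)%N ->
    phi i (x - \sum_(l < k) c l ^+ (p ^ e) * r l) = 0.
  (* Subtracting a multiple of [r j] keeps the earlier [phi i] at 0, as the matrix vanishes above
     the diagonal. *)
  suff h j : (j <= k)%N -> exists c : nat -> A, forall i, (i < j)%N ->
      phi i (x - \sum_(l < j) c l ^+ (p ^ e) * r l) = 0 by exact: h.
  elim: j => [|j IH] jk; first by exists (fun=> 0).
  have [c hc] := IH (ltnW jk); have [u uj] := local_unit (diag j jk).
  pose x' := x - \sum_(l < j) c l ^+ (p ^ e) * r l.
  exists (fun l => if (l < j)%N then c l else phi j x' * u) => i.
  have -> : x - \sum_(l < j.+1) (if (l < j)%N then c l else phi j x' * u) ^+ (p ^ e) * r l =
      x' - (phi j x' * u) ^+ (p ^ e) * r j.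
    rewrite big_ord_recr /= ltnn opprD addrA /x'; congr (_ - _ - _).
    by apply: eq_bigr => l _; rewrite ltn_ord.
  rewrite (lphi i).1 (flinN _ (lphi i)) (lphi i).2.
  rewrite ltnS leq_eqVlt => /orP[/eqP->|ij]; first by rewrite -mulrA uj mulr1 subrr.
  by rewrite hc // tri ?ij // mulr0 subrr.
exists (x - \sum_(l < k) c l ^+ (p ^ e) * r l), c; rewrite subrK; split=> //.
set y := x - _ in hc *; apply: contrapT => nIy.
have [psi [lpsi psiy]] : exists psi, flin p e psi /\ psi y \notin m.
  apply: contrapT => h; apply: nIy => psi lpsi; apply: contraT => psiy.
  by case: h; exists psi.
have : (k.+1 <= k)%N; last by rewrite ltnn.
apply: maxk; apply/asboolP.
exists (fun i => if (i < k)%N then phi i else psi), (fun i => if (i < k)%N then r i else y).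
split=> [i|i j|i]; first by case: ifP.
  rewrite ltnS => /andP[ij jk]; rewrite (leq_trans ij jk); case: ifP => jk'.
    by rewrite tri // ij.
  exact: hc (leq_trans ij jk).
by rewrite ltnS => ik; case: ifP => ik'; [exact: diag|exact: psiy].
Qed.

Lemma splitsW (R : comNzRingType) (P : Spec R) k l : (l <= k)%N -> splits p e P k -> splits p e P l.
Proof.
move=> lk [phi [r [lphi tri diag]]]; exists phi, r; split=> // [i j /andP[ij jl]|i il].
  by rewrite tri // ij (leq_trans jl lk).
exact: diag (leq_trans il lk).
Qed.

Lemma splitsP N : comp_series p e I setT N ->
  forall k, splits p e (max_spec A) k <-> (k <= N)%N.
Proof.
move=> cs k; split; first exact: splits_le.
by move=> kN; exact: splitsW kN (splits_rank cs).
Qed.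

Lemma split_ideal_length : noetherian A -> exists n, comp_series p 0 I setT n.
Proof.
move=> nA; apply: finite_length => //; first exact: split_ideal_ideal.
move=> a am; exists (p ^ e)%N => phi lphi.
by rewrite -[_ ^+ _]mulr1 lphi.2 mulrC idealMr.
Qed.

Lemma comp_series_frob_iter n d k : pbasis p (max_spec A) d ->
  comp_series p 0 I setT n -> comp_series p k I setT (n * d ^ k).
Proof.
move=> [b bind bspan] cs; elim: k => [|k IH]; first by rewrite muln1.
have sIk : fsub p k I.
  by have [h0 hD hM] := split_ideal_ideal A p e; split=> // a x; exact: hM.
have -> : (n * d ^ k.+1 = n * d ^ k * d)%N by rewrite expnSr mulnA.
exact: (comp_series_frob chAp sIk bind bspan IH).
Qed.

(** Every hull gives the same length and one exists, so [xget] returns this value and not its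
    default. *)
Lemma splitting_number n (g : nat -> A) N : noetherian A -> frob_gen p e n g ->
  comp_series p 0 I setT N ->
  s_ chAp e = N%:R / ((p ^ e) ^ krull_dim A)%:R.
Proof.
move=> nA gen cs; have [E [psi hull]] := injective_hull_exists chAp.
have lenE (E' : lmodType A) (psi' : {linear residue_field A -> E'}) :
    injective_hull psi' -> length (@K_ p A chAp e E' psi') = N.
  move=> [injE inj_psi _]; apply: length_K_ cs => r; split.
    exact: pure_tensor_split.
  exact: split_pure_tensor gen injE.
rewrite /s_; case: xgetP => [v _ [E' [psi' [hull' ->]]]|/(_ (N%:R / ((p ^ e) ^ krull_dim A)%:R))[]].
  by rewrite lenE.
by exists E, psi; split=> //; rewrite lenE.
Qed.

End LocalRank.

(** * Free summands under localization *)

Section SplitLocalization.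
Variables (R : comNzRingType) (p : nat) (chRp : p \in [pchar R]) (e : nat).
Variables (noethR : noetherian R) (n : nat) (g : nat -> R) (gen : frob_gen p e n g).
Variable P : Spec R.
Local Notation L := (localization P).
Local Notation f := (to_loc P : {rmorphism R -> L}).

Let chL : p \in [pchar L] := loc_pchar P chRp.

Let fden (a : L) : exists s x, s \notin P /\ f s * a = f x. Proof. exact: loc_fracP. Qed.

Let f_unit_inj s (a : L) : s \notin P -> f s * a = 0 -> a = 0.
Proof.
by move=> /to_loc_unit[u us] sa; rewrite -[a]mul1r -us -mulrA sa mulr0.
Qed.

Let q_gt0 : (0 < p ^ e)%N. Proof. exact: frob_exp_gt0 chRp e. Qed.

Lemma common_annihilator k (x : nat -> R) : (forall i, (i < k)%N -> f (x i) = 0) ->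
  exists2 t, t \notin P & forall i, (i < k)%N -> t * x i = 0.
Proof.
elim: k => [|k IH] hx; first by exists 1 => //; exact: notin_1.
have [i ik|t tP ht] := IH; first exact: hx (leqW ik).
have /to_loc_eq0[s sP sx] := hx k (ltnSn k).
exists (s * t) => [|i]; first exact: notin_mul.
rewrite ltnS leq_eqVlt => /orP[/eqP->|ik]; first by rewrite mulrAC sx mul0r.
by rewrite -mulrA ht // mulr0.
Qed.

Lemma flin_localize phi : flin p e phi ->
  exists2 psi : L -> L, flin p e psi & forall y, psi (f y) = f (phi y).
Proof.
move=> lphi; have genL := @frob_gen_localization R P p chRp e n g gen.
have [|psi lpsi psiE] := flin_of_images chL (d := fun i => f (phi (g i))) genL.
  move=> a ha; have [s [x [sP sx]]] := common_den fden n a.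
  have : f (\sum_(i < n) x i ^+ (p ^ e) * g i) = 0.
    rewrite rmorph_sum (eq_bigr (fun i : 'I_n => f s ^+ (p ^ e) * (a i ^+ (p ^ e) * f (g i)))).
      by rewrite -mulr_sumr ha mulr0.
    by move=> i _; rewrite mulrA -exprMn sx // rmorphM rmorphXn.
  move=> /to_loc_eq0[t tP ht].
  have : t * \sum_(i < n) x i * phi (g i) = 0.
    rewrite -(flin_sum _ _ _ lphi) -lphi.2 -[X in t ^+ X](prednK q_gt0) exprSr -mulrA ht mulr0.
    exact: flin0 lphi.
  move=> /(congr1 f); rewrite rmorph0 rmorphM => /(f_unit_inj tP) h.
  apply: (f_unit_inj sP); rewrite -[RHS]h rmorph_sum mulr_sumr.
  by apply: eq_bigr => i _; rewrite mulrA sx // rmorphM.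
exists psi => // y; have [c ->] := gen y.
rewrite (flin_sum _ _ _ lphi) !rmorph_sum.
rewrite (eq_bigr (fun i : 'I_n => f (c i) ^+ (p ^ e) * f (g i))); last first.
  by move=> i _; rewrite rmorphM rmorphXn.
rewrite (psiE (fun i => f (c i))).
by apply: eq_bigr => i _; rewrite rmorphM.
Qed.

(** [R^(e)] is finitely presented: [s] clears the denominators on the generators, and [t] kills the
    images of the finitely many relations, which are known to vanish only in the localization. *)
Lemma flin_descend (psi : L -> L) : flin p e psi ->
  exists s phi, [/\ s \notin P, flin p e phi & forall y, f (phi y) = f s * psi (f y)].
Proof.
move=> lpsi; have [s [x [sP sx]]] := common_den fden n (fun i => psi (f (g i))).
have [|||m [v [vrel vgen]]] := @noetherian_fun R n
  [set a : nat -> R | \sum_(i < n) a i ^+ (p ^ e) * g i = 0] noethR.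
- by rewrite /mkset big1 // => i _; rewrite (frob_exp0 chRp) mul0r.
- move=> y z hy hz; rewrite /mkset.
  under eq_bigr => i _ do rewrite (frob_expD chRp) mulrDl.
  by rewrite big_split /= hy hz addr0.
- move=> a y hy; rewrite /mkset.
  under eq_bigr => i _ do rewrite exprMn -mulrA.
  by rewrite -mulr_sumr hy mulr0.
have sumE (c : nat -> R) : f (\sum_(i < n) c i * x i) =
    f s * psi (f (\sum_(i < n) c i ^+ (p ^ e) * g i)).
  rewrite !rmorph_sum (eq_bigr (fun i : 'I_n => f s * (f (c i) * psi (f (g i))))); last first.
    by move=> i _; rewrite rmorphM mulrCA sx.
  rewrite -mulr_sumr; congr (_ * _).
  rewrite -(@flin_sum _ _ _ psi n (fun i => f (c i)) (fun i => f (g i)) lpsi).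
  by congr psi; apply: eq_bigr => i _; rewrite rmorphM rmorphXn.
have [|t tP ht] := @common_annihilator m (fun j => \sum_(i < n) v j i * x i).
  move=> j _; rewrite sumE; have := vrel j; rewrite /mkset => ->.
  by rewrite rmorph0 (flin0 lpsi) mulr0.
have [|phi lphi phiE] := flin_of_images chRp (d := fun i => t * x i) gen.
  move=> a /vgen[c hc].
  rewrite (eq_bigr (fun i : 'I_n => \sum_(j < m) c j * (t * (v j i * x i)))); last first.
    move=> i _; rewrite hc // mulr_suml; apply: eq_bigr => j _.
    by rewrite -mulrA; congr (_ * _); rewrite mulrCA.
  rewrite exchange_big /= big1 // => j _.
  by rewrite -!mulr_sumr ht // mulr0.
exists (t * s), phi; split=> // [|y]; first exact: notin_mul.
have [c yE] := gen y; rewrite {1}yE phiE rmorphM -mulrA yE -sumE -rmorphM; congr (to_loc P _).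
by rewrite mulr_sumr; apply: eq_bigr => i _; rewrite mulrCA.
Qed.

Lemma splits_localization k : splits p e P k <-> splits p e (max_spec L) k.
Proof.
have f_max x : (f x \in max_spec L) = (x \in P) by exact: loc_max_to_loc.
split=> [[phi [r [lphi tri diag]]]|[psi [rho [lpsi tri diag]]]].
  have /choice[psi hpsi] : forall i, exists psi : L -> L, flin p e psi /\
      forall y, psi (f y) = f (phi i y).
    by move=> i; have [psi ? ?] := flin_localize (lphi i); exists psi.
  exists psi, (fun j => f (r j)); split=> [i|i j ij|i ik].
  - by have [] := hpsi i.
  - by have [_ ->] := hpsi i; rewrite tri // rmorph0.
  - by have [_ ->] := hpsi i; rewrite f_max; exact: diag.
have /choice[phi hphi] : forall i, exists phi : R -> R, flin p e phi /\
    exists2 s, s \notin P & forall y, f (phi y) = f s * psi i (f y).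
  move=> i; have [s [phi [sP lphi phiE]]] := flin_descend (lpsi i).
  by exists phi; split=> //; exists s.
have /choice[r hr] : forall j, exists r : R, exists2 s, s \notin P &
    f r = f s ^+ (p ^ e) * rho j.
  move=> j; have [s [x [sP sx]]] := fden (rho j).
  exists (s ^+ (p ^ e).-1 * x), s => //.
  by rewrite rmorphM rmorphXn -sx mulrA -exprSr prednK.
have fphi i j : exists2 s, s \notin P & f (phi i (r j)) = f s * psi i (rho j).
  have [_ [s sP hs]] := hphi i; have [t tP ht] := hr j.
  exists (s * t); first exact: notin_mul.
  by rewrite hs ht (lpsi i).2 rmorphM mulrA.
(* The entries above the diagonal vanish only in [R_P]; multiplying [phi i] by [t i] makes them
   vanish in [R]. *)
have /choice[t ht] : forall i, exists t, t \notin P /\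
    forall j, (i < j < k)%N -> t * phi i (r j) = 0.
  move=> i; have [|t tP ht] := @common_annihilator k
      (fun j => if (i < j)%N then phi i (r j) else 0).
    move=> j jk; case: ifP => ij; last exact: rmorph0.
    by have [s _ ->] := fphi i j; rewrite tri ?ij // mulr0.
  by exists t; split=> // j /andP[ij jk]; have := ht j jk; rewrite ij.
exists (fun i x => t i * phi i x), r; split=> [i|i j ij|i ik].
- by apply: flin_scale; have [] := hphi i.
- by have [_] := ht i; apply.
- apply: notin_mul; first by have [] := ht i.
  rewrite -f_max; have [s sP ->] := fphi i i.
  by rewrite prime_idealrM negb_or f_max sP diag.
Qed.

End SplitLocalization.

(** The zeros above the diagonal hold in [R], so the same family works at every prime that misses
    the product [x] of the diagonal entries. *)
Lemma splits_open (R : comNzRingType) (p e : nat) (P : Spec R) k : splits p e P k ->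
  nbhs P [set Q : Spec R | splits p e Q k].
Proof.
move=> [phi [r [lphi tri diag]]].
have [x xP hx] : exists2 x, x \notin P & forall Q : Spec R, x \notin Q ->
    forall i, (i < k)%N -> phi i (r i) \notin Q.
  elim: k {tri} diag => [|k IH] diag; first by exists 1 => //; exact: notin_1.
  have [i ik|x xP hx] := IH; first exact: diag (leqW ik).
  exists (x * phi k (r k)) => [|Q]; first exact: notin_mul (diag k (ltnSn k)).
  rewrite prime_idealrM negb_or => /andP[xQ kQ] i.
  by rewrite ltnS leq_eqVlt => /orP[/eqP->|]; [|exact: hx].
have oU : open (~` @zariski_closed R [set x]) by exists [set x].
apply: (filterS _ (open_nbhs_nbhs (conj oU _))).
  move=> Q xQ; exists phi, r; split=> //; apply: hx; apply/negP => xQ'.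
  by apply: xQ => _ ->.
by move=> /(_ x erefl); apply/negP.
Qed.

(** * Values of the splitting numbers and semicontinuity *)

Section Values.
Variables (p : nat) (R : comNzRingType) (chRp : p \in [pchar R]).
Variables (noethR : noetherian R) (finR : F_finite chRp) (e : nat).

Local Notation dim_alph P := (krull_dim (localization P) + alpha p (localization P))%N.

Lemma splitting_values (P : Spec R) : exists N,
  [/\ forall k, splits p e P k <-> (k <= N)%N &
      s_at chRp e P = N%:R / ((p ^ e) ^ dim_alph P)%:R].
Proof.
have [n1 [g1 gen1]] := F_finite_gen 1 finR; have [n [g gen]] := F_finite_gen e finR.
have chL : p \in [pchar localization P] := loc_pchar P chRp.
have nL := @noetherian_localization R P noethR.
have genL := @frob_gen_localization R P p chRp e n g gen.
have [N0 cs0] := split_ideal_length chL e nL.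
have pb := pbasis_localization chRp (pbasis_expn_alpha chRp gen1 P).
have cse := comp_series_frob_iter chL e pb cs0.
(* [N0] is the length of [K_e]. At level [e] it is multiplied by [[k : k^p]^e = q^alpha], which also
   enters the denominator. *)
exists (N0 * (p ^ alpha p (localization P)) ^ e)%N; split.
  by move=> k; rewrite (splits_localization chRp noethR gen); exact: splitsP.
rewrite /s_at (@splitting_number (localization P) p (loc_pchar P chRp) e n _ N0 nL genL cs0).
rewrite expnD -!expnM natrM natrM.
rewrite [(e * alpha _ _)%N]mulnC -mulf_div divff ?mulr1 //.
by rewrite pnatr_eq0 -lt0n expn_gt0 prime_gt0 // (pcharf_prime chRp).
Qed.

End Values.

Theorem corollary2p5 (K : realType) (p : nat) (R : comNzRingType)
    (chRp : p \in [pchar R]) (noethR : noetherian R) (finR : F_finite chRp)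
    (eqdimR : locally_equidimensional R) (e : nat) :
  [/\ lower_semicontinuous (fun P : Spec R => (ratr (s_at chRp e P) : K)%:E),
      lower_semicontinuous (fun P : Spec R => (ratr (a_at chRp e P) : K)%:E)
    & forall P0 : Spec R, exists2 c : rat, c != 0 &
        forall P : Spec R, connected_component [set: Spec R] P0 P ->
          a_at chRp e P = c * s_at chRp e P].
Proof.
have [n1 [g1 gen1]] := F_finite_gen 1 finR.
pose d (P : Spec R) := (krull_dim (localization P) + alpha p (localization P))%N.
pose q (P : Spec R) : rat := ((p ^ e) ^ d P)%:R.
have q_gt0 P : 0 < q P.
  by rewrite ltr0n expn_gt0 expn_gt0 prime_gt0 // (pcharf_prime chRp).
have aE P : a_at chRp e P = s_at chRp e P * q P by [].
have vals P := splitting_values noethR finR e P.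
split=> [P x|P x|P0].
- have [N [splitN sN]] := vals P; rewrite lte_fin => xN.
  (* Near [P] the numerator of [N / q^d] does not drop and the exponent [d] is constant. *)
  exists ([set Q | splits p e Q N] `&` [set Q | d Q = d P]).
    apply: filterI; first by apply: splits_open; apply/splitN.
    apply: open_nbhs_nbhs; split=> //.
    exact: (dim_alpha_open chRp noethR gen1 eqdimR (d P)).
  move=> Q [/= sQ dQ]; rewrite lte_fin; apply: lt_le_trans xN _.
  have [M [splitM sM]] := vals Q; rewrite ler_rat sN sM -/(d Q) -/(d P) dQ.
  rewrite ler_pM2r ?invr_gt0 //; first by rewrite ler_nat; apply/splitM.
  exact: q_gt0.
- have [N [splitN sN]] := vals P; rewrite lte_fin => xN.
  (* The powers of [q] cancel, leaving the free rank itself. *)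
  have aN Q M : s_at chRp e Q = M%:R / ((p ^ e) ^ d Q)%:R -> a_at chRp e Q = M%:R.
    by move=> sM; rewrite aE sM divfK // gt_eqF // q_gt0.
  exists [set Q | splits p e Q N]; first by apply: splits_open; apply/splitN.
  move=> Q /= sQ; rewrite lte_fin; apply: lt_le_trans xN _.
  have [M [splitM sM]] := vals Q.
  by rewrite ler_rat (aN _ _ sM) (aN _ _ sN) ler_nat; apply/splitM.
exists (q P0) => [|P PP0]; first by rewrite gt_eqF.
rewrite aE mulrC /q; congr (((p ^ e) ^ _)%:R * _).
by rewrite /d (dim_alpha_component chRp noethR gen1 eqdimR PP0).
Qed.
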